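(* Let $\mathscr{M}=\{m_n\}_{n\in\mathbb{N}_0}$ be a weight sequence, $N\ge1$, and let $P_1(D),\dots,P_k(D)$ be constant coefficient linear partial differential operators on $\mathbb{T}^N$. The system $$P_j(D)u=f_j,\qquad u\in\mathscr{D}'_{\mathscr{M}}(\mathbb{T}^N),\ f_j\in\mathscr{D}'_{\mathscr{M}}(\mathbb{T}^N),\qquad j=1,\dots,k,$$ is globally $\mathscr{M}$-hypoelliptic if and only if for every $\varepsilon>0$ there exists $R_\varepsilon>0$ such that $$|P(\xi)|\ge\inf_{n\in\mathbb{N}_0}\left(\frac{m_n\cdot n!}{\varepsilon^n(1+|\xi|)^n}\right),\qquad\forall\xi\in\mathbb{Z}^N\text{ with }|\xi|\ge R_\varepsilon.$$
   Context: $\mathbb{N}=\{1,2,\dots\}$, $\mathbb{N}_0=\mathbb{N}\cup\{0\}$, $\mathbb{T}^N=\mathbb{R}^N/2\pi\mathbb{Z}^N$, and $|\xi|$ is the Euclidean norm of $\xi\in\mathbb{Z}^N$. A weight sequence is a sequence $\mathscr{M}=\{m_n\}_{n\in\mathbb{N}_0}$ of positive reals with: $m_0=m_1=1$; $m_n^2\le m_{n-1}m_{n+1}$ for all $n\in\mathbb{N}$; and there is $H>1$ with $m_{j+k}\le H^{j+k}m_jm_k$ for all $j,k\in\mathbb{N}_0$. $\mathcal{E}_{\mathscr{M}}(\mathbb{T}^N)$ is the space of $f\in C^\infty(\mathbb{T}^N)$ (complex-valued) for which there are $C,h>0$ with $|D^\alpha f(x)|\le C h^{|\alpha|}m_{|\alpha|}|\alpha|!$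 for all $x\in\mathbb{T}^N$, $\alpha\in\mathbb{N}_0^N$, where $D=-i\partial$. For $h>0$, $\mathcal{E}_{\mathscr{M},h}(\mathbb{T}^N)$ is the Banach space of those $f$ with $\|f\|_{\mathscr{M},h}:=\sup_{x,\alpha}\frac{|D^\alpha f(x)|}{h^{|\alpha|}m_{|\alpha|}|\alpha|!}<\infty$. $\mathcal{E}_{\mathscr{M}}(\mathbb{T}^N)$ carries the locally convex inductive limit topology of the spaces $\mathcal{E}_{\mathscr{M},h_n}(\mathbb{T}^N)$ for any strictly increasing positive sequence $h_n\to+\infty$ (the topology does not depend on the choice). $\mathscr{D}'_{\mathscr{M}}(\mathbb{T}^N)$ is the topological dual of $\mathcal{E}_{\mathscr{M}}(\mathbb{T}^N)$; $\mathcal{E}_{\mathscr{M}}(\mathbb{T}^N)$ is regarded as a subspace of it via $\langle f,\varphi\rangle=\int_{\mathbb{T}^N}f\varphi\,dx$, and differential operators act on $\mathscr{D}'_{\mathscr{M}}(\mathbb{T}^N)$ by duality. The symbol of the system is $P(\xi)=(P_1(\xi),\dots,P_k(\xi))$, $\xi\in\mathbb{Z}^N$, where $P_j(D)e^{ix\xi}=P_j(\xi)e^{ix\xi}$, and $|P(\xi)|:=\max_{1\le j\le k}|P_j(\xi)|$. The system is globally $\mathscr{M}$-hypoelliptic if: whenever $u\in\mathscr{D}'_{\mathscr{M}}(\mathbb{T}^N)$ and $P_j(D)u\in\mathcal{E}_{\mathscr{M}}(\mathbb{T}^N)$ for all $j=1,\dots,k$, then $u\in\mathcal{E}_{\mathscr{M}}(\mathbb{T}^N)$.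 *)

(* Defs.v *)
From HB Require Import structures.
From mathcomp Require Import all_boot all_order all_algebra.
From mathcomp Require Import all_classical all_reals all_analysis.
From mathcomp Require Import complex.
(* The notations of mpoly clash with those of MathComp-Analysis. *)
From mathcomp Require Import -(notations) mpoly.
From mathcomp Require Import ring lra zify.

Set Implicit Arguments.
Unset Strict Implicit.
Unset Printing Implicit Defensive.

Import Order.TTheory GRing.Theory Num.Theory.
Import numFieldNormedType.Exports.
Import Normc.

Local Open Scope classical_set_scope.
Local Open Scope complex_scope.
Local Open Scope ring_scope.

Record weight_seq (R : realType) := WeightSeq {
  weight :> nat -> R;
  weight_gt0 : forall n, 0 < weight n;
  weight0 : weight 0 = 1;
  weight1 : weight 1 = 1;
  weight_logconvex : forall n, weight n.+1 ^+ 2 <= weight n * weight n.+2;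
  weight_submult : exists2 H : R, 1 < H &
    forall j k, weight (j + k) <= H ^+ (j + k) * weight j * weight k }.

Section PartialDerivatives.
Context {R : realType} {N : nat}.
Implicit Types (g : 'rV[R]_N -> R) (f : 'rV[R]_N -> R[i]) (a : multinom N).

(* A function on the torus is a function on R^N that is 2 pi-periodic in each
   coordinate.  The library has no derivative of R[i]-valued functions of a
   real vector, so derivatives are taken on real and imaginary parts. *)
Definition rpart (j : 'I_N) g : 'rV[R]_N -> R := fun x => 'D_(delta_mx 0 j) g x.

(* C^oo: all iterated partial derivatives, in any order, exist and are
   continuous. *)
Definition rsmooth g := forall s : seq 'I_N,
  continuous (foldr rpart g s) /\
  forall j x, derivable (foldr rpart g s) x (delta_mx 0 j).

Definition cpart (j : 'I_N) f : 'rV[R]_N -> R[i] :=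
  fun x => rpart j (@complex.Re R \o f) x +i* rpart j (@complex.Im R \o f) x.

Definition smooth f :=
  rsmooth (@complex.Re R \o f) /\ rsmooth (@complex.Im R \o f).

(* The sequence 0, .., 0, 1, .., 1, .., in which j occurs a j times. *)
Definition mindex_seq a : seq 'I_N := flatten [seq nseq (a j) j | j <- enum 'I_N].

(* D^a with D = -i d *)
Definition Dmulti a f : 'rV[R]_N -> R[i] :=
  fun x => (- 'i) ^+ mdeg a * foldr cpart f (mindex_seq a) x.

Definition torus_periodic f :=
  forall (j : 'I_N) x, f (x + (2 * pi) *: delta_mx 0 j) = f x.

Lemma Schwarz g i j : rsmooth g -> rpart i (rpart j g) = rpart j (rpart i g).
Proof.
move=> gs; apply/funext => x.
have key (i' j' : 'I_N) (h : R) : 0 < h -> exists c d : R,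
    [/\ 0 < c < h, 0 < d < h &
    g (x + h *: delta_mx 0 i' + h *: delta_mx 0 j') - g (x + h *: delta_mx 0 i')
    - (g (x + h *: delta_mx 0 j') - g x) =
    h * h * rpart j' (rpart i' g) (x + c *: delta_mx 0 i' + d *: delta_mx 0 j')].
  move=> h0.
  have line (F : 'rV[R]_N -> R) (k : 'I_N) y t :
      derivable F (y + t *: delta_mx 0 k) (delta_mx 0 k) ->
      is_derive t 1 (fun s : R => F (y + s *: delta_mx 0 k))
        (rpart k F (y + t *: delta_mx 0 k)).
    have E : (fun h0 : R => h0^-1 *: (F (y + (h0 *: (1:R) + t) *: delta_mx 0 k) -
                F (y + t *: delta_mx 0 k))) =
             (fun h0 : R => h0^-1 *: ((F \o shift (y + t *: delta_mx 0 k))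
               (h0 *: delta_mx 0 k) - F (y + t *: delta_mx 0 k))).
      apply/funext => z /=; congr (_ *: (F _ - _)).
      by rewrite scaler1 scalerDl addrCA.
    move=> dF; apply: DeriveDef; first by rewrite /derivable /= E.
    by rewrite /rpart /derive /= E.
  have [_ d1] := gs [::]; have [_ d2] := gs [:: i'].
  have D1 y t k := line g k y t (d1 k _).
  have D2 y t k := line (rpart i' g) k y t (d2 k _).
  pose G s := g (x + h *: delta_mx 0 j' + s *: delta_mx 0 i') -
              g (x + s *: delta_mx 0 i').
  have dG (t : R) : is_derive t (1 : R) G
     (rpart i' g (x + h *: delta_mx 0 j' + t *: delta_mx 0 i') -
      rpart i' g (x + t *: delta_mx 0 i')).
    by apply: is_deriveB.
  have [c /[!in_itv]/= c0h Gc] := MVT h0 (fun t _ => dG t)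
     (derivable_within_continuous (fun t _ => @ex_derive _ _ _ _ _ _ _ (dG t))).
  pose K s := rpart i' g (x + c *: delta_mx 0 i' + s *: delta_mx 0 j').
  have dK (t : R) : is_derive t (1 : R) K
     (rpart j' (rpart i' g) (x + c *: delta_mx 0 i' + t *: delta_mx 0 j')).
    exact: D2.
  have [d /[!in_itv]/= d0h Kd] := MVT h0 (fun t _ => dK t)
     (derivable_within_continuous (fun t _ => @ex_derive _ _ _ _ _ _ _ (dK t))).
  exists c, d; split=> //.
  move: Gc Kd; rewrite /G /K !scale0r !addr0 subr0.
  rewrite [x + c *: _ + h *: _]addrAC [x + h *: _ + h *: _]addrAC => Gc Kd.
  by rewrite Gc Kd; ring.
have near_eq (h : R) : 0 < h -> exists y z, [/\ `|y - x| <= 2 * h, `|z - x| <= 2 * h &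
    rpart i (rpart j g) y = rpart j (rpart i g) z].
  move=> h0; have [c [d [c0h d0h E1]]] := key j i h h0.
  have [c' [d' [c0h' d0h' E2]]] := key i j h h0.
  have bnd (k l : 'I_N) (u v : R) : 0 < u < h -> 0 < v < h ->
      `|x + u *: delta_mx 0 k + v *: delta_mx 0 l - x| <= 2 * h.
    have nd m w : 0 < w < h -> `|w *: delta_mx 0 m : 'rV[R]_N| <= h.
      move=> /andP[w0 wh]; rewrite normrZ gtr0_norm// -[leRHS]mulr1.
      apply: ler_pM; [exact: ltW|exact: normr_ge0|exact: ltW|].
      rewrite -[leLHS]/(mx_norm _) mx_normrE; apply: bigmax_le => // p _.
      by rewrite mxE; case: (_ && _); rewrite ?normr1 ?normr0.
    move=> uh vh; rewrite addrAC [x + _]addrC addrK mulr_natl mulr2n.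
    by rewrite (le_trans (ler_normD _ _))// lerD// nd.
  exists (x + c *: delta_mx 0 j + d *: delta_mx 0 i),
         (x + c' *: delta_mx 0 i + d' *: delta_mx 0 j).
  split; [exact: bnd|exact: bnd|].
  have h20 : h * h != 0 by rewrite mulf_neq0 ?gt_eqF.
  suff E : h * h * rpart i (rpart j g) (x + c *: delta_mx 0 j + d *: delta_mx 0 i) =
           h * h * rpart j (rpart i g) (x + c' *: delta_mx 0 i + d' *: delta_mx 0 j).
    exact: (mulfI h20 E).
  refine (etrans (esym E1) (etrans _ E2)).
  rewrite [x + h *: _ + h *: _]addrAC.
  ring.
have [c1 _] := gs [:: i; j]; have [c2 _] := gs [:: j; i].
apply/eqP; rewrite -subr_eq0 -normr_le0.
apply/ler_addgt0Pr => e e0; rewrite add0r.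
have e20 : 0 < e / 2 by rewrite divr_gt0.
have /cvgrPdist_lt/(_ _ e20) := c1 x.
move=> /nbhs_normP[/= r1 /= r10 near1].
have /cvgrPdist_lt/(_ _ e20) := c2 x.
move=> /nbhs_normP[/= r2 /= r20 near2].
pose h := Num.min r1 r2 / 3.
have m0 : 0 < Num.min r1 r2 by rewrite lt_min r10.
have h0 : 0 < h by rewrite divr_gt0.
have h1 : 2 * h < r1.
  have : Num.min r1 r2 <= r1 by rewrite ge_min lexx.
  by rewrite /h; lra.
have h2 : 2 * h < r2.
  have : Num.min r1 r2 <= r2 by rewrite ge_min lexx orbT.
  by rewrite /h; lra.
have [y [z [yx zx yz]]] := near_eq h h0.
have n1 : `|rpart i (rpart j g) x - rpart i (rpart j g) y| < e / 2.
  by apply: near1; rewrite /= distrC; exact: le_lt_trans yx h1.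
have n2 : `|rpart j (rpart i g) x - rpart j (rpart i g) z| < e / 2.
  by apply: near2; rewrite /= distrC; exact: le_lt_trans zx h2.
rewrite yz in n1; rewrite distrC in n2.
rewrite [leRHS]splitr; apply/ltW.
exact: le_lt_trans (ler_distD (rpart j (rpart i g) z) _ _) (ltrD n1 n2).
Qed.

Lemma rsmooth_foldr g t : rsmooth g -> rsmooth (foldr rpart g t).
Proof. by move=> gs s; rewrite -foldr_cat; exact: gs. Qed.

Lemma foldr_rpart_perm g s t : rsmooth g -> perm_eq s t ->
  foldr rpart g s = foldr rpart g t.
Proof.
move=> gs; have move1 i t1 t2 :
    foldr rpart g (i :: t1 ++ t2) = foldr rpart g (t1 ++ i :: t2).
  elim: t1 => //= k t1 IH; rewrite -IH /=.
  exact: Schwarz (rsmooth_foldr (t1 ++ t2) gs).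
have moves s1 s2 s3 :
    foldr rpart g (s1 ++ s2 ++ s3) = foldr rpart g (s2 ++ s1 ++ s3).
  elim: s1 s3 => //= i s1 IH s3; rewrite -(move1 i s2 (s1 ++ s3)) /=.
  by rewrite IH.
exact: (catCA_perm_subst moves).
Qed.

Lemma rsmooth_lin g1 g2 (b : R) : rsmooth g1 -> rsmooth g2 ->
  rsmooth (fun x => b * g1 x + g2 x) /\
  forall s, foldr rpart (fun x => b * g1 x + g2 x) s =
    fun x => b * foldr rpart g1 s x + foldr rpart g2 s x.
Proof.
move=> g1s g2s.
have E s : foldr rpart (fun x => b * g1 x + g2 x) s =
    fun x => b * foldr rpart g1 s x + foldr rpart g2 s x.
  elim: s => //= j s ->; apply/funext => x.
  have [_ d1] := g1s s; have [_ d2] := g2s s.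
  rewrite /rpart (_ : (fun _ => _) = b *: foldr rpart g1 s + foldr rpart g2 s)//.
  rewrite deriveD; [|exact/derivableZ/d1|exact: d2].
  by rewrite deriveZ//; exact: d1.
split; last exact: E.
move=> s; rewrite E; have [c1 d1] := g1s s; have [c2 d2] := g2s s.
split=> [x|j x].
  exact: cvgD (cvgM (cvg_cst b) (c1 x)) (c2 x).
rewrite (_ : (fun _ => _) = b *: foldr rpart g1 s + foldr rpart g2 s)//.
by apply: derivableD; [exact/derivableZ/d1|exact: d2].
Qed.

Lemma foldr_cpartE f s x : foldr cpart f s x =
  foldr rpart (@complex.Re R \o f) s x +i* foldr rpart (@complex.Im R \o f) s x.
Proof.
suff E : foldr cpart f s = fun x =>
   foldr rpart (@complex.Re R \o f) s x +i* foldr rpart (@complex.Im R \o f) s x.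
  by rewrite E.
elim: s => /= [|j s ->]; last by [].
by apply/funext => y /=; case: (f y).
Qed.

Lemma smooth_lin f1 f2 (c : R[i]) : smooth f1 -> smooth f2 ->
  smooth (fun x => c * f1 x + f2 x) /\
  forall s, foldr cpart (fun x => c * f1 x + f2 x) s =
    fun x => c * foldr cpart f1 s x + foldr cpart f2 s x.
Proof.
case: c => a b [r1 i1] [r2 i2].
have [rr Er] := rsmooth_lin (- b) i1 r2.
have [rr' Er'] := rsmooth_lin a r1 rr.
have [ii Ei] := rsmooth_lin b r1 i2.
have [ii' Ei'] := rsmooth_lin a i1 ii.
have ReE : @complex.Re R \o (fun x => (a +i* b) * f1 x + f2 x) =
   fun x => a * (@complex.Re R \o f1) x +
     (- b * (@complex.Im R \o f1) x + (@complex.Re R \o f2) x).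
  by apply/funext => x /=; case: (f1 x) (f2 x) => [? ?] [? ?] /=; ring.
have ImE : @complex.Im R \o (fun x => (a +i* b) * f1 x + f2 x) =
   fun x => a * (@complex.Im R \o f1) x +
     (b * (@complex.Re R \o f1) x + (@complex.Im R \o f2) x).
  by apply/funext => x /=; case: (f1 x) (f2 x) => [? ?] [? ?] /=; ring.
split; first by rewrite /smooth ReE ImE; split; [exact: rr'|exact: ii'].
move=> s; apply/funext => x; rewrite !foldr_cpartE ReE ImE Er' Er Ei' Ei.
by apply/eqP; rewrite eq_complex /=; apply/andP; split; apply/eqP; ring.
Qed.

Lemma smooth0 : smooth (fun=> 0).
Proof.
suff E : rsmooth (fun=> 0) by split.
have E s : foldr rpart (fun=> 0) s = fun=> 0.
  elim: s => //= j s ->; apply/funext => x; rewrite /rpart.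
  exact: (derive_cst 0).
move=> s; rewrite E; split=> [|j x]; first exact: cst_continuous.
exact: derivable_cst.
Qed.

Lemma smooth_foldr f t : smooth f -> smooth (foldr cpart f t).
Proof.
move=> [fr fi]; split.
  rewrite (_ : _ \o _ = foldr rpart (@complex.Re R \o f) t).
    exact: rsmooth_foldr.
  by apply/funext => x /=; rewrite foldr_cpartE.
rewrite (_ : _ \o _ = foldr rpart (@complex.Im R \o f) t).
  exact: rsmooth_foldr.
by apply/funext => x /=; rewrite foldr_cpartE.
Qed.

Lemma count_mindex_seq a j : count_mem j (mindex_seq a) = a j.
Proof.
rewrite /mindex_seq count_flatten -map_comp sumnE big_map big_enum /=.
rewrite (bigD1 j)//= count_nseq /= eqxx mul1n big1 ?addn0// => i ij.
by rewrite count_nseq /= (negbTE ij).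
Qed.

Lemma Dmulti_comp f a b : smooth f -> Dmulti a (Dmulti b f) = Dmulti (mnm_add a b) f.
Proof.
move=> fs; rewrite /Dmulti.
set c := (- 'i) ^+ mdeg b.
have [_ E] := smooth_lin c (smooth_foldr (mindex_seq b) fs) smooth0.
have -> : (fun x => c * foldr cpart f (mindex_seq b) x) =
          (fun x => c * foldr cpart f (mindex_seq b) x + 0).
  by apply/funext => x; rewrite addr0.
have E0 s : foldr cpart (fun=> 0) s = fun=> 0.
  have [_ E1] := smooth_lin (-1) smooth0 smooth0.
  have := E1 s; rewrite (_ : (fun _ => _ + _) = (fun=> 0)); last first.
    by apply/funext => x; rewrite mulr0 addr0.
  by move=> {1}->; apply/funext => x; rewrite mulN1r addNr.
rewrite E E0; apply/funext => x; rewrite addr0 mulrA -exprD -mdegD -foldr_cat.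
congr (_ * _); rewrite !foldr_cpartE.
have p : perm_eq (mindex_seq a ++ mindex_seq b) (mindex_seq (mnm_add a b)).
  by apply/allP => j _ /=; rewrite count_cat !count_mindex_seq mnmDE.
by rewrite (foldr_rpart_perm fs.1 p) (foldr_rpart_perm fs.2 p).
Qed.

Lemma smooth_Dmulti f a : smooth f -> smooth (Dmulti a f).
Proof.
move=> fs; have [] := smooth_lin ((- 'i) ^+ mdeg a) (smooth_foldr (mindex_seq a) fs) smooth0.
rewrite (_ : (fun _ => _ + _) = Dmulti a f)//.
by apply/funext => x; rewrite addr0.
Qed.

Lemma Dmulti_lin f1 f2 c a : smooth f1 -> smooth f2 ->
  Dmulti a (fun x => c * f1 x + f2 x) = fun x => c * Dmulti a f1 x + Dmulti a f2 x.
Proof.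
move=> s1 s2; have [_ E] := smooth_lin c s1 s2.
by apply/funext => x; rewrite /Dmulti E; ring.
Qed.

End PartialDerivatives.

Lemma normc_nneg (R : realType) (z : R[i]) : 0 <= normc z.
Proof. by case: z => a b; exact: sqrtr_ge0. Qed.

Section Ultradifferentiable.
Context {R : realType} (M : weight_seq R) (N : nat).

Definition ultra_bound (C h : R) (f : 'rV[R]_N -> R[i]) := forall x a,
  normc (Dmulti a f x) <= C * (h ^+ mdeg a * M (mdeg a) * (mdeg a)`!%:R).

Definition ultra_pred : pred ('rV[R]_N -> R[i]) := fun f =>
  `[< [/\ smooth f, torus_periodic f &
          exists C h, [/\ 0 < C, 0 < h & ultra_bound C h f]] >].

Lemma ultra_predP f : reflect
  [/\ smooth f, torus_periodic f & exists C h, [/\ 0 < C, 0 < h & ultra_bound C h f]]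
  (f \in ultra_pred).
Proof. exact: asboolP. Qed.

Lemma ultra_weight_ge0 h n : 0 <= h -> 0 <= h ^+ n * M n * n`!%:R.
Proof. by move=> h0; rewrite !mulr_ge0 ?exprn_ge0 ?ler0n// ltW ?weight_gt0. Qed.

Lemma ultra_weight_gt0 h n : 0 < h -> 0 < h ^+ n * M n * n`!%:R.
Proof.
by move=> h0; rewrite !mulr_gt0 ?exprn_gt0 ?weight_gt0// ltr0n fact_gt0.
Qed.

Lemma ultra_weight_le h h' n : 0 <= h -> h <= h' ->
  h ^+ n * M n * n`!%:R <= h' ^+ n * M n * n`!%:R.
Proof.
move=> h0 hh; rewrite ler_wpM2r ?ler0n// ler_wpM2r ?(ltW (weight_gt0 _ _))//.
by rewrite lerXn2r ?nnegrE//; exact: le_trans hh.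
Qed.

Lemma ultra_bound_le C h h' f : 0 <= C -> 0 <= h -> h <= h' ->
  ultra_bound C h f -> ultra_bound C h' f.
Proof.
move=> C0 h0 hh b x a; apply: (le_trans (b x a)).
exact/ler_wpM2l/ultra_weight_le.
Qed.

Lemma ultra_submod_closed : submod_closed ultra_pred.
Proof.
split=> [|c f1 f2 /ultra_predP[s1 p1 [C1 [h1 [C10 h10 b1]]]]
  /ultra_predP[s2 p2 [C2 [h2 [C20 h20 b2]]]]].
  apply/ultra_predP; split=> //; first exact: smooth0.
  exists 1, 1; split=> // x a.
  have -> : Dmulti a (0 : 'rV[R]_N -> R[i]) x = 0.
    have := @Dmulti_lin R N (fun=> 0) (fun=> 0) (-1) a (@smooth0 R N) (@smooth0 R N).
    rewrite (_ : (fun _ => -1 * 0 + 0) = 0); last first.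
      by apply/funext => y; rewrite mulr0 addr0.
    by move=> ->; rewrite mulN1r addNr.
  by rewrite normc0 mul1r ultra_weight_ge0.
have [s E] := smooth_lin c s1 s2.
apply/ultra_predP; split=> //.
  by move=> j x; rewrite -[LHS]/(c * f1 _ + f2 _) p1 p2.
have c0 := normc_nneg c.
exists (normc c * C1 + C2), (Num.max h1 h2); split.
- by rewrite ltr_wpDl// mulr_ge0// ltW.
- by rewrite lt_max h10.
- move=> x a; rewrite (Dmulti_lin _ _ s1 s2).
  apply: (le_trans (le_normcD _ _)); rewrite normcM mulrDl -(mulrA (normc c)).
  apply: lerD; first apply: ler_wpM2l => //.
    apply: (le_trans (b1 x a)); apply: (ler_wpM2l (ltW C10)).
    by apply: ultra_weight_le; [exact: ltW|rewrite le_max lexx].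
  apply: (le_trans (b2 x a)); apply: (ler_wpM2l (ltW C20)).
  by apply: ultra_weight_le; [exact: ltW|rewrite le_max lexx orbT].
Qed.

HB.instance Definition _ := GRing.isSubmodClosed.Build R[i] ('rV[R]_N -> R[i]) ultra_pred
  (GRing.submod_closed_semi ultra_submod_closed).

Record ultradiff := Ultradiff {
  ultra_fun :> 'rV[R]_N -> R[i];
  ultra_funP : ultra_fun \in ultra_pred }.

HB.instance Definition _ := [isSub for ultra_fun].
HB.instance Definition _ := [Choice of ultradiff by <:].
HB.instance Definition _ := [SubChoice_isSubLmodule of ultradiff by <:].

Lemma ultradiffP (f : ultradiff) : [/\ smooth f, torus_periodic f &
  exists C h, [/\ 0 < C, 0 < h & ultra_bound C h f]].
Proof. exact/ultra_predP/ultra_funP. Qed.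

Definition ultranorm (h : R) (f : 'rV[R]_N -> R[i]) : \bar R :=
  ereal_sup (range (fun p : 'rV[R]_N * multinom N =>
    (normc (Dmulti p.2 f p.1) /
      (h ^+ mdeg p.2 * M (mdeg p.2) * (mdeg p.2)`!%:R))%:E)).

Lemma ultranorm_le (h C : R) f : 0 < h ->
  (ultranorm h f <= C%:E)%E <-> ultra_bound C h f.
Proof.
move=> h0; split=> [fC x a|fC].
  rewrite -ler_pdivrMr ?ultra_weight_gt0// -lee_fin; apply: le_trans fC.
  by apply: ereal_sup_ubound; exists (x, a).
apply: ge_ereal_sup => _ [[x a] _ <-] /=.
by rewrite lee_fin ler_pdivrMr ?ultra_weight_gt0.
Qed.

(* Locally convex inductive limit topology of the steps E_{M,h_n}, for the
   sequence h_n = n + 1: the absolutely convex sets that meet every step in a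
   neighbourhood of 0 of its norm form a base of neighbourhoods of 0.  The
   condition ultranorm < d already implies membership in the step. *)
Definition abs_convex (V : set ultradiff) := forall f g (a b : R[i]),
  V f -> V g -> normc a + normc b <= 1 -> V (a *: f + b *: g).

Definition step_nbhs0 (n : nat) (V : set ultradiff) := exists2 d : R, 0 < d &
  forall f : ultradiff, (ultranorm n.+1%:R f < d%:E)%E -> V f.

Definition ultra_open : set_system ultradiff := fun U => forall f, U f ->
  exists V, [/\ abs_convex V, forall n, step_nbhs0 n V & forall g, V g -> U (f + g)].

Lemma ultra_openT : ultra_open setT.
Proof. by move=> f _; exists setT; split=> // n; exists 1. Qed.

Lemma ultra_openI : setI_closed ultra_open.
Proof.
move=> A B oA oB f [/oA[V [cV nV VA]] /oB[W [cW nW WB]]].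
exists (V `&` W); split.
- move=> g g' a b [Vg Wg] [Vg' Wg'] ab.
  by split; [exact: cV|exact: cW].
- move=> n; have [d d0 dV] := nV n; have [e e0 eW] := nW n.
  exists (Num.min d e); first by rewrite lt_min d0.
  move=> g; rewrite EFin_min lt_min => /andP[gd ge].
  by split; [exact: dV|exact: eW].
- by move=> g [/VA ? /WB ?]; split.
Qed.

Lemma ultra_open_bigU (I : Type) (A : I -> set ultradiff) :
  (forall i, ultra_open (A i)) -> ultra_open (\bigcup_i A i).
Proof.
move=> oA f [i _ /oA[V [cV nV VA]]]; exists V; split=> // g /VA Ag.
by exists i.
Qed.

HB.instance Definition _ := isOpenTopological.Build ultradiff
  ultra_openT ultra_openI ultra_open_bigU.

Record ultradist := Ultradist {
  ultradist_fun :> {linear ultradiff -> (R[i])^o};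
  ultradist_continuous : continuous ultradist_fun }.

End Ultradifferentiable.

Lemma fact_add_le n m : ((n + m)`! <= 2 ^ (n + m) * (n`! * m`!))%N.
Proof.
rewrite -(@bin_fact (n + m) n) ?leq_addr// addKn leq_mul2r; apply/orP; right.
rewrite -[(2 ^ _)%N]/((1 + 1) ^ (n + m))%N.
rewrite (expnDn 1 1 (n + m)) (bigD1 (inord n : 'I_(n + m).+1))//=.
by rewrite inordK ?ltnS ?leq_addr// !exp1n !muln1 leq_addr.
Qed.

Section Operators.
Context {R : realType} {N : nat}.
Implicit Types (P : mpoly N R[i]) (f g : 'rV[R]_N -> R[i]).

Definition diffop P f : 'rV[R]_N -> R[i] :=
  fun x => \sum_(a <- msupp P) mcoeff a P * Dmulti a f x.

(* P(-D), the transpose of P(D) *)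
Definition diffop_tr P f : 'rV[R]_N -> R[i] :=
  fun x => \sum_(a <- msupp P) (-1) ^+ mdeg a * mcoeff a P * Dmulti a f x.

Section Dcomb.
Variable w : multinom N -> R[i].

Let Dcomb (s : seq (multinom N)) f : 'rV[R]_N -> R[i] :=
  fun x => \sum_(a <- s) w a * Dmulti a f x.

Let Dcomb_cons b s f : Dcomb (b :: s) f = fun x => w b * Dmulti b f x + Dcomb s f x.
Proof. by apply/funext => x; rewrite /Dcomb big_cons. Qed.

Let Dcomb_nil f : Dcomb [::] f = fun=> 0.
Proof. by apply/funext => x; rewrite /Dcomb big_nil. Qed.

Lemma smooth_Dcomb s f : smooth f -> smooth (Dcomb s f).
Proof.
move=> fs; elim: s => [|b s IH]; first by rewrite Dcomb_nil; exact: smooth0.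
by rewrite Dcomb_cons; have [] := smooth_lin (w b) (smooth_Dmulti b fs) IH.
Qed.

Lemma Dcomb_lin s f g c : smooth f -> smooth g ->
  Dcomb s (fun x => c * f x + g x) = fun x => c * Dcomb s f x + Dcomb s g x.
Proof.
move=> fs gs; apply/funext => x; rewrite /Dcomb mulr_sumr -big_split /=.
by apply: eq_bigr => a _; rewrite Dmulti_lin//; ring.
Qed.

Lemma periodic_Dcomb s f : torus_periodic f -> torus_periodic (Dcomb s f).
Proof.
move=> pf j x; rewrite /Dcomb; apply: eq_bigr => a _; congr (_ * _).
rewrite /Dmulti; congr (_ * _).
suff : torus_periodic (foldr cpart f (mindex_seq a)) by exact.
elim: (mindex_seq a) => //= k t; set h := foldr _ _ _ => ph i y.
have rp (q : 'rV[R]_N -> R) v z : (forall y', q (y' + v) = q y') ->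
    rpart k q (z + v) = rpart k q z.
  move=> qv; rewrite /rpart /derive.
  suff -> : (fun r : R => r^-1 *: ((q \o shift (z + v)) (r *: delta_mx 0 k) - q (z + v))) =
            (fun r : R => r^-1 *: ((q \o shift z) (r *: delta_mx 0 k) - q z)) by [].
  by apply/funext => r /=; rewrite addrA !qv.
by rewrite /cpart !rp// => z /=; rewrite ph.
Qed.

Lemma ultra_bound_Dcomb (M : weight_seq R) : exists2 H : R, 1 < H &
  forall (s : seq (multinom N)) (h : R), 0 < h -> exists2 K : R, 0 < K &
    forall C f, 0 <= C -> smooth f -> ultra_bound M C h f ->
      ultra_bound M (C * K) (h * H) (Dcomb s f).
Proof.
have [H H1 MH] := weight_submult M.
have H0 : 0 < H by lra.
exists (2 * H); first lra.
move=> s h h0; pose W (b : multinom N) := (h * (2 * H)) ^+ mdeg b * M (mdeg b) * (mdeg b)`!%:R.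
have hH : 0 < h * (2 * H) by rewrite !mulr_gt0.
have W0 b : 0 <= W b by exact/ultra_weight_ge0/ltW.
exists (1 + \sum_(b <- s) normc (w b) * W b).
  by rewrite ltr_wpDr// sumr_ge0// => b _; rewrite mulr_ge0 ?normc_nneg.
move=> C f C0 fs bf.
have bD b : ultra_bound M (C * W b) (h * (2 * H)) (Dmulti b f).
  move=> x a; rewrite Dmulti_comp// (le_trans (bf x _))// -(mulrA C).
  apply: ler_wpM2l => //; rewrite mdegD /W.
  set n := mdeg a; set m := mdeg b.
  have E1 := MH n m.
  have E2 : ((n + m)`!%:R : R) <= 2 ^+ (n + m) * (n`!%:R * m`!%:R).
    by rewrite -!natrM -natrX -natrM ler_nat fact_add_le.
  apply: le_trans (_ : h ^+ (n + m) * (H ^+ (n + m) * M n * M m) *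
     (2 ^+ (n + m) * (n`!%:R * m`!%:R)) <= _); last first.
    by rewrite !exprMn !exprD le_eqVlt; apply/orP; left; apply/eqP; ring.
  have hn : 0 <= h ^+ (n + m) by exact/exprn_ge0/ltW.
  apply: ler_pM.
  - exact: mulr_ge0 hn (ltW (weight_gt0 M _)).
  - exact: ler0n.
  - exact: ler_wpM2l hn _ _ E1.
  - exact: E2.
rewrite mulrDr mulr1 mulr_sumr.
elim: s => [|b s IH] x a.
  rewrite Dcomb_nil.
  have [_] := smooth_lin (-1) (@smooth0 R N) (@smooth0 R N).
  have := @Dmulti_lin R N (fun=> 0) (fun=> 0) (-1) a (@smooth0 R N) (@smooth0 R N).
  rewrite (_ : (fun _ => -1 * 0 + 0) = fun=> 0); last first.
    by apply/funext => y; rewrite mulr0 addr0.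
  move=> -> _; rewrite mulN1r addNr normc0.
  by rewrite big_nil addr0 mulr_ge0// ultra_weight_ge0// ltW.
rewrite Dcomb_cons Dmulti_lin; [|exact: smooth_Dmulti|exact: smooth_Dcomb].
apply: (le_trans (le_normcD _ _)); rewrite normcM big_cons addrCA mulrDl.
apply: lerD; last exact: IH.
rewrite (mulrCA C) -(mulrA (normc (w b))); apply: ler_wpM2l; first exact: normc_nneg.
exact: bD.
Qed.

End Dcomb.

End Operators.

Section TransposedOperator.
Context {R : realType} (M : weight_seq R) (N : nat) (P : mpoly N R[i]).

Lemma diffop_tr_ultra (f : ultradiff M N) : diffop_tr P f \in @ultra_pred R M N.
Proof.
have [fs pf [C [h [C0 h0 bf]]]] := ultradiffP f.
pose w (a : multinom N) : R[i] := (-1) ^+ mdeg a * mcoeff a P.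
have [H H1 bH] := ultra_bound_Dcomb w M.
have [K K0 bK] := bH (msupp P) h h0.
apply/ultra_predP; split.
- exact: (smooth_Dcomb w).
- exact: (periodic_Dcomb w).
- exists (C * K), (h * H); split; [exact: mulr_gt0|apply: mulr_gt0 => //; lra|].
  by apply: bK => //; exact: ltW.
Qed.

Definition ultra_diffop_tr (f : ultradiff M N) : ultradiff M N :=
  Ultradiff (diffop_tr_ultra f).

Lemma ultra_diffop_tr_linear : linear ultra_diffop_tr.
Proof.
move=> c f g; apply/val_inj; rewrite /=.
have [fs _ _] := ultradiffP f; have [gs _ _] := ultradiffP g.
exact: (Dcomb_lin _ _ c fs gs).
Qed.

HB.instance Definition _ := GRing.isLinear.Build R[i] (ultradiff M N) (ultradiff M N) _
  ultra_diffop_tr ultra_diffop_tr_linear.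

Lemma ultra_diffop_tr_continuous : continuous ultra_diffop_tr.
Proof.
apply/continuousP => U oU.
suff : ultra_open (ultra_diffop_tr @^-1` U) by [].
have {}oU : ultra_open U by [].
move=> f /oU[V [cV nV VU]]; exists (ultra_diffop_tr @^-1` V); split.
- by move=> g g' a b Vg Vg' ab /=; rewrite linearD !linearZ; exact: cV.
- move=> n.
  pose w (a : multinom N) : R[i] := (-1) ^+ mdeg a * mcoeff a P.
  have [H H1 bH] := ultra_bound_Dcomb w M.
  have n0 : 0 < n.+1%:R :> R by rewrite ltr0n.
  have [K K0 bK] := bH (msupp P) _ n0.
  have [n' n'H] : exists n', n.+1%:R * H <= n'.+1%:R.
    exists (Num.truncn (n.+1%:R * H)); apply/ltW; rewrite truncnS_gt//.
  have [d d0 dV] := nV n'.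
  exists (d / 2 / K); first by rewrite !divr_gt0.
  move=> g gd; apply: dV; have [gs _ _] := ultradiffP g.
  have dK : 0 <= d / 2 / K by rewrite !divr_ge0// ltW.
  have /(bK _ _ dK gs) : ultra_bound M (d / 2 / K) n.+1%:R g.
    by apply/ultranorm_le => //; exact: ltW.
  rewrite divfK ?gt_eqF// => bg.
  apply: (@le_lt_trans _ _ (d / 2)%:E); last by rewrite lte_fin; lra.
  apply/ultranorm_le; first by rewrite ltr0n.
  by apply: ultra_bound_le bg; rewrite ?divr_ge0 ?mulr_ge0//; lra.
- by move=> g /VU; rewrite /= linearD.
Qed.

End TransposedOperator.

Section DistributionOperator.
Context {R : realType} {M : weight_seq R} {N : nat}.
Implicit Types (P : mpoly N R[i]) (u : ultradist M N).

Lemma ultradist_diffop_subproof P u :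
  continuous ((u : {linear ultradiff M N -> (R[i])^o}) \o ultra_diffop_tr P).
Proof.
by move=> f; apply: continuous_comp;
  [exact: ultra_diffop_tr_continuous|exact: ultradist_continuous].
Qed.

(* P(D) u, defined by < P(D) u, phi > = < u, P(-D) phi > *)
Definition ultradist_diffop P u : ultradist M N :=
  Ultradist (@ultradist_diffop_subproof P u).

End DistributionOperator.

Section Symbol.
Context {R : realType} {N : nat}.
Implicit Types (xi : 'rV[int]_N) (x : 'rV[R]_N) (P : mpoly N R[i]).

Definition torus_exp xi x : R[i] :=
  let t := \sum_j (xi 0 j)%:~R * x 0 j in cos t +i* sin t.

(* With D = -i d, the eigenvalue of P(D) on e^{i x xi} is the value of the
   polynomial P at xi; see diffop_torus_exp. *)
Definition symbol P xi : R[i] := meval (fun j => (xi 0 j)%:~R) P.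

Lemma cpart_torus_exp (c : R[i]) j xi :
  cpart j (fun x => c * torus_exp xi x) =
  fun x => c * ('i * (xi 0 j)%:~R) * torus_exp xi x.
Proof.
apply/funext => x; pose t := \sum_j (xi 0 j)%:~R * x 0 j : R.
pose k : R := (xi 0 j)%:~R.
have sh (r : R) : \sum_j0 (xi 0 j0)%:~R * (r *: delta_mx 0 j + x) 0 j0 = t + r * k :> R.
  rewrite -/t /t (bigD1 j)//= [in RHS](bigD1 j)//= !mxE !eqxx /=.
  rewrite (eq_bigr (fun j0 => (xi 0 j0)%:~R * x 0 j0)); last first.
    by move=> i ij; rewrite !mxE (negbTE ij) andbF mulr0 add0r.
  by rewrite /k; ring.
have dd (a b : R) : rpart j (fun y => let t := \sum_j (xi 0 j)%:~R * y 0 j in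
    a * cos t + b * sin t) x = - a * k * sin t + b * k * cos t.
  pose F (r : R) := a * cos (t + r * k) + b * sin (t + r * k).
  have dF : is_derive (0 : R) (1 : R) F (- a * k * sin t + b * k * cos t).
    have dt : is_derive (0 : R) (1 : R) (fun r : R => t + r * k) k.
      have dk := is_deriveD (is_derive_cst t (0 : R) 1) (is_deriveZ k (is_derive_id (0 : R) 1)).
      have Et : (cst t : R -> R) + k *: (id : R -> R) = (fun r : R => t + r * k).
        by apply/funext => r; rewrite mulrC.
      have Ek : 0 + k *: (1 : R^o) = k by rewrite add0r -[LHS]/(k * 1) mulr1.
      by move: dk; rewrite Et Ek.
    have t0 : t + 0 * k = t by rewrite mul0r addr0.
    have dc : is_derive (0 : R) (1 : R) (fun r : R => cos (t + r * k)) (- sin t * k).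
      have dc0 : is_derive (t + 0 * k) (1 : R) cos (- sin t) by rewrite t0; exact: is_derive_cos.
      exact (@is_derive1_comp R cos (fun r : R => t + r * k) 0 _ _ dc0 dt).
    have ds : is_derive (0 : R) (1 : R) (fun r : R => sin (t + r * k)) (cos t * k).
      have ds0 : is_derive (t + 0 * k) (1 : R) sin (cos t) by rewrite t0; exact: is_derive_sin.
      exact (@is_derive1_comp R sin (fun r : R => t + r * k) 0 _ _ ds0 dt).
    have -> : F = a *: (fun r : R => cos (t + r * k)) + b *: (fun r : R => sin (t + r * k)).
      by [].
    apply: (is_derive_eq (is_deriveD (is_deriveZ a dc) (is_deriveZ b ds))).
    have sc (p q : R) : p *: (q : R^o) = p * q by [].
    by rewrite !sc; ring.
  refine (etrans _ (@derive_val _ _ _ _ _ _ _ dF)).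
  pose G (y : 'rV[R]_N) := let t := \sum_j (xi 0 j)%:~R * y 0 j in
    a * cos t + b * sin t.
  have E : (fun h : R => h^-1 *: ((G \o shift x) (h *: delta_mx 0 j) - G x)) =
           (fun h : R => h^-1 *: ((F \o shift (0 : R)) (h *: (1 : R)) - F 0)).
    by apply/funext => h; rewrite /= /G sh /F mul0r !addr0 scaler1.
  exact: (congr1 (fun q : R -> R => lim (q @ 0^')) E).
case: c => a b; rewrite /cpart /torus_exp.
have -> : @complex.Re R \o (fun x => (a +i* b) * torus_exp xi x) =
  (fun y => let t := \sum_j (xi 0 j)%:~R * y 0 j in a * cos t + (- b) * sin t).
  by apply/funext => y /=; rewrite mulNr.
have -> : @complex.Im R \o (fun x => (a +i* b) * torus_exp xi x) =
  (fun y => let t := \sum_j (xi 0 j)%:~R * y 0 j in b * cos t + a * sin t).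
  by apply/funext => y /=; rewrite addrC.
rewrite !dd /=.
have -> : ((xi 0 j)%:~R : R[i]) = k +i* 0 by rewrite -(rmorph_int (real_complex R)).
by rewrite -/t; apply/eqP; rewrite eq_complex /=; apply/andP; split; apply/eqP; ring.
Qed.

Lemma diffop_torus_exp P xi :
  diffop P (torus_exp xi) = fun x => symbol P xi * torus_exp xi x.
Proof.
apply/funext => x; rewrite /diffop /symbol mevalE mulr_suml.
apply: eq_bigr => a _; rewrite -mulrA; congr (_ * _).
rewrite /Dmulti.
have E s : foldr cpart (torus_exp xi) s =
    fun x => (\prod_(j <- s) ('i * (xi 0 j)%:~R)) * torus_exp xi x.
  elim: s => [|j s IH] /=; first by apply/funext => y; rewrite big_nil mul1r.
  rewrite IH cpart_torus_exp big_cons; apply/funext => y; congr (_ * _).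
  exact: mulrC.
rewrite E mulrA; congr (_ * _).
rewrite /mindex_seq big_flatten /= big_map big_enum /= mdegE -prodrXr -big_split /=.
apply: eq_bigr => j _; rewrite big_nseq iter_mulr mulr1 -exprMn; congr (_ ^+ _).
by rewrite mulrA mulNr -expr2 sqr_i opprK mul1r.
Qed.

End Symbol.

Section Hypoellipticity.
Context {R : realType}.

(* Iterated Lebesgue integral over [0, 2 pi]^n; it is only applied to
   continuous functions, for which it is the integral over the torus. *)
Fixpoint torus_integral (n : nat) : ('rV[R]_n -> R) -> R :=
  if n is n'.+1 return ('rV[R]_n -> R) -> R then
    fun g => \int[lebesgue_measure]_(t in `[0, 2 * pi])
      torus_integral (fun y : 'rV[R]_n' => g (row_mx (t%:M : 'rV[R]_1) y))
  else fun g => g 0.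

Definition torus_pairing n (f g : 'rV[R]_n -> R[i]) : R[i] :=
  torus_integral (fun x => complex.Re (f x * g x)) +i*
  torus_integral (fun x => complex.Im (f x * g x)).

(* u belongs to E_M, embedded in its dual by f |-> (phi |-> \int f phi). *)
Definition is_ultradiff (M : weight_seq R) N (u : ultradist M N) :=
  exists f : ultradiff M N, forall phi, u phi = torus_pairing f phi.

Definition globally_hypoelliptic (M : weight_seq R) (N k : nat)
    (P : 'I_k -> mpoly N R[i]) :=
  forall u : ultradist M N,
    (forall j, is_ultradiff (ultradist_diffop (P j) u)) -> is_ultradiff u.

(* The default value 0 of the maximum is harmless since the moduli are >= 0. *)
Definition symbol_norm (N k : nat) (P : 'I_k -> mpoly N R[i]) (xi : 'rV[int]_N) : R :=
  \big[Num.max/0]_(j < k) normc (symbol (P j) xi).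

End Hypoellipticity.

Definition euclid_norm (R : realType) (N : nat) (xi : 'rV[int]_N) : R :=
  Num.sqrt (\sum_j (xi 0 j)%:~R ^+ 2).

(* Main.v *)
Require Import Defs.
From HB Require Import structures.
From mathcomp Require Import all_boot all_order all_algebra.
From mathcomp Require Import all_classical all_reals all_analysis.
From mathcomp Require Import complex.
From mathcomp Require Import -(notations) mpoly.
From mathcomp Require Import ring lra.
Set Implicit Arguments.
Unset Strict Implicit.
Unset Printing Implicit Defensive.
Import Order.TTheory GRing.Theory Num.Theory.
Import numFieldNormedType.Exports.
Import Normc.
Local Open Scope classical_set_scope.
Local Open Scope complex_scope.
Local Open Scope ring_scope.

(** Both directions are read off the Fourier coefficients u^(xi) = <u, e^{i x xi}>
    of an ultradistribution u, because P_j(D) multiplies them by the symbol.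

    A function belongs to E_M exactly when its coefficients satisfy
    |f^(xi)| <= A B^n m_n n! / (1 + |xi|)^n for all n; this is the predicate
    [rapid].  Lemma [fourier_bound] is the easy half (integrate by parts along
    the dominant coordinate), [fourier_series] the converse half: such
    coefficients sum to a smooth function with the right derivative bounds.
    The condition m_{j+k} <= H^{j+k} m_j m_k is what makes the estimates stable,
    in the form m_{n+k} (n+k)! <= L^{n+k} m_n n! m_k k!: it lets a fixed power of 1 + |xi| be traded for a larger B, which
    buys summability over the lattice.

    Sufficiency.  If P_j(D) u = f_j lies in E_M for every j, then
    |P(-xi)| |u^(xi)| <= A B^n m_n n! / (1 + |xi|)^n.  Write T_eps(xi) for the
    infimum in the statement.  Applying the estimate with n + k in place of n and
    splitting m_{n+k} (n+k)! gives, for eps = 1 / (L B),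
    T_eps |u^| <= A a_n a_k for all n and k, with a_n the ratio whose infimum is
    T_eps.  Taking the infimum over k and cancelling T_eps > 0 leaves
    |u^| <= A a_n for large |xi|, and finitely many frequencies only change the
    constant ([rapid_of_symbol_bound]).  So the coefficients of u are those of
    some f in E_M.  That u equals f requires trigonometric polynomials to be dense
    in E_M ([trig_density], [ultradist_fourierE]): the Fourier series of phi
    converges to phi in one of the steps E_{M,h}, since it converges there to
    some function with the coefficients of phi, and a continuous periodic
    function is determined by its coefficients ([torus_complete]).

    Necessity.  If the symbol condition fails for some eps, pick a sequence xi_i
    with |P(xi_i)| < T_eps(xi_i) and |xi_i| >= 2^i, and let
    u = \sum_i e^{i x xi_i}.  Sparsity makes u a continuous functional although
    its coefficients are all 1, whereas P_j(D) u = \sum_i P_j(xi_i) e^{i x xi_i}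
    has rapidly decreasing coefficients and so lies in E_M.  Since the
    coefficients of u do not tend to 0, u is not in E_M.

    All functions to be integrated are bounded and Lipschitz, which keeps the
    iterated integrals within reach of the one-dimensional theory of continuous
    functions. *)

(** * Torus integrals of bounded Lipschitz functions *)

Section BoundedLipschitz.
Context {R : realType} {n : nat}.
Implicit Types (g h : 'rV[R]_n -> R) (x y : 'rV[R]_n).

Definition dist1 x y : R := \sum_j `|x 0 j - y 0 j|.

(** Bounded Lipschitz functions form an algebra that is stable under freezing the
    first variable and under integrating out the others; this stability is what
    allows the iterated integral to be handled by induction on the dimension. *)
Definition blip g :=
  (exists K, forall x, `|g x| <= K) /\
  (exists L, forall x y, `|g x - g y| <= L * dist1 x y).

Lemma dist1_ge0 x y : 0 <= dist1 x y.
Proof. exact: sumr_ge0. Qed.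

Lemma blip_cst c : blip (fun=> c).
Proof.
split; first by exists `|c|.
by exists 0 => x y; rewrite subrr normr0 mul0r.
Qed.

Lemma blipD g h : blip g -> blip h -> blip (fun x => g x + h x).
Proof.
move=> [[K gK] [L gL]] [[K' hK] [L' hL]]; split.
  exists (K + K') => x; exact: le_trans (ler_normD _ _) (lerD (gK x) (hK x)).
exists (L + L') => x y; rewrite opprD addrACA mulrDl.
exact: le_trans (ler_normD _ _) (lerD (gL x y) (hL x y)).
Qed.

Lemma blipM g h : blip g -> blip h -> blip (fun x => g x * h x).
Proof.
move=> [[K gK] [L gL]] [[K' hK] [L' hL]]; split.
  by exists (K * K') => x; rewrite normrM ler_pM.
exists (K * L' + K' * L) => x y.
have -> : g x * h x - g y * h y = g x * (h x - h y) + h y * (g x - g y) by ring.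
apply: le_trans (ler_normD _ _) _; rewrite !normrM mulrDl -!mulrA.
by apply: lerD; apply: ler_pM.
Qed.

Lemma blipZ c g : blip g -> blip (fun x => c * g x).
Proof. by move=> bg; apply: blipM => //; exact: blip_cst. Qed.

Lemma blipN g : blip g -> blip (fun x => - g x).
Proof.
move=> /(blipZ (-1)); rewrite (_ : (fun x => -1 * g x) = fun x => - g x)//.
by apply/funext => x; rewrite mulN1r.
Qed.

Lemma blipB g h : blip g -> blip h -> blip (fun x => g x - h x).
Proof. by move=> bg /blipN; exact: blipD. Qed.

End BoundedLipschitz.

Section TorusIntegral.
Context {R : realType}.
Implicit Type F : R -> R.

Lemma lipschitz_continuous F (L : R) :
  (forall s t, `|F s - F t| <= L * `|s - t|) -> continuous F.
Proof.
move=> FL x; apply/cvgrPdist_le => e e0.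
have L0 : 0 < `|L| + 1 by rewrite ltr_wpDl.
near=> t; apply: le_trans (FL _ _) _.
apply: le_trans (_ : (`|L| + 1) * `|x - t| <= _).
  apply: ler_wpM2r => //; apply: le_trans (ler_norm _) _; lra.
rewrite -ler_pdivlMl//; near: t.
by apply: cvgr_dist_le; [exact: cvg_id|rewrite mulr_gt0 ?invr_gt0].
Unshelve. all: by end_near. Qed.

Lemma continuous_integrable_itv F (a b : R) : continuous F ->
  (@lebesgue_measure R).-integrable `[a, b] (EFin \o F).
Proof.
move=> cF; apply: continuous_compact_integrable; first exact: segment_compact.
exact: continuous_subspaceT.
Qed.

Definition slice n (g : 'rV[R]_(1 + n) -> R) (t : R) : 'rV[R]_n -> R :=
  fun y => g (row_mx (t%:M : 'rV[R]_1) y).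

Lemma dist1_row_mx n (s t : R) (x y : 'rV[R]_n) :
  dist1 (row_mx (s%:M : 'rV[R]_1) x) (row_mx (t%:M : 'rV[R]_1) y) =
  `|s - t| + dist1 x y.
Proof.
rewrite /dist1 big_split_ord big_ord1 !row_mxEl !mxE eqxx !mulr1n.
by congr (_ + _); apply: eq_bigr => j _; rewrite !row_mxEr.
Qed.

Lemma dist1xx n (x : 'rV[R]_n) : dist1 x x = 0.
Proof. by rewrite /dist1 big1// => j _; rewrite subrr normr0. Qed.

Lemma blip_slice n (g : 'rV[R]_(1 + n) -> R) t : blip g -> blip (slice g t).
Proof.
move=> [[K gK] [L gL]]; split; first by exists K => x; exact: gK.
by exists L => x y; apply: le_trans (gL _ _) _; rewrite dist1_row_mx subrr normr0 add0r.
Qed.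

Lemma torus_integralS n (g : 'rV[R]_(1 + n) -> R) :
  torus_integral g =
  \int[lebesgue_measure]_(t in `[0, 2 * pi]) torus_integral (slice g t).
Proof. by []. Qed.

Lemma pi2_gt0 : 0 < 2 * pi :> R.
Proof. by rewrite mulr_gt0 ?pi_gt0. Qed.

Lemma Rintegral_bound F K : continuous F ->
  (forall t, `|F t| <= K) ->
  `|\int[lebesgue_measure]_(t in `[0, 2 * pi]) F t| <= 2 * pi * K.
Proof.
move=> cF FK; have p0 := pi2_gt0.
apply: le_trans (le_normr_Rintegral _ _) _ => //.
  exact: continuous_integrable_itv.
apply: le_trans (_ : \int[lebesgue_measure]_(t in `[0, 2 * pi]) K <= _).
  apply: le_Rintegral => //; apply: continuous_integrable_itv.
    by move=> x; apply: continuous_comp; [exact: cF|exact: norm_continuous].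
  by move=> x; exact: cst_continuous.
rewrite Rintegral_cst//= lebesgue_measure_itv/= lte_fin p0 -EFinD/= subr0.
by rewrite mulrC.
Qed.

(** The three properties need one another: linearity in dimension n + 1 needs the
    inner integral to be integrable in the outer variable, which follows from its
    Lipschitz continuity, and that follows from linearity and the sup bound in
    dimension n. *)
Lemma torus_integral_ind n :
  (forall (a : R) (g h : 'rV[R]_n -> R), blip g -> blip h ->
    torus_integral (fun x => a * g x + h x) = a * torus_integral g + torus_integral h) /\
  (forall (g : 'rV[R]_n -> R) K, blip g -> (forall x, `|g x| <= K) ->
    `|torus_integral g| <= (2 * pi) ^+ n * K) /\
  (forall g : 'rV[R]_(1 + n) -> R, blip g ->
     exists L, forall s t,
       `|torus_integral (slice g s) - torus_integral (slice g t)| <= L * `|s - t|).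
Proof.
have cont m : (forall (a : R) (g h : 'rV[R]_m -> R), blip g -> blip h ->
    torus_integral (fun x => a * g x + h x) = a * torus_integral g + torus_integral h) ->
    (forall (g : 'rV[R]_m -> R) K, blip g -> (forall x, `|g x| <= K) ->
    `|torus_integral g| <= (2 * pi) ^+ m * K) ->
    forall g : 'rV[R]_(1 + m) -> R, blip g ->
     exists L, forall s t,
       `|torus_integral (slice g s) - torus_integral (slice g t)| <= L * `|s - t|.
  move=> lin bd g bg; have [_ [L gL]] := bg.
  exists ((2 * pi) ^+ m * L) => s t.
  have b1 := blip_slice s bg; have b2 := blip_slice t bg.
  have -> : torus_integral (slice g s) - torus_integral (slice g t) =
     torus_integral (fun y => -1 * slice g t y + slice g s y).
    by rewrite lin//; ring.
  rewrite -mulrA; apply: bd; first by apply: blipD => //; exact: blipZ.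
  move=> x; rewrite mulN1r addrC; apply: le_trans (gL _ _) _.
  by rewrite dist1_row_mx dist1xx addr0.
elim: n => [|n [lin [bd lip]]].
  have l0 : forall (a : R) (g h : 'rV[R]_0 -> R), blip g -> blip h ->
    torus_integral (fun x => a * g x + h x) = a * torus_integral g + torus_integral h.
    by [].
  have b0 : forall (g : 'rV[R]_0 -> R) K, blip g -> (forall x, `|g x| <= K) ->
    `|torus_integral g| <= (2 * pi) ^+ 0 * K.
    by move=> g K _ gK; rewrite expr0 mul1r; exact: gK.
  by split=> //; split=> //; exact: cont.
have co (g : 'rV[R]_(1 + n) -> R) : blip g ->
    continuous (fun t => torus_integral (slice g t)).
  by move=> /lip[L gL]; exact: lipschitz_continuous gL.
have l1 : forall (a : R) (g h : 'rV[R]_(1 + n) -> R), blip g -> blip h ->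
    torus_integral (fun x => a * g x + h x) = a * torus_integral g + torus_integral h.
  move=> a g h bg bh; rewrite !torus_integralS.
  have mI : measurable (`[0, 2 * pi] : set R) by [].
  have ig := continuous_integrable_itv 0 (2 * pi) (co _ bg).
  have ih := continuous_integrable_itv 0 (2 * pi) (co _ bh).
  rewrite -RintegralZl// -RintegralD//.
    apply: eq_Rintegral => t _; rewrite -lin//; exact: blip_slice.
  apply: continuous_integrable_itv => x.
  by apply: cvgM; [exact: cvg_cst|exact: co].
have b1 : forall (g : 'rV[R]_(1 + n) -> R) K, blip g -> (forall x, `|g x| <= K) ->
    `|torus_integral g| <= (2 * pi) ^+ n.+1 * K.
  move=> g K bg gK; rewrite torus_integralS exprS -mulrA.
  apply: Rintegral_bound; first exact: co.
  by move=> t; apply: bd; [exact: blip_slice|move=> x; exact: gK].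
by split=> //; split=> //; exact: cont.
Qed.

Lemma torus_integral_lin n a (g h : 'rV[R]_n -> R) : blip g -> blip h ->
  torus_integral (fun x => a * g x + h x) = a * torus_integral g + torus_integral h.
Proof. exact: (torus_integral_ind n).1. Qed.

Lemma torus_integral_bound n (g : 'rV[R]_n -> R) K : blip g -> (forall x, `|g x| <= K) ->
  `|torus_integral g| <= (2 * pi) ^+ n * K.
Proof. exact: (torus_integral_ind n).2.1. Qed.

Lemma torus_integral_slice_lipschitz n (g : 'rV[R]_(1 + n) -> R) : blip g ->
  exists L, forall s t,
    `|torus_integral (slice g s) - torus_integral (slice g t)| <= L * `|s - t|.
Proof. exact: (torus_integral_ind n).2.2. Qed.

Lemma continuous_torus_integral_slice n (g : 'rV[R]_(1 + n) -> R) : blip g ->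
  continuous (fun t => torus_integral (slice g t)).
Proof.
by move=> /torus_integral_slice_lipschitz[L gL]; exact: lipschitz_continuous gL.
Qed.

Lemma torus_integralD n (g h : 'rV[R]_n -> R) : blip g -> blip h ->
  torus_integral (fun x => g x + h x) = torus_integral g + torus_integral h.
Proof.
move=> bg bh; have := torus_integral_lin 1 bg bh; rewrite mul1r => <-.
by congr torus_integral; apply/funext => x; rewrite mul1r.
Qed.

Lemma torus_integralZ n a (g : 'rV[R]_n -> R) : blip g ->
  torus_integral (fun x => a * g x) = a * torus_integral g.
Proof.
move=> bg.
have z : torus_integral (fun _ : 'rV[R]_n => 0) = 0 :> R.
  apply/eqP; rewrite -normr_le0 -[leRHS](mulr0 ((2 * pi) ^+ n)).
  by apply: torus_integral_bound => [|x]; rewrite ?normr0//; exact: blip_cst.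
have := torus_integral_lin a bg (blip_cst 0); rewrite z addr0 => <-.
by congr torus_integral; apply/funext => x; rewrite addr0.
Qed.

Lemma torus_integralB n (g h : 'rV[R]_n -> R) : blip g -> blip h ->
  torus_integral (fun x => g x - h x) = torus_integral g - torus_integral h.
Proof.
move=> bg bh; have := torus_integral_lin (-1) bh bg.
rewrite mulN1r addrC => <-.
by congr torus_integral; apply/funext => x; rewrite mulN1r addrC.
Qed.

Lemma torus_integral_cst n (c : R) :
  torus_integral (fun _ : 'rV[R]_n => c) = (2 * pi) ^+ n * c.
Proof.
elim: n => [|n IH]; first by rewrite /= mul1r.
rewrite torus_integralS (_ : (fun _ : R => torus_integral _) = fun _ => (2 * pi) ^+ n * c).
  rewrite Rintegral_cst//= lebesgue_measure_itv/= lte_fin pi2_gt0 -EFinD/= subr0.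
  by rewrite exprS; ring.
by apply/funext => t; exact: IH.
Qed.

End TorusIntegral.

(** * Integrals of derivatives of periodic functions *)

Section QuadraticDerivative.
Context {R : realType}.

Lemma quadratic_is_derive (V : normedModType R) (g : V -> R) (x v : V) (d C : R) :
  (forall s, `|g (x + s *: v) - g x - s * d| <= C * s ^+ 2) ->
  is_derive x v g d.
Proof.
move=> gC.
have lim : (fun h : R => h^-1 *: ((g \o shift x) (h *: v) - g x)) @ 0^' --> d.
  apply/cvgrPdist_le => e e0.
  have C0 : 0 < `|C| + 1 by rewrite ltr_wpDl.
  have ed : 0 < (`|C| + 1)^-1 * e by rewrite mulr_gt0 ?invr_gt0.
  near=> h.
  have h0 : h != 0 by near: h; exact: nbhs_dnbhs_neq.
  have hd : `|h| <= (`|C| + 1)^-1 * e.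
    near: h; apply: (@dnbhs0_le _ R) => //.
  rewrite distrC /= [h *: v + x]addrC.
  rewrite -[_ *: _]/(h^-1 * (g (x + h *: v) - g x)).
  have -> : h^-1 * (g (x + h *: v) - g x) - d =
    h^-1 * (g (x + h *: v) - g x - h * d) by rewrite [RHS]mulrBr mulKf.
  rewrite normrM normfV ler_pdivrMl ?normr_gt0//.
  apply: le_trans (gC h) _; rewrite -real_normK ?num_real// expr2 mulrCA.
  apply: ler_wpM2l => //.
  apply: le_trans (_ : (`|C| + 1) * `|h| <= _).
    apply: ler_wpM2r => //; apply: le_trans (ler_norm _) _; lra.
  by rewrite -ler_pdivlMl.
apply: DeriveDef; first by apply/cvg_ex; exists d.
exact: cvg_lim lim.
Unshelve. all: by end_near. Qed.

Context {n : nat}.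
Implicit Types (g h k l : 'rV[R]_n -> R).

(** A uniform quadratic remainder is a form of differentiability that survives
    integration over the remaining variables and pointwise limits of functions. *)
Definition qder (j : 'I_n) g k :=
  exists C, forall x s, `|g (x + s *: delta_mx 0 j) - g x - s * k x| <= C * s ^+ 2.

Lemma dist1_shift (x : 'rV[R]_n) s j : dist1 (x + s *: delta_mx 0 j) x = `|s|.
Proof.
rewrite /dist1 (bigD1 j)//= big1 ?addr0.
  by rewrite !mxE !eqxx mulr1 addrAC subrr add0r.
by move=> i /negbTE ij; rewrite !mxE ij andbF mulr0 addr0 subrr normr0.
Qed.

Lemma qderD j g h k l : qder j g k -> qder j h l ->
  qder j (fun x => g x + h x) (fun x => k x + l x).
Proof.
move=> [C gC] [D hD]; exists (C + D) => x s.
have -> : g (x + s *: delta_mx 0 j) + h (x + s *: delta_mx 0 j) - (g x + h x) -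
  s * (k x + l x) = (g (x + s *: delta_mx 0 j) - g x - s * k x) +
    (h (x + s *: delta_mx 0 j) - h x - s * l x) by ring.
by rewrite mulrDl (le_trans (ler_normD _ _))// lerD.
Qed.

Lemma qderM j g h k l : blip g -> blip h -> blip k -> blip l ->
  qder j g k -> qder j h l ->
  qder j (fun x => g x * h x) (fun x => g x * l x + k x * h x).
Proof.
move=> [[K gK] _] [[H hH] [L hL]] [[B kB] _] _ [C gC] [D hD].
exists (C * H + K * D + B * L) => x s.
set y := x + _.
have -> : g y * h y - g x * h x - s * (g x * l x + k x * h x) =
  (g y - g x - s * k x) * h y + g x * (h y - h x - s * l x) +
  s * (k x * (h y - h x)) by ring.
apply: le_trans (ler_normD _ _) _; rewrite [leRHS]mulrDl; apply: lerD.
  apply: le_trans (ler_normD _ _) _; rewrite [leRHS]mulrDl; apply: lerD; rewrite normrM.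
    by rewrite mulrAC; apply: ler_pM; [| |exact: gC|exact: hH].
  by rewrite -mulrA; apply: ler_pM; [| |exact: gK|exact: hD].
rewrite !normrM -(real_normK (num_real s)) expr2 [leRHS]mulrA [leRHS]mulrC.
apply: ler_wpM2l => //; rewrite -mulrA; apply: ler_pM => //.
by apply: le_trans (hL _ _) _; rewrite /y dist1_shift.
Qed.

Lemma qderN j g k : qder j g k -> qder j (fun x => - g x) (fun x => - k x).
Proof.
move=> [C gC]; exists C => x s.
have -> : - g (x + s *: delta_mx 0 j) - - g x - s * - k x =
  - (g (x + s *: delta_mx 0 j) - g x - s * k x) by ring.
by rewrite normrN.
Qed.

End QuadraticDerivative.

(** Along an inner variable this is the case of lower dimension, slice by slice.
    Along the outer variable the quadratic remainder passes through the inner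
    integral F, so F' is the inner integral of k and the fundamental theorem of
    calculus gives F(2 pi) - F(0) = 0. *)
Lemma torus_integral_qder (R : realType) n (j : 'I_n) (g k : 'rV[R]_n -> R) :
  (forall x, g (x + (2 * pi) *: delta_mx 0 j) = g x) ->
  blip g -> blip k -> qder j g k -> torus_integral k = 0.
Proof.
elim: n j g k => [[]//|n IH] j g k pg bg bk [C gC].
rewrite (torus_integralS (k : 'rV[R]_(1 + n) -> R)).
have sh (t s r : R) (x y : 'rV[R]_n) :
    (row_mx (t%:M : 'rV[R]_1) x) + s *: row_mx (r%:M : 'rV[R]_1) y =
    row_mx ((t + s * r)%:M : 'rV[R]_1) (x + s *: y).
  by rewrite scale_row_mx add_row_mx scale_scalar_mx -raddfD.
move: (fintype.splitK (j : 'I_(1 + n))).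
case: (fintype.split (j : 'I_(1 + n))) => j' /= Ej.
  have dE : (delta_mx 0 (j : 'I_(1 + n)) : 'rV[R]_(1 + n)) =
      row_mx (1%:M : 'rV[R]_1) (0 : 'rV[R]_n).
    apply/rowP => i; rewrite -Ej -(fintype.splitK i); case: fintype.split => i' /=.
      by rewrite row_mxEl !mxE /= (ord1 i') (ord1 j') !eqxx.
    rewrite row_mxEr !mxE /= (_ : (_ == _) = false)//.
    by apply/negbTE; rewrite eq_rlshift.
  pose F t := torus_integral (slice (g : 'rV[R]_(1 + n) -> R) t).
  pose F1 t := torus_integral (slice (k : 'rV[R]_(1 + n) -> R) t).
  have FC t s : `|F (t + s *: 1) - F t - s * F1 t| <= (2 * pi) ^+ n * C * s ^+ 2.
    have bgt r := blip_slice (g := (g : 'rV[R]_(1 + n) -> R)) r bg.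
    have bkt r := blip_slice (g := (k : 'rV[R]_(1 + n) -> R)) r bk.
    rewrite /F /F1 -torus_integralB// -torus_integralZ//.
    rewrite -torus_integralB//; [|exact: blipB|exact: blipZ].
    rewrite -mulrA; apply: torus_integral_bound.
      by apply: blipB; [exact: blipB|exact: blipZ].
    move=> y; have := gC (row_mx (t%:M : 'rV[R]_1) y) s.
    rewrite dE sh mulr1 scaler0 addr0 /slice.
    by rewrite (_ : s *: (1 : R) = s) //; exact: mulr1.
  have dF t := quadratic_is_derive (FC t).
  have p0 := @pi2_gt0 R.
  have cF : continuous F by exact: (continuous_torus_integral_slice (g := (g : 'rV[R]_(1 + n) -> R))).
  rewrite /Rintegral (continuous_FTC2 (F := F))//.
  - have -> : F (2 * pi) = F 0.
      congr torus_integral; apply/funext => y; rewrite /slice -[in RHS]pg dE sh.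
      by rewrite mulr1 add0r scaler0 addr0.
    by rewrite -EFinD subrr.
  - apply: continuous_subspaceT.
    exact: (continuous_torus_integral_slice (g := (k : 'rV[R]_(1 + n) -> R))).
  - split.
    + by move=> t _; exact: ex_derive.
    + by apply: cvg_at_right_filter; exact: cF.
    + by apply: cvg_at_left_filter; exact: cF.
  - by move=> t _; rewrite derive1E derive_val.
have dE : (delta_mx 0 (j : 'I_(1 + n)) : 'rV[R]_(1 + n)) =
    row_mx (0%:M : 'rV[R]_1) (delta_mx 0 j' : 'rV[R]_n).
  apply/rowP => i; rewrite -Ej -(fintype.splitK i); case: fintype.split => i' /=.
    rewrite row_mxEl !mxE /= mul0rn (_ : (_ == _) = false)//.
    by apply/negbTE; rewrite eq_lrshift.
  by rewrite row_mxEr !mxE eq_rshift.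
rewrite -[RHS](mul0r (fine (lebesgue_measure (`[0, 2 * pi] : set R)))) -Rintegral_cst//.
apply: eq_Rintegral => t _; apply: (IH j' (slice (g : 'rV[R]_(1 + n) -> R) t)).
- move=> y; rewrite /slice -[in RHS]pg dE sh.
  by rewrite mulr0 addr0.
- exact: (blip_slice (g := (g : 'rV[R]_(1 + n) -> R))).
- exact: (blip_slice (g := (k : 'rV[R]_(1 + n) -> R))).
- exists C => y s; have := gC (row_mx (t%:M : 'rV[R]_1) y) s.
  by rewrite dE sh mulr0 addr0.
Qed.

(** * Completeness of the trigonometric system *)

Lemma derive_bound_lipschitz (R : realType) (F F' : R -> R) (B : R) :
  (forall t, is_derive t (1 : R) F (F' t)) -> (forall t, `|F' t| <= B) ->
  forall s t, `|F s - F t| <= B * `|s - t|.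
Proof.
move=> dF F'B.
have key s t : s < t -> `|F s - F t| <= B * `|s - t|.
  move=> st.
  have [c _ E] := MVT st (fun x _ => dF x)
    (derivable_within_continuous (fun x _ => @ex_derive _ _ _ _ _ _ _ (dF x))).
  by rewrite distrC [`|s - t|]distrC E normrM ler_wpM2r.
move=> s t; have [st|ts|->] := ltgtP s t; first exact: key.
  by rewrite distrC [`|s - t|]distrC; exact: key.
by rewrite !subrr normr0 mulr0.
Qed.

Lemma le_of_eq (R : realType) (x y : R) : x = y -> x <= y.
Proof. by move=> ->. Qed.

Section Completeness1.
Context {R : realType}.
Local Notation I F := (\int[lebesgue_measure]_(t in `[0, 2 * pi]) (F t : R)).

Lemma Rintegral_lin (a : R) (F H : R -> R) : continuous F -> continuous H ->
  \int[lebesgue_measure]_(t in `[0, 2 * pi]) (a * F t + H t) = a * I F + I H.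
Proof.
move=> cF cH; have iF := continuous_integrable_itv 0 (2 * pi) cF.
have iH := continuous_integrable_itv 0 (2 * pi) cH.
rewrite RintegralD//; first by rewrite RintegralZl.
by apply: continuous_integrable_itv => x; apply: cvgM; [exact: cvg_cst|exact: cF].
Qed.

Lemma cos_lipschitz (s t : R) : `|cos s - cos t| <= `|s - t|.
Proof.
rewrite -[leRHS]mul1r; apply: derive_bound_lipschitz (fun t => is_derive_cos t) _ s t.
by move=> u; rewrite normrN sin_max.
Qed.

Lemma sin_lipschitz (s t : R) : `|sin s - sin t| <= `|s - t|.
Proof.
rewrite -[leRHS]mul1r; apply: derive_bound_lipschitz (fun t => is_derive_sin t) _ s t.
by move=> u; rewrite cos_max.
Qed.

Lemma continuous_cos_affine (k b : R) : continuous (fun t : R => cos (k * t + b)).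
Proof.
apply: (@lipschitz_continuous _ _ `|k|) => s t; apply: le_trans (cos_lipschitz _ _) _.
by rewrite -normrM; apply: le_of_eq; congr `| _ |; ring.
Qed.

Variable G : R -> R.
Hypothesis G_continuous : continuous G.
Hypothesis G_orthogonal : forall (k : int) b, I (fun t => G t * cos (k%:~R * t + b)) = 0.

Lemma continuous_peak (d t0 : R) n :
  continuous (fun t => G t * (1 + (cos (t - t0) - d)) ^+ n).
Proof.
have c1 : continuous (fun t => 1 + (cos (t - t0) - d)).
  apply: (@lipschitz_continuous _ _ 1) => s t; rewrite mul1r.
  apply: le_trans (_ : `|cos (s - t0) - cos (t - t0)| <= _).
    by apply: le_of_eq; congr `| _ |; ring.
  by apply: le_trans (cos_lipschitz _ _) _; apply: le_of_eq; congr `| _ |; ring.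
elim: n => [|n IH] t.
  by under eq_fun do rewrite expr0 mulr1; exact: G_continuous.
under eq_fun do rewrite exprS mulrCA.
by apply: cvgM; [exact: c1|exact: IH].
Qed.

(** Powers of 1 + cos (t - t0) - d are trigonometric polynomials, hence
    orthogonal to G; the induction multiplies by one more factor, which shifts the
    frequency k by one in either direction. *)
Lemma orthogonal_peak (d t0 : R) n (k : int) b :
  I (fun t => G t * (1 + (cos (t - t0) - d)) ^+ n * cos (k%:~R * t + b)) = 0.
Proof.
have cK := @continuous_peak d t0.
have cKc m (j : int) a :
    continuous (fun t => G t * (1 + (cos (t - t0) - d)) ^+ m * cos (j%:~R * t + a)).
  by move=> t; apply: cvgM; [exact: cK|exact: continuous_cos_affine].
elim: n k b => [|n IH] k b.
  rewrite -[RHS](G_orthogonal k b); apply: eq_Rintegral => t _.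
  by rewrite expr0 mulr1.
pose A j a t := G t * (1 + (cos (t - t0) - d)) ^+ n * cos (j%:~R * t + a).
transitivity (I (fun t => (1 - d) * A k b t +
    (2^-1 * A (k + 1) (b - t0) t + (2^-1 * A (k - 1) (b + t0) t + 0)))).
  apply: eq_Rintegral => t _; rewrite /A exprS.
  have -> : (k + 1)%:~R * t + (b - t0) = (k%:~R * t + b) + (t - t0) by rewrite intrD; ring.
  have -> : (k - 1)%:~R * t + (b + t0) = (k%:~R * t + b) - (t - t0) by rewrite intrB; ring.
  by rewrite [cos (_ + (t - t0))]cosD [cos (_ - (t - t0))]cosB; field.
have c0 : continuous (fun _ : R => 0 : R) by move=> t; exact: cst_continuous.
have cA : continuous (fun t => 2^-1 * A (k - 1) (b + t0) t + 0).
  by move=> t; apply: cvgD; [apply: cvgM; [exact: cvg_cst|exact: cKc]|exact: cvg_cst].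
rewrite Rintegral_lin; [|exact: cKc|]; last first.
  by move=> t; apply: cvgD; [apply: cvgM; [exact: cvg_cst|exact: cKc]|exact: cA].
rewrite Rintegral_lin; [|exact: cKc|exact: cA].
rewrite Rintegral_lin; [|exact: cKc|exact: c0].
by rewrite !IH Rintegral_cst//; ring.
Qed.

(** If G(t0) = c > 0, then G >= c / 2 on |t - t0| <= d.  The peak function
    1 + cos (t - t0) - cos d is at least 1 there and of modulus at most 1 elsewhere on
    the period, so by Bernoulli G times its n-th power is at least
    (c / 2) n max(0, cos (t - t0) - cos d) - K.  The integral would tend to infinity
    with n, but it vanishes. *)
Lemma orthogonal_le0 (t0 K : R) : 0 < t0 < 2 * pi -> (forall t, `|G t| <= K) ->
  G t0 <= 0.
Proof.
move=> /andP[t00 t02] GK; rewrite leNgt; apply/negP => c0.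
set c := G t0 in c0; have p0 := @pi_gt0 R; have pi0 := @pi2_gt0 R.
have /cvgrPdist_le/(_ _ (divr_gt0 c0 (ltr0n R 2))) := @G_continuous t0.
move=> /nbhs_normP[/= r r0 near_t0].
(* d <= t0 and d <= 2 pi - t0 keep the peaks around t0 - 2 pi and t0 + 2 pi away from
   the interior of the period [0, 2 pi] *)
pose d := Num.min (Num.min t0 (2 * pi - t0)) (Num.min pi (r / 2)).
have d0 : 0 < d by rewrite !lt_min t00 p0 divr_gt0//= andbT subr_gt0.
have dt0 : d <= t0 by rewrite !ge_min lexx.
have dt1 : d <= 2 * pi - t0 by rewrite !ge_min lexx !orbT.
have dpi : d <= pi by rewrite !ge_min lexx !orbT.
have dr : d < r.
  by apply: le_lt_trans (_ : d <= r / 2) _; [rewrite !ge_min lexx !orbT|lra].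
have cos_le (x y : R) : 0 <= x -> x <= y -> y <= pi -> cos y <= cos x.
  move=> x0; rewrite le_eqVlt => /predU1P[->//|xy] yp.
  apply/ltW; rewrite ltr_cos// in_itv/= ?x0 ?yp ?andbT.
    by rewrite (le_trans (ltW xy)).
  by rewrite (le_trans x0 (ltW xy)).
pose ka (t : R) : R := cos (t - t0) - cos d.
have kaL s t : `|ka s - ka t| <= `|s - t|.
  rewrite /ka; apply: le_trans (_ : `|cos (s - t0) - cos (t - t0)| <= _).
    by apply: le_of_eq; congr `| _ |; ring.
  by apply: le_trans (cos_lipschitz _ _) _; apply: le_of_eq; congr `| _ |; ring.
pose kp (t : R) : R := Num.max 0 (ka t).
have ckp : continuous kp.
  apply: (@lipschitz_continuous _ _ 1) => s t; rewrite mul1r.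
  apply: le_trans (kaL s t); rewrite /kp !maxEle.
  by case: (leP 0 (ka s)); case: (leP 0 (ka t)); rewrite ?subrr ?normr0// => ? ?;
    rewrite ler_norml; have := ler_norm (ka s - ka t);
    have := ler_norm (- (ka s - ka t)); rewrite normrN; lra.
have kin t : `|t - t0| <= d -> 0 <= ka t.
  by move=> td; rewrite subr_ge0 -(cos_norm (t - t0)); apply: cos_le.
have kout (t : R) : 0 <= t <= 2 * pi -> d < `|t - t0| -> ka t <= 0.
  move=> t02p td; rewrite subr_le0 -(cos_norm (t - t0)).
  set th := `|t - t0| in td *.
  have [thp|pth] := leP th pi; first by apply: cos_le => //; exact: ltW.
  rewrite -(cosN th) -(cosD2pi (- th)).
  have th2 : th <= 2 * pi - d by rewrite /th ler_norml; lra.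
  by apply: cos_le; rewrite ?(ltW d0)// -mulr_natl; lra.
have Glow t : `|t - t0| <= d -> c / 2 <= G t.
  move=> td; have : `|G t0 - G t| <= c / 2.
    by apply: near_t0; rewrite /= distrC; exact: le_lt_trans td dr.
  by rewrite ler_norml -/c; lra.
have K0 : 0 <= K by exact: le_trans (GK 0).
have low n (t : R) : 0 <= t <= 2 * pi ->
    (c / 2 * n%:R) * kp t + - K <= G t * (1 + (cos (t - t0) - cos d)) ^+ n.
  move=> tI; rewrite -/(ka t) /kp; have [td|td] := leP `|t - t0| d.
    have k0 := kin t td; rewrite max_r//.
    have bern : 1 + n%:R * ka t <= (1 + ka t) ^+ n.
      elim: n => [|n IH]; first by rewrite mul0r addr0 expr0.
      rewrite exprS; apply: le_trans (ler_wpM2l _ IH); last by rewrite addr_ge0.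
      rewrite -natr1; have : 0 <= n%:R * ka t * ka t by rewrite !mulr_ge0.
      nra.
    have h1 : 0 <= n%:R * ka t by rewrite mulr_ge0.
    apply: le_trans (_ : c / 2 * (1 + n%:R * ka t) <= _); first by nra.
    apply: ler_pM => //; [lra|lra|exact: Glow].
  have k0 := kout t tI td; rewrite max_l// mulr0 add0r.
  have : `|G t * (1 + ka t) ^+ n| <= K.
    rewrite normrM -[leRHS]mulr1; apply: ler_pM => //.
    rewrite normrX exprn_ile1// ler_norml.
    have := cos_geN1 (t - t0); have := cos_le1 d; move: k0; rewrite /ka; lra.
  by rewrite ler_norml => /andP[].
have cG := @continuous_peak (cos d) t0.
have cK : continuous (fun _ : R => - K) by move=> t; exact: cst_continuous.
have J0 : 0 < I kp.
  have hd : 0 < d / 2 by lra.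
  pose P := [set` `[t0 - d / 2, t0 + d / 2]] : set R.
  have k1 : 0 < cos (d / 2) - cos d.
    rewrite subr_gt0 ltr_cos ?in_itv/=; lra.
  have PI : P `<=` `[0, 2 * pi] by move=> t; rewrite /P /= !in_itv/=; lra.
  apply: lt_le_trans (_ : \int[lebesgue_measure]_(t in P) (cos (d / 2) - cos d) <= _).
    have mP : lebesgue_measure P = d%:E.
      rewrite /P lebesgue_measure_itv/= lte_fin.
      have -> : t0 - d / 2 < t0 + d / 2 by lra.
      by rewrite -EFinB; congr EFin; field.
    rewrite Rintegral_cst; last exact: measurable_itv.
    suff -> : fine (lebesgue_measure P) = d by rewrite mulr_gt0.
    by rewrite mP.
  apply: le_trans (_ : \int[lebesgue_measure]_(t in P) kp t <= _).
    apply: le_Rintegral; first exact: measurable_itv.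
    - by apply: continuous_integrable_itv => t; exact: cst_continuous.
    - exact: continuous_integrable_itv.
    - move=> t; rewrite /P /= in_itv/= => tP; rewrite /kp le_max; apply/orP; right.
      rewrite /ka lerD2r -(cos_norm (t - t0)); apply: cos_le => //; last lra.
      by rewrite ler_norml; lra.
  have iP := continuous_integrable_itv (t0 - d / 2) (t0 + d / 2) ckp.
  have iI := continuous_integrable_itv 0 (2 * pi) ckp.
  rewrite /Rintegral fine_le//; [exact: integrable_fin_num iP|exact: integrable_fin_num iI|].
  apply: ge0_subset_integral => //; first exact: measurable_itv.
    exact: (measurable_int _ iI).
  by move=> t _; rewrite lee_fin /kp le_max lexx.
have main n : c / 2 * n%:R * I kp <= 2 * pi * K.
  have : I (fun t => (c / 2 * n%:R) * kp t + - K) <=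
         I (fun t => G t * (1 + (cos (t - t0) - cos d)) ^+ n).
    apply: le_Rintegral => //.
    - apply: continuous_integrable_itv => t; apply: cvgD; last exact: cvg_cst.
      by apply: cvgM; [exact: cvg_cst|exact: ckp].
    - exact: continuous_integrable_itv.
    - by move=> t; rewrite /= in_itv/=; exact: low.
  have -> : I (fun t => G t * (1 + (cos (t - t0) - cos d)) ^+ n) = 0.
    rewrite -[RHS](orthogonal_peak (cos d) t0 n 0 0); apply: eq_Rintegral => t _.
    by rewrite mul0r add0r cos0 mulr1.
  rewrite (Rintegral_lin _ ckp cK) Rintegral_cst//= lebesgue_measure_itv/= lte_fin pi0.
  by rewrite -EFinD/= subr0 mulNr subr_le0 [K * _]mulrC.
have cJ : 0 < c / 2 * I kp by rewrite mulr_gt0// divr_gt0.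
have [n nK] : exists n : nat, 2 * pi * K / (c / 2 * I kp) < n%:R.
  exists (Num.truncn (2 * pi * K / (c / 2 * I kp))).+1; exact: truncnS_gt.
by move: nK; rewrite ltr_pdivrMr// ltNge => /negP; apply; rewrite mulrCA mulrA.
Qed.

End Completeness1.

Lemma periodic_orthogonal_eq0 (R : realType) (G : R -> R) (K : R) :
  continuous G -> (forall t, `|G t| <= K) -> (forall t, G (t + 2 * pi) = G t) ->
  (forall (k : int) b,
    \int[lebesgue_measure]_(t in `[0, 2 * pi]) (G t * cos (k%:~R * t + b)) = 0) ->
  forall t, G t = 0.
Proof.
move=> cG GK pG G0; have p0 := @pi2_gt0 R.
have inner t : 0 < t < 2 * pi -> G t = 0.
  move=> tI; apply/eqP; rewrite eq_le (orthogonal_le0 cG G0 tI GK) /=.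
  rewrite -oppr_le0; apply: (@orthogonal_le0 _ (fun t => - G t) _ _ t K) => //.
  - by move=> s; apply: cvgN; exact: cG.
  - move=> k b; under eq_Rintegral do rewrite mulNr -mulN1r.
    rewrite RintegralZl// ?G0 ?mulr0//.
    apply: continuous_integrable_itv => s.
    by apply: cvgM; [exact: cG|exact: continuous_cos_affine].
  - by move=> s; rewrite normrN.
have G00 : G 0 = 0.
  apply/eqP; rewrite -normr_le0; apply/ler_addgt0Pr => e e0; rewrite add0r.
  have /cvgrPdist_le/(_ _ e0)/nbhs_normP[/= r r0 near0] := cG 0.
  pose s := Num.min (r / 2) pi.
  have s0 : 0 < s by rewrite lt_min pi_gt0 divr_gt0.
  have sr : s <= r / 2 by rewrite ge_min lexx.
  have sp : s <= pi by rewrite ge_min lexx orbT.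
  have : `|G 0 - G s| <= e by apply: near0; rewrite /= sub0r normrN gtr0_norm//; lra.
  by rewrite (inner s) ?subr0//; have := @pi_gt0 R; lra.
move=> t; pose k := Num.floor (t / (2 * pi)).
pose r := t - k%:~R * (2 * pi).
have pern m s : G (s + m%:R * (2 * pi)) = G s.
  elim: m => [|m IH]; first by rewrite mul0r addr0.
  by rewrite -(natr1 m) mulrDl mul1r addrA pG.
have per (m : int) s : G (s + m%:~R * (2 * pi)) = G s.
  case: m => m; first exact: pern.
  by rewrite NegzE mulrNz mulNr -(pern m.+1 (s - _)) subrK.
have -> : G t = G r by rewrite -(per k r) /r subrK.
have [r0 r2] : 0 <= r /\ r < 2 * pi.
  have /andP[] := real_floor_itv (num_real (t / (2 * pi))).
  rewrite -/k ler_pdivlMr// ltr_pdivrMr// intrD mulrDl mul1r /r; lra.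
move: r0; rewrite le_eqVlt => /predU1P[<-//|r0]; apply: inner.
by rewrite r0.
Qed.

Definition phase {R : realType} n (xi : 'rV[int]_n) (x : 'rV[R]_n) : R :=
  \sum_j (xi 0 j)%:~R * x 0 j.

Section Phase.
Context {R : realType} {n : nat}.
Implicit Types (xi eta : 'rV[int]_n) (x y : 'rV[R]_n).

Lemma phase_row_mx (k : int) xi (t : R) x :
  phase (row_mx (k%:M : 'rV_1) xi) (row_mx (t%:M : 'rV[R]_1) x) = k%:~R * t + phase xi x.
Proof.
rewrite /phase big_split_ord big_ord1 !row_mxEl !mxE eqxx !mulr1n.
by congr (_ + _); apply: eq_bigr => j _; rewrite !row_mxEr.
Qed.

Lemma phase_lipschitz xi x y :
  `|phase xi x - phase xi y| <= (\sum_j `|(xi 0 j)%:~R|) * dist1 x y.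
Proof.
rewrite /phase -sumrB; apply: le_trans (ler_norm_sum _ _ _) _.
rewrite mulr_suml; apply: ler_sum => j _; rewrite -mulrBr normrM; apply: ler_wpM2l => //.
by rewrite /dist1 (bigD1 j)//= lerDl sumr_ge0.
Qed.

Lemma blip_phase (F : R -> R) xi b : (forall t, `|F t| <= 1) ->
  (forall s t, `|F s - F t| <= `|s - t|) -> blip (fun x => F (phase xi x + b)).
Proof.
move=> F1 FL; split; first by exists 1.
exists (\sum_j `|(xi 0 j)%:~R|) => x y; apply: le_trans (FL _ _) _.
by rewrite opprD addrACA subrr addr0; exact: phase_lipschitz.
Qed.

Lemma phase_shift xi x s j :
  phase xi (x + s *: delta_mx 0 j) = phase xi x + s * (xi 0 j)%:~R.
Proof.
rewrite /phase (bigD1 j)//= [in RHS](bigD1 j)//= !mxE !eqxx /= mulr1 mulrDr.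
rewrite [_ * s]mulrC addrAC; congr (_ + _ + _).
by apply: eq_bigr => i /negbTE ij; rewrite !mxE ij andbF mulr0 addr0.
Qed.

Lemma phaseD xi eta x : phase (xi + eta) x = phase xi x + phase eta x.
Proof.
by rewrite /phase -big_split /=; apply: eq_bigr => j _; rewrite !mxE intrD mulrDl.
Qed.

Lemma phaseN xi x : phase (- xi) x = - phase xi x.
Proof.
by rewrite /phase -sumrN; apply: eq_bigr => j _; rewrite !mxE mulrNz mulNr.
Qed.

End Phase.

Lemma periodic_int (R : realType) (F : R -> R) :
  (forall t, F (t + pi *+ 2) = F t) -> forall (m : int) t, F (t + 2 * pi * m%:~R) = F t.
Proof.
move=> pF.
have pern m t : F (t + 2 * pi * m%:R) = F t.
  elim: m => [|m IH]; first by rewrite mulr0 addr0.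
  by rewrite -(natr1 m) mulrDr mulr1 addrA [2 * pi]mulr_natl pF -mulr_natl.
case=> m t; first exact: pern.
by rewrite NegzE mulrNz mulrN -(pern m.+1 (t - _)) subrK.
Qed.

(** Integrating g over the last n variables against a fixed frequency leaves a
    periodic function of the first variable with vanishing coefficients, hence zero;
    then every slice of g has vanishing coefficients, and the dimension drops.  The
    arbitrary phase b merges the sine and cosine coefficients. *)
Lemma torus_complete (R : realType) n (g : 'rV[R]_n -> R) :
  blip g -> (forall j x, g (x + (2 * pi) *: delta_mx 0 j) = g x) ->
  (forall xi b, torus_integral (fun x => g x * cos (phase xi x + b)) = 0) ->
  forall x, g x = 0.
Proof.
have bc m (xi : 'rV[int]_m) b : blip (fun x : 'rV[R]_m => cos (phase xi x + b)).
  by apply: blip_phase; [exact: cos_max|exact: cos_lipschitz].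
elim: n g => [|n IH] g bg pg g0 x.
  have := g0 0 0; rewrite /= /phase big_ord0 addr0 cos0 mulr1 => <-.
  by congr g; apply/rowP => -[].
have dl : (delta_mx 0 (lshift n (0 : 'I_1)) : 'rV[R]_(1 + n)) = row_mx (1%:M : 'rV[R]_1) 0.
  apply/rowP => i; rewrite -(fintype.splitK i); case: fintype.split => i' /=.
    by rewrite row_mxEl !mxE /= (ord1 i') !eqxx.
  by rewrite row_mxEr !mxE eq_rlshift andbF.
have dr j : (delta_mx 0 (rshift 1 j) : 'rV[R]_(1 + n)) =
    row_mx (0 : 'rV[R]_1) (delta_mx 0 j : 'rV[R]_n).
  apply/rowP => i; rewrite -(fintype.splitK i); case: fintype.split => i' /=.
    by rewrite row_mxEl !mxE eq_lrshift andbF.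
  by rewrite row_mxEr !mxE eq_rshift.
pose g' : 'rV[R]_(1 + n) -> R := g.
have bg' : blip g' by [].
suff slice0 t y : slice g' t y = 0.
  rewrite -[x](@hsubmxK _ 1 1 n) (mx11_scalar (lsubmx _)).
  exact: slice0.
have [[K gK] _] := bg.
apply: (IH (slice g' t)) => [|j {}y|xi b].
- exact: blip_slice.
- rewrite /slice /g' -[RHS](pg (rshift 1 j)); congr g.
  rewrite [RHS](_ : _ = row_mx t%:M y + (2 * pi) *: delta_mx 0 (rshift 1 j))//.
  by rewrite dr scale_row_mx scaler0 add_row_mx addr0.
pose G s := torus_integral (fun y => slice g' s y * cos (phase xi y + b)).
pose gc : 'rV[R]_(1 + n) -> R :=
  fun x => g' x * cos (phase (row_mx (0%:M : 'rV_1) xi) x + b).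
have bgc : blip gc by exact: blipM.
have Gc s : G s = torus_integral (slice gc s).
  congr torus_integral; apply/funext => y'.
  by rewrite /slice /gc phase_row_mx mul0r add0r.
apply: (@periodic_orthogonal_eq0 R G ((2 * pi) ^+ n * K)).
- have := continuous_torus_integral_slice bgc.
  by rewrite (_ : (fun _ => _) = G)//; apply/funext => s; rewrite Gc.
- move=> s; apply: torus_integral_bound.
    by apply: blipM; [exact: blip_slice|exact: bc].
  move=> y'; rewrite normrM -[K]mulr1; apply: ler_pM => //; [exact: gK|exact: cos_max].
- move=> s; congr torus_integral; apply/funext => y'; congr (_ * _).
  rewrite /slice /g' -[RHS](pg (lshift n (0 : 'I_1))); congr g.
  rewrite [RHS](_ : _ = row_mx s%:M y' + (2 * pi) *: delta_mx 0 (lshift n (0 : 'I_1)))//.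
  by rewrite dl scale_row_mx scaler0 add_row_mx addr0 scale_scalar_mx mulr1 -raddfD.
- move=> k a.
  pose e j c := fun x => g' x * cos (phase (row_mx ((j : int)%:M : 'rV_1) xi) x + c).
  have be j c : blip (e j c) by exact: blipM.
  transitivity (torus_integral (fun x => 2^-1 * (e k (b + a) x + e (- k) (b - a) x))).
    rewrite [RHS](torus_integralS (fun x => 2^-1 * (e k (b + a) x + e (- k) (b - a) x))).
    apply: eq_Rintegral => s _; rewrite /G mulrC -torus_integralZ; last first.
      by apply: blipM; [exact: blip_slice|exact: bc].
    congr torus_integral; apply/funext => y'; rewrite /slice /e !phase_row_mx.
    have -> : k%:~R * s + phase xi y' + (b + a) = (phase xi y' + b) + (k%:~R * s + a) by ring.
    have -> : (- k)%:~R * s + phase xi y' + (b - a) = (phase xi y' + b) - (k%:~R * s + a).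
      by rewrite mulrNz; ring.
    rewrite [cos (_ + (k%:~R * s + a))]cosD [cos (_ - (k%:~R * s + a))]cosB.
    by field.
  rewrite torus_integralZ; last exact: blipD.
  by rewrite torus_integralD// [torus_integral (e _ _)]g0 [torus_integral (e _ _)]g0 addr0 mulr0.
Qed.

(** * Complex integrals and exponentials *)

Section ComplexModulus.
Context {R : realType}.
Implicit Types z w : R[i].

Lemma normc_ge_Re z : `|complex.Re z| <= normc z.
Proof.
case: z => a b /=; rewrite -sqrtr_sqr; apply: ler_wsqrtr.
by rewrite lerDl sqr_ge0.
Qed.

Lemma normc_ge_Im z : `|complex.Im z| <= normc z.
Proof.
case: z => a b /=; rewrite -sqrtr_sqr; apply: ler_wsqrtr.
by rewrite lerDr sqr_ge0.
Qed.

Lemma normc_le_ReIm z : normc z <= `|complex.Re z| + `|complex.Im z|.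
Proof.
case: z => a b /=.
have -> : `|a| + `|b| = Num.sqrt ((`|a| + `|b|) ^+ 2).
  by rewrite sqrtr_sqr [RHS]ger0_norm// addr_ge0.
apply: ler_wsqrtr; rewrite sqrrD !real_normK ?num_real// lerD2r lerDl.
by rewrite mulrn_wge0// mulr_ge0.
Qed.

Lemma ReD z w : complex.Re (z + w) = complex.Re z + complex.Re w.
Proof. by case: z w => [? ?] [? ?]. Qed.

Lemma ImD z w : complex.Im (z + w) = complex.Im z + complex.Im w.
Proof. by case: z w => [? ?] [? ?]. Qed.

Lemma ReN z : complex.Re (- z) = - complex.Re z.
Proof. by case: z. Qed.

Lemma ImN z : complex.Im (- z) = - complex.Im z.
Proof. by case: z. Qed.

Lemma ReM z w : complex.Re (z * w) =
  complex.Re z * complex.Re w - complex.Im z * complex.Im w.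
Proof. by case: z w => [? ?] [? ?]. Qed.

Lemma ImM z w : complex.Im (z * w) =
  complex.Re z * complex.Im w + complex.Im z * complex.Re w.
Proof. by case: z w => [? ?] [? ?]. Qed.

Lemma complex_eq z w : complex.Re z = complex.Re w -> complex.Im z = complex.Im w -> z = w.
Proof. by case: z w => [? ?] [? ?] /= -> ->. Qed.

End ComplexModulus.

Section ComplexIntegral.
Context {R : realType} {n : nat}.
Implicit Types (f g k l : 'rV[R]_n -> R[i]).

Definition cblip f := blip (fun x => complex.Re (f x)) /\ blip (fun x => complex.Im (f x)).

Definition cintegral f : R[i] :=
  torus_integral (fun x => complex.Re (f x)) +i* torus_integral (fun x => complex.Im (f x)).

Definition cqder j f k :=
  qder j (fun x => complex.Re (f x)) (fun x => complex.Re (k x)) /\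
  qder j (fun x => complex.Im (f x)) (fun x => complex.Im (k x)).

Lemma torus_pairingE f g : torus_pairing f g = cintegral (fun x => f x * g x).
Proof. by []. Qed.

Lemma cblip_cst c : cblip (fun=> c).
Proof. by split; exact: blip_cst. Qed.

Lemma cblipD f g : cblip f -> cblip g -> cblip (fun x => f x + g x).
Proof.
move=> [f1 f2] [g1 g2]; split.
  by under eq_fun do rewrite ReD; exact: blipD.
by under eq_fun do rewrite ImD; exact: blipD.
Qed.

Lemma cblipM f g : cblip f -> cblip g -> cblip (fun x => f x * g x).
Proof.
move=> [f1 f2] [g1 g2]; split.
  by under eq_fun do rewrite ReM; apply: blipB; exact: blipM.
by under eq_fun do rewrite ImM; apply: blipD; exact: blipM.
Qed.

Lemma cblipZ c f : cblip f -> cblip (fun x => c * f x).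
Proof. by apply: cblipM; exact: cblip_cst. Qed.

Lemma cblip_sum (I : Type) (s : seq I) (F : I -> 'rV[R]_n -> R[i]) :
  (forall i, cblip (F i)) -> cblip (fun x => \sum_(i <- s) F i x).
Proof.
move=> bF; elim: s => [|i s IH].
  by under eq_fun do rewrite big_nil; exact: cblip_cst.
by under eq_fun do rewrite big_cons; exact: cblipD.
Qed.

Lemma cintegral_lin c f g : cblip f -> cblip g ->
  cintegral (fun x => c * f x + g x) = c * cintegral f + cintegral g.
Proof.
move=> [f1 f2] [g1 g2]; case: c => a b; apply: complex_eq => /=.
  under [X in torus_integral X]eq_fun do rewrite ReD ReM /= -addrA -mulNr.
  rewrite torus_integral_lin//; last by apply: blipD => //; exact: blipZ.
  by rewrite torus_integral_lin// addrA mulNr.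
under [X in torus_integral X]eq_fun do rewrite ImD ImM /= -addrA.
rewrite torus_integral_lin//; last by apply: blipD => //; exact: blipZ.
by rewrite torus_integral_lin// addrA.
Qed.

Lemma cintegral_bound f K : cblip f -> (forall x, normc (f x) <= K) ->
  normc (cintegral f) <= 2 * (2 * pi) ^+ n * K.
Proof.
move=> [f1 f2] fK; apply: le_trans (normc_le_ReIm _) _ => /=.
rewrite -mulrA mulr_natl mulr2n; apply: lerD; apply: torus_integral_bound => // x.
  by apply: le_trans (fK x); exact: normc_ge_Re.
by apply: le_trans (fK x); exact: normc_ge_Im.
Qed.

Lemma cintegral_cst c : cintegral (fun=> c) = ((2 * pi) ^+ n)%:C * c.
Proof.
by rewrite /cintegral !torus_integral_cst; case: c => a b; apply: complex_eq => /=; ring.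
Qed.

Lemma cintegralD f g : cblip f -> cblip g ->
  cintegral (fun x => f x + g x) = cintegral f + cintegral g.
Proof.
move=> bf bg; rewrite -[cintegral f]mul1r -cintegral_lin//.
by congr cintegral; apply/funext => x; rewrite mul1r.
Qed.

Lemma cintegralZ c f : cblip f -> cintegral (fun x => c * f x) = c * cintegral f.
Proof.
move=> bf; have := cintegral_lin c bf (cblip_cst 0).
rewrite cintegral_cst mulr0 addr0 => <-.
by congr cintegral; apply/funext => x; rewrite addr0.
Qed.

Lemma cintegral_sum (I : Type) (s : seq I) (F : I -> 'rV[R]_n -> R[i]) :
  (forall i, cblip (F i)) ->
  cintegral (fun x => \sum_(i <- s) F i x) = \sum_(i <- s) cintegral (F i).
Proof.
move=> bF; elim: s => [|i s IH].
  under [X in cintegral X]eq_fun do rewrite big_nil.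
  by rewrite big_nil cintegral_cst mulr0.
under [X in cintegral X]eq_fun do rewrite big_cons.
by rewrite big_cons cintegralD ?IH//; exact: cblip_sum.
Qed.

Lemma cqderM j f g k l : cblip f -> cblip g -> cblip k -> cblip l ->
  cqder j f k -> cqder j g l ->
  cqder j (fun x => f x * g x) (fun x => f x * l x + k x * g x).
Proof.
move=> [f1 f2] [g1 g2] [k1 k2] [l1 l2] [fk1 fk2] [gl1 gl2]; split.
  under eq_fun do rewrite ReM.
  have := qderD (qderM f1 g1 k1 l1 fk1 gl1) (qderN (qderM f2 g2 k2 l2 fk2 gl2)).
  congr qder; apply/funext => x; rewrite ReD !ReM; ring.
under eq_fun do rewrite ImM.
have := qderD (qderM f1 g2 k1 l2 fk1 gl2) (qderM f2 g1 k2 l1 fk2 gl1).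
congr qder; apply/funext => x; rewrite ImD !ImM; ring.
Qed.

Lemma cintegral_cqder j f k : (forall x, f (x + (2 * pi) *: delta_mx 0 j) = f x) ->
  cblip f -> cblip k -> cqder j f k -> cintegral k = 0.
Proof.
move=> pf [f1 f2] [k1 k2] [fk1 fk2]; rewrite /cintegral.
by rewrite (torus_integral_qder _ f1 k1 fk1) ?(torus_integral_qder _ f2 k2 fk2)//
  => x; rewrite pf.
Qed.

Lemma integral_by_parts j f g k l : torus_periodic f -> torus_periodic g ->
  cblip f -> cblip g -> cblip k -> cblip l -> cqder j f k -> cqder j g l ->
  cintegral (fun x => f x * l x) = - cintegral (fun x => k x * g x).
Proof.
move=> pf pg bf bg bk bl fk gl; apply/eqP; rewrite -addr_eq0; apply/eqP.
rewrite -cintegralD; [|exact: cblipM|exact: cblipM].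
apply: (@cintegral_cqder j (fun x => f x * g x)); last exact: cqderM.
- by move=> x; rewrite pf pg.
- exact: cblipM.
- by apply: cblipD; exact: cblipM.
Qed.

End ComplexIntegral.

Lemma derive_lipschitz_quadratic (R : realType) (F F' : R -> R) (B : R) :
  (forall t, is_derive t (1 : R) F (F' t)) ->
  (forall s t, `|F' s - F' t| <= B * `|s - t|) ->
  forall t s, `|F (t + s) - F t - s * F' t| <= B * s ^+ 2.
Proof.
move=> dF F'B t s.
pose H u := F u - u * F' t.
pose H' u := F' u - F' t.
have dH (u : R) : is_derive u (1 : R) H (H' u).
  have dt := @is_deriveM _ _ id (fun=> F' t) u 1 _ _ (is_derive_id u 1) (is_derive_cst (F' t) u 1).
  have := is_deriveB (dF u) dt.
  move/is_derive_eq; apply.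
  rewrite /H' scaler0 add0r; congr (_ - _); exact: mulr1.
have key a b : a < b -> (forall u, a <= u <= b -> `|u - t| <= b - a) ->
   `|H b - H a| <= B * (b - a) ^+ 2.
  move=> ab ut.
  have [u /[!in_itv]/= /andP[au ub] ->] := MVT ab (fun x _ => dH x)
    (derivable_within_continuous (fun x _ => @ex_derive _ _ _ _ _ _ _ (dH x))).
  have ba : 0 <= b - a by lra.
  rewrite normrM (ger0_norm ba) expr2 mulrA; apply: ler_wpM2r => //.
  apply: le_trans (F'B _ _) _.
  have B0 : 0 <= B by have := le_trans (normr_ge0 _) (F'B 1 0); rewrite subr0 normr1 mulr1.
  by apply: ler_wpM2l => //; apply: ut; lra.
have -> : F (t + s) - F t - s * F' t = H (t + s) - H t by rewrite /H; ring.
have [s0|s0|->] := ltgtP s 0.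
- rewrite distrC; have -> : s ^+ 2 = (t - (t + s)) ^+ 2 by ring.
  apply: key; [lra|move=> u ?; rewrite ler_norml; lra].
- have -> : s ^+ 2 = (t + s - t) ^+ 2 by ring.
  apply: key; [lra|move=> u ?; rewrite ler_norml; lra].
- by rewrite addr0 subrr normr0 expr0n mulr0.
Qed.

Lemma cos_quadratic (R : realType) (t s : R) : `|cos (t + s) - cos t - s * - sin t| <= s ^+ 2.
Proof.
rewrite -[leRHS]mul1r; apply: (derive_lipschitz_quadratic (fun t => is_derive_cos t)) => u v.
have -> : - sin u - - sin v = - (sin u - sin v) by ring.
by rewrite mul1r normrN; exact: sin_lipschitz.
Qed.

Lemma sin_quadratic (R : realType) (t s : R) : `|sin (t + s) - sin t - s * cos t| <= s ^+ 2.
Proof.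
rewrite -[leRHS]mul1r; apply: (derive_lipschitz_quadratic (fun t => is_derive_sin t)) => u v.
by rewrite mul1r; exact: cos_lipschitz.
Qed.

Lemma complexi_neq0 (R : realType) : 'i != 0 :> R[i].
Proof. by rewrite eq_complex /= oner_eq0 andbF. Qed.

Section TorusExp.
Context {R : realType} {n : nat}.
Implicit Types (xi eta : 'rV[int]_n) (x y : 'rV[R]_n).

Definition abs1 xi : R := \sum_j `|(xi 0 j)%:~R|.

Lemma abs1_ge0 xi : 0 <= abs1 xi.
Proof. exact: sumr_ge0. Qed.

Lemma abs1_ge xi j : `|(xi 0 j)%:~R| <= abs1 xi.
Proof. by rewrite /abs1 (bigD1 j)//= lerDl sumr_ge0. Qed.

Lemma torus_expE xi x : torus_exp xi x = cos (phase xi x) +i* sin (phase xi x).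
Proof. by []. Qed.

Lemma normc_torus_exp xi x : normc (torus_exp xi x) = 1.
Proof. by rewrite torus_expE /= cos2Dsin2 sqrtr1. Qed.

Lemma torus_expD xi eta x : torus_exp (xi + eta) x = torus_exp xi x * torus_exp eta x.
Proof. by rewrite !torus_expE phaseD cosD sinD; apply: complex_eq => /=; ring. Qed.

Lemma torus_exp0 x : torus_exp 0 x = 1.
Proof.
by rewrite torus_expE /phase big1 ?cos0 ?sin0// => j _; rewrite mxE mul0r.
Qed.

Lemma torus_exp_periodic xi : torus_periodic (torus_exp xi : 'rV[R]_n -> R[i]).
Proof.
move=> j x; rewrite !torus_expE phase_shift.
by rewrite !periodic_int//; [exact: sinD2pi|exact: cosD2pi].
Qed.

Lemma torus_exp_lipschitz xi x y :
  normc (torus_exp xi x - torus_exp xi y) <= 2 * (abs1 xi * dist1 x y).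
Proof.
apply: le_trans (normc_le_ReIm _) _; rewrite mulr_natl mulr2n.
apply: lerD.
  by apply: le_trans (cos_lipschitz _ _) _; exact: phase_lipschitz.
by apply: le_trans (sin_lipschitz _ _) _; exact: phase_lipschitz.
Qed.

(** Explicit constants in terms of the frequency are needed here: this remainder
    is summed over all frequencies of a trigonometric series. *)
Lemma torus_exp_quadratic xi x s j :
  normc (torus_exp xi (x + s *: delta_mx 0 j) - torus_exp xi x -
    s%:C * ('i * (xi 0 j)%:~R * torus_exp xi x)) <= 2 * (abs1 xi ^+ 2 * s ^+ 2).
Proof.
have kE : ((xi 0 j)%:~R : R[i]) = ((xi 0 j)%:~R : R)%:C by rewrite (rmorph_int (real_complex R)).
have sk : (s * (xi 0 j)%:~R) ^+ 2 <= abs1 xi ^+ 2 * s ^+ 2.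
  rewrite exprMn mulrC; apply: ler_wpM2r; first exact: sqr_ge0.
  rewrite -real_normK ?num_real//; apply: lerXn2r; rewrite ?nnegrE ?abs1_ge0//.
  exact: abs1_ge.
apply: le_trans (normc_le_ReIm _) _; rewrite mulr_natl mulr2n.
rewrite kE !torus_expE phase_shift /=; apply: lerD; apply: le_trans sk.
  apply: le_trans (cos_quadratic (phase xi x) _); apply: le_of_eq; congr `| _ |; ring.
apply: le_trans (sin_quadratic (phase xi x) _); apply: le_of_eq; congr `| _ |; ring.
Qed.

Lemma cblip_torus_exp xi : cblip (torus_exp xi : 'rV[R]_n -> R[i]).
Proof.
split.
  have := @blip_phase R n cos xi 0 (@cos_max R) (@cos_lipschitz R).
  by under eq_fun do rewrite addr0.
have := @blip_phase R n sin xi 0 (@sin_max R) (@sin_lipschitz R).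
by under eq_fun do rewrite addr0.
Qed.

Lemma cqder_torus_exp xi j :
  cqder j (torus_exp xi : 'rV[R]_n -> R[i]) (fun x => 'i * (xi 0 j)%:~R * torus_exp xi x).
Proof.
split; exists (2 * abs1 xi ^+ 2) => x s; rewrite -[leRHS]mulrA;
  apply: le_trans (torus_exp_quadratic xi x s j).
  apply: le_trans (normc_ge_Re _); apply: le_of_eq; congr `| _ |.
  by rewrite !ReD !ReN [complex.Re (_%:C * _)]ReM /= mul0r subr0.
apply: le_trans (normc_ge_Im _); apply: le_of_eq; congr `| _ |.
by rewrite !ImD !ImN [complex.Im (_%:C * _)]ImM /= mul0r addr0.
Qed.

Lemma cintegral_torus_exp xi :
  cintegral (torus_exp xi) = if xi == 0 then ((2 * pi) ^+ n)%:C else 0 :> R[i].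
Proof.
have [->|xi0] := eqVneq xi 0.
  rewrite (_ : torus_exp 0 = fun=> 1); last by apply/funext => x; rewrite torus_exp0.
  by rewrite cintegral_cst mulr1.
have [j xij] : exists j, xi 0 j != 0.
  apply/existsP; apply: contraR xi0; rewrite negb_exists => /forallP xi0.
  by apply/eqP/rowP => j; rewrite mxE; apply/eqP; rewrite -[_ == _]negbK.
have b := cblip_torus_exp xi.
have := cintegral_cqder (torus_exp_periodic xi j) b (cblipZ _ b) (cqder_torus_exp xi j).
rewrite cintegralZ// => /eqP; rewrite !mulf_eq0 intr_eq0 (negbTE xij) orbF.
by rewrite (negbTE (complexi_neq0 R)) => /eqP.
Qed.

End TorusExp.

(** * Smooth functions with bounded derivatives *)

Section BoundedSmooth.
Context {R : realType} {N : nat}.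
Implicit Types (g : 'rV[R]_N -> R) (x y : 'rV[R]_N).

Lemma is_derive_line g k y (t : R) : derivable g (y + t *: delta_mx 0 k) (delta_mx 0 k) ->
  is_derive t (1 : R) (fun s : R => g (y + s *: delta_mx 0 k))
    (rpart k g (y + t *: delta_mx 0 k)).
Proof.
have E : (fun h : R => h^-1 *: (g (y + (h *: (1 : R) + t) *: delta_mx 0 k) -
            g (y + t *: delta_mx 0 k))) =
         (fun h : R => h^-1 *: ((g \o shift (y + t *: delta_mx 0 k))
           (h *: delta_mx 0 k) - g (y + t *: delta_mx 0 k))).
  apply/funext => z /=; congr (_ *: (g _ - _)).
  by rewrite scaler1 scalerDl addrCA.
move=> dg; apply: DeriveDef; first by rewrite /derivable /= E.
by rewrite /rpart /derive /= E.
Qed.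

(** Move from y to x one coordinate at a time; only partial derivatives along the
    coordinate axes are known to exist. *)
Lemma bounded_rpart_lipschitz g (B : R) :
  (forall j x, derivable g x (delta_mx 0 j)) -> (forall j x, `|rpart j g x| <= B) ->
  forall x y, `|g x - g y| <= B * dist1 x y.
Proof.
move=> dg gB x y.
have step j z (s : R) : `|g (z + s *: delta_mx 0 j) - g z| <= B * `|s|.
  have := derive_bound_lipschitz (fun t => is_derive_line (dg j (z + t *: delta_mx 0 j)))
    (fun t => gB j _) s 0.
  by rewrite scale0r addr0 subr0.
pose z m : 'rV[R]_N := \row_(j < N) if (j < m)%N then x 0 j else y 0 j.
have key m : (m <= N)%N ->
    `|g (z m) - g y| <= B * \sum_(j < N | (j < m)%N) `|x 0 j - y 0 j|.
  elim: m => [_|m IH mN].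
    rewrite big_pred0// mulr0 (_ : z 0 = y) ?subrr ?normr0//.
    by apply/rowP => j; rewrite mxE.
  pose jm := Ordinal mN.
  have zS : z m.+1 = z m + (x 0 jm - y 0 jm) *: delta_mx 0 jm.
    apply/rowP => j; rewrite !mxE ltnS leq_eqVlt -[X in X || _]/(j == jm :> nat).
    have [->|jm'] := eqVneq j jm; first by rewrite eqxx ltnn /=; ring.
    by rewrite (_ : (j == jm :> nat) = false) ?mulr0 ?addr0//=; apply/negbTE.
  rewrite (bigD1 jm)//= mulrDr.
  have -> : g (z m.+1) - g y = (g (z m.+1) - g (z m)) + (g (z m) - g y) by ring.
  apply: le_trans (ler_normD _ _) _; apply: lerD; first by rewrite zS; exact: step.
  rewrite (eq_bigl (fun j : 'I_N => (j < m)%N)); first exact/IH/ltnW.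
  by move=> j; rewrite ltnS -(inj_eq val_inj) /= ltn_neqAle andbC.
have := key N (leqnn N).
have -> : z N = x by apply/rowP => j; rewrite mxE ltn_ord.
by rewrite (eq_bigl xpredT)// => j; rewrite ltn_ord.
Qed.

Lemma dist1_le_norm x y : dist1 x y <= N%:R * `|x - y|.
Proof.
have -> : N%:R * `|x - y| = \sum_(j < N) `|x - y| by rewrite sumr_const card_ord mulr_natl.
apply: ler_sum => j _.
have -> : x 0 j - y 0 j = (x - y) 0 j by rewrite !mxE.
rewrite -[leRHS]/(mx_norm _) mx_normrE.
exact: (le_bigmax _ (fun ij : 'I_1 * 'I_N => `|(x - y) ij.1 ij.2|) (0, j)).
Qed.

Lemma dist1_continuous g (L : R) : (forall x y, `|g x - g y| <= L * dist1 x y) ->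
  continuous g.
Proof.
move=> gL x; apply/(@cvgrPdist_le _ _ _ (nbhs x) (nbhs_filter x)) => e e0.
have C0 : 0 < `|L| * N%:R + 1 by rewrite ltr_wpDl// mulr_ge0.
suff : nbhs_ball_ (ball_ (fun x : 'rV[R]_N => `|x|)) x (fun y => `|g x - g y| <= e).
  by move/nbhs_normP.
exists ((`|L| * N%:R + 1)^-1 * e) => [|y /= /ltW xy].
  by rewrite /= mulr_gt0 ?invr_gt0.
apply: le_trans (gL _ _) _.
apply: le_trans (ler_wpM2r (dist1_ge0 _ _) (ler_norm L)) _.
apply: le_trans (ler_wpM2l (normr_ge0 L) (dist1_le_norm _ _)) _.
rewrite mulrA; apply: le_trans (_ : (`|L| * N%:R + 1) * `|x - y| <= _).
  by rewrite ler_wpM2r// lerDl.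
by rewrite -ler_pdivlMl.
Qed.

Definition bsmooth g := rsmooth g /\ forall s, exists B, forall x, `|foldr rpart g s x| <= B.

Lemma bsmooth_lipschitz g s : bsmooth g ->
  exists L, forall x y, `|foldr rpart g s x - foldr rpart g s y| <= L * dist1 x y.
Proof.
move=> [gs gb]; have /choice[B gB] := fun j => gb (j :: s).
exists (\sum_j `|B j|); apply: bounded_rpart_lipschitz => [j x|j x].
  by have [_] := gs s; exact.
apply: le_trans (gB j x) _; rewrite (bigD1 j)//=.
by apply: le_trans (ler_norm _) _; rewrite lerDl sumr_ge0.
Qed.

Lemma bsmooth_blip g s : bsmooth g -> blip (foldr rpart g s).
Proof. by move=> gs; split; [exact: gs.2|exact: bsmooth_lipschitz]. Qed.

Lemma bsmooth_qder g s j : bsmooth g -> qder j (foldr rpart g s) (foldr rpart g (j :: s)).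
Proof.
move=> bg; have [gs gb] := bg; have [B gB] := gb (j :: j :: s).
exists B => x t; have [_ d1] := gs s; have [_ d2] := gs (j :: s).
have := derive_lipschitz_quadratic
  (fun u : R => is_derive_line (d1 j (x + u *: delta_mx 0 j)))
  (derive_bound_lipschitz (fun u : R => is_derive_line (d2 j (x + u *: delta_mx 0 j)))
    (fun u => gB _)) 0 t.
by rewrite scale0r add0r addr0.
Qed.

(** A recognition criterion for smoothness: it suffices to exhibit a candidate G s
    for every iterated derivative, with the quadratic remainder linking
    consecutive ones.  It applies to sums of series, where the
    candidates are the series of derivatives. *)
Lemma rsmooth_family (G : seq 'I_N -> 'rV[R]_N -> R) :
  (forall s, exists L, forall x y, `|G s x - G s y| <= L * dist1 x y) ->
  (forall s j, qder j (G s) (G (j :: s))) ->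
  rsmooth (G [::]) /\ forall s, foldr rpart (G [::]) s = G s.
Proof.
move=> GL GQ.
have D s j x : is_derive x (delta_mx 0 j) (G s) (G (j :: s) x).
  by have [C GC] := GQ s j; exact: quadratic_is_derive (GC x).
have E s : foldr rpart (G [::]) s = G s.
  by elim: s => //= j s ->; apply/funext => x; rewrite /rpart derive_val.
split=> // s; rewrite E; split; last by move=> j x; exact: ex_derive.
by have [L] := GL s; exact: dist1_continuous.
Qed.

End BoundedSmooth.

Section Words.
Context {R : realType} {N : nat}.
Implicit Types (f : 'rV[R]_N -> R[i]).

Lemma size_mindex_seq (a : multinom N) : size (mindex_seq a) = mdeg a.
Proof.
rewrite /mindex_seq size_flatten /shape -map_comp sumnE big_map big_enum /= mdegE.
by apply: eq_bigr => j _; rewrite size_nseq.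
Qed.

Lemma normc_i_exp n : normc ((- 'i) ^+ n : R[i]) = 1.
Proof.
elim: n => [|n IH]; first by rewrite expr0 normc1.
by rewrite exprS normcM IH mulr1 /= oppr0 expr0n sqrrN expr1n add0r sqrtr1.
Qed.

Lemma normc_Dmulti a f x : normc (Dmulti a f x) = normc (foldr cpart f (mindex_seq a) x).
Proof. by rewrite /Dmulti normcM normc_i_exp mul1r. Qed.

(** Mixed partial derivatives commute, so the bounds on D^a also control
    derivatives taken in any order. *)
Lemma foldr_cpart_mindex f s : smooth f ->
  exists2 a : multinom N, mdeg a = size s & foldr cpart f s = foldr cpart f (mindex_seq a).
Proof.
move=> [f1 f2]; pose a : multinom N := Multinom [tuple count_mem i s | i < N].
have p : perm_eq s (mindex_seq a).
  by apply/allP => j _ /=; rewrite count_mindex_seq mnmE.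
exists a; first by rewrite -size_mindex_seq -(perm_size p).
by apply/funext => x; rewrite !foldr_cpartE (foldr_rpart_perm f1 p) (foldr_rpart_perm f2 p).
Qed.

Lemma periodic_rpart (g : 'rV[R]_N -> R) (v : 'rV[R]_N) k :
  (forall x, g (x + v) = g x) -> forall x, rpart k g (x + v) = rpart k g x.
Proof.
move=> gv x; rewrite /rpart /derive.
suff -> : (fun r : R => r^-1 *: ((g \o shift (x + v)) (r *: delta_mx 0 k) - g (x + v))) =
          (fun r : R => r^-1 *: ((g \o shift x) (r *: delta_mx 0 k) - g x)) by [].
by apply/funext => r /=; rewrite addrA !gv.
Qed.

Lemma periodic_foldr_cpart f s : torus_periodic f -> torus_periodic (foldr cpart f s).
Proof.
move=> pf; elim: s => //= k s IH j x.
by rewrite /cpart !periodic_rpart// => z /=; rewrite IH.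
Qed.

Lemma Re_foldr_cpart f s :
  (fun x => complex.Re (foldr cpart f s x)) = foldr rpart (@complex.Re R \o f) s.
Proof. by apply/funext => x; rewrite foldr_cpartE. Qed.

Lemma Im_foldr_cpart f s :
  (fun x => complex.Im (foldr cpart f s x)) = foldr rpart (@complex.Im R \o f) s.
Proof. by apply/funext => x; rewrite foldr_cpartE. Qed.

End Words.

Section UltraRegular.
Context {R : realType} {M : weight_seq R} {N : nat}.
Implicit Types (f : ultradiff M N) (s : seq 'I_N) (xi : 'rV[int]_N).

Lemma ultra_bound_word (C h : R) (g : 'rV[R]_N -> R[i]) s x : smooth g ->
  ultra_bound M C h g ->
  normc (foldr cpart g s x) <= C * (h ^+ size s * M (size s) * (size s)`!%:R).
Proof.
move=> gs gb; have [a <- ->] := foldr_cpart_mindex s gs.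
by rewrite -normc_Dmulti; exact: gb.
Qed.

Lemma ultradiff_bsmooth f :
  bsmooth (@complex.Re R \o f) /\ bsmooth (@complex.Im R \o f).
Proof.
have [fs _ [C [h [_ _ fb]]]] := ultradiffP f.
split; split=> [|s]; [exact: fs.1| |exact: fs.2|].
  exists (C * (h ^+ size s * M (size s) * (size s)`!%:R)) => x.
  rewrite -Re_foldr_cpart; apply: le_trans (normc_ge_Re _) _; exact: ultra_bound_word.
exists (C * (h ^+ size s * M (size s) * (size s)`!%:R)) => x.
rewrite -Im_foldr_cpart; apply: le_trans (normc_ge_Im _) _; exact: ultra_bound_word.
Qed.

Lemma cblip_foldr_cpart f s : cblip (foldr cpart f s).
Proof.
have [b1 b2] := ultradiff_bsmooth f.
by split; rewrite ?Re_foldr_cpart ?Im_foldr_cpart; exact: bsmooth_blip.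
Qed.

Lemma cblip_ultradiff f : cblip f.
Proof. exact: (cblip_foldr_cpart f [::]). Qed.

Lemma cqder_foldr_cpart f s j : cqder j (foldr cpart f s) (foldr cpart f (j :: s)).
Proof.
have [b1 b2] := ultradiff_bsmooth f.
by split; rewrite ?Re_foldr_cpart ?Im_foldr_cpart; exact: bsmooth_qder.
Qed.

Lemma ultradiff_periodic f : torus_periodic f.
Proof. by have [] := ultradiffP f. Qed.

(** The coefficient at -xi in the usual convention, without normalisation; the sign
    matches the pairing of a distribution with e^{i x xi}. *)
Definition fourier f xi : R[i] := cintegral (fun x => f x * torus_exp xi x).

Lemma fourier_foldr_cpart f s xi :
  cintegral (fun x => foldr cpart f s x * torus_exp xi x) =
  (\prod_(j <- s) - ('i * (xi 0 j)%:~R)) * fourier f xi.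
Proof.
elim: s => [|j s IH]; first by rewrite big_nil mul1r.
rewrite big_cons -mulrA -IH; have be := @cblip_torus_exp R N xi.
have bf := cblip_foldr_cpart f s.
transitivity (- cintegral (fun x => foldr cpart f s x * ('i * (xi 0 j)%:~R * torus_exp xi x))).
  rewrite (@integral_by_parts _ _ j (foldr cpart f s) (torus_exp xi) (foldr cpart f (j :: s))
    (fun x => 'i * (xi 0 j)%:~R * torus_exp xi x)) ?opprK//.
  - exact/periodic_foldr_cpart/ultradiff_periodic.
  - exact: torus_exp_periodic.
  - exact: (cblip_foldr_cpart f (j :: s)).
  - exact: cblipZ.
  - exact: cqder_foldr_cpart.
  - exact: cqder_torus_exp.
under [X in cintegral X]eq_fun do rewrite mulrCA.
by rewrite cintegralZ ?mulNr//; exact: cblipM.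
Qed.

Lemma fourier_Dmulti f a xi :
  cintegral (fun x => Dmulti a f x * torus_exp xi x) =
  (\prod_j (- (xi 0 j)%:~R) ^+ a j) * fourier f xi.
Proof.
under [X in cintegral X]eq_fun do rewrite /Dmulti -mulrA.
rewrite cintegralZ; last by apply: cblipM; [exact: cblip_foldr_cpart|exact: cblip_torus_exp].
rewrite fourier_foldr_cpart mulrA; congr (_ * _).
rewrite /mindex_seq big_flatten /= big_map big_enum /= mdegE -prodrXr -big_split /=.
apply: eq_bigr => j _; rewrite big_nseq iter_mulr mulr1 -exprMn; congr (_ ^+ _).
by rewrite -mulNr mulrA mulrNN -expr2 sqr_i mulN1r.
Qed.

Lemma cblip_Dmulti f a : cblip (Dmulti a f).
Proof. by apply: cblipZ; exact: cblip_foldr_cpart. Qed.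

Lemma fourier_diffop_tr P f xi :
  cintegral (fun x => diffop_tr P f x * torus_exp xi x) = symbol P xi * fourier f xi.
Proof.
under [X in cintegral X]eq_fun do rewrite /diffop_tr mulr_suml.
rewrite cintegral_sum; last first.
  move=> a; apply: cblipM; last exact: cblip_torus_exp.
  by apply: cblipZ; exact: cblip_Dmulti.
rewrite /symbol mevalE mulr_suml; apply: eq_bigr => a _.
under [X in cintegral X]eq_fun do rewrite -[_ * torus_exp _ _]mulrA.
rewrite cintegralZ; last by apply: cblipM; [exact: cblip_Dmulti|exact: cblip_torus_exp].
rewrite fourier_Dmulti mulrA; congr (_ * _).
under eq_bigr do rewrite exprNn.
by rewrite big_split /= prodrXr -mdegE mulrACA -exprMn mulrNN mulr1 expr1n mul1r.
Qed.

End UltraRegular.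

(** * Trigonometric series *)

Section ComplexSeries.
Context {R : realType}.
Implicit Types (z : nat -> R[i]) (w : R[i]) (b : nat -> R).

(** Sums of series as a relation: limits of partial sums are then compared through
    [csums_uniq], and bounds pass to them by [csums_le]. *)
Definition csums z w := forall e : R, 0 < e -> exists m0, forall m, (m0 <= m)%N ->
  normc (\sum_(i < m) z i - w) <= e.

Lemma csums_le z w K : csums z w -> (forall m, normc (\sum_(i < m) z i) <= K) ->
  normc w <= K.
Proof.
move=> zw zK; apply/ler_addgt0Pr => e /zw[m0 /(_ _ (leqnn _)) le_e].
have -> : w = \sum_(i < m0) z i + - (\sum_(i < m0) z i - w) by ring.
by apply: le_trans (le_normcD _ _) _; rewrite normcN lerD.
Qed.

Lemma csums_lin (c : R[i]) z w z' w' : csums z w -> csums z' w' ->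
  csums (fun i => c * z i + z' i) (c * w + w').
Proof.
move=> zw zw' e e0; have c0 : 0 < normc c + 1 by rewrite ltr_wpDl ?normc_nneg.
have [m1 h1] := zw (e / 2 / (normc c + 1)) ltac:(by rewrite !divr_gt0).
have [m2 h2] := zw' (e / 2) ltac:(by rewrite divr_gt0).
exists (maxn m1 m2) => m; rewrite geq_max => /andP[/h1{}h1 /h2{}h2].
rewrite big_split /= -mulr_sumr.
have -> : c * \sum_(i < m) z i + \sum_(i < m) z' i - (c * w + w') =
  c * (\sum_(i < m) z i - w) + (\sum_(i < m) z' i - w') by ring.
apply: le_trans (le_normcD _ _) _; rewrite normcM [leRHS]splitr lerD//.
apply: le_trans (_ : (normc c + 1) * (e / 2 / (normc c + 1)) <= _).
  by apply: ler_pM; rewrite ?normc_nneg// lerDl.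
by rewrite mulrC divfK// gt_eqF.
Qed.

Lemma csums_uniq z w w' : csums z w -> csums z w' -> w = w'.
Proof.
move=> zw zw'; apply/eqP; rewrite -subr_eq0; apply/eqP/eq0_normc.
apply/eqP; rewrite eq_le normc_nneg andbT.
have -> : w - w' = - ((-1) * w + w') by ring.
rewrite normcN; apply: csums_le (csums_lin (-1) zw zw') _ => m.
by rewrite big1 ?normc0// => i _; ring.
Qed.

Lemma csums_finite z n : (forall i, (n <= i)%N -> z i = 0) -> csums z (\sum_(i < n) z i).
Proof.
move=> z0 e e0; exists n => m nm; rewrite -!(big_mkord xpredT) (big_cat_nat (leq0n _) nm)//=.
have -> : \sum_(n <= i < m) z i = 0.
  by rewrite big_nat_cond big1// => i /andP[/andP[/z0]].
by rewrite addr0 subrr normc0 ltW.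
Qed.

Lemma csums_single z i0 : (forall i, i != i0 -> z i = 0) -> csums z (z i0).
Proof.
move=> z0; have -> : z i0 = \sum_(i < i0.+1) z i.
  rewrite big_ord_recr /= big1 ?add0r// => i _.
  by rewrite z0// ltn_eqF.
by apply: csums_finite => i i0i; rewrite z0// gtn_eqF.
Qed.

Lemma normc_sum (I : Type) (s : seq I) (P : pred I) (F : I -> R[i]) :
  normc (\sum_(i <- s | P i) F i) <= \sum_(i <- s | P i) normc (F i).
Proof.
apply: (big_ind2 (fun a (r : R) => normc a <= r)) => [|x1 x2 y1 y2 h1 h2|//].
  by rewrite normc0.
exact: le_trans (le_normcD _ _) (lerD h1 h2).
Qed.

Definition summable b := (forall i, 0 <= b i) /\ exists S, forall m, \sum_(i < m) b i <= S.

Lemma summable_tail b : summable b -> forall e : R, 0 < e -> exists m0,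
  forall m m', (m0 <= m)%N -> (m <= m')%N -> \sum_(m <= i < m') b i <= e.
Proof.
move=> [b0 [S bS]] e e0.
pose E := [set \sum_(i < m) b i | m in [set: nat]].
have hE : has_sup E by split; [exists (\sum_(i < 0) b i), 0%N|exists S => _ [m _ <-]].
have [_ [m0 _ <-] lt_m0] := sup_adherent e0 hE.
exists m0 => m m' m0m mm'.
have le_sup : \sum_(i < m') b i <= sup E by apply: (sup_ubound hE.2); exists m'.
have : \sum_(i < m0) b i <= \sum_(i < m) b i.
  rewrite -!(big_mkord xpredT) (big_cat_nat (leq0n _) m0m)//= lerDl.
  by apply: sumr_ge0.
move: le_sup; rewrite -!(big_mkord xpredT b) (big_cat_nat (leq0n _) mm')//=.
move: lt_m0; rewrite -(big_mkord xpredT b); lra.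
Qed.

Lemma cauchy_csums z : (forall e : R, 0 < e -> exists m0, forall m m',
    (m0 <= m)%N -> (m <= m')%N -> normc (\sum_(m <= i < m') z i) <= e) ->
  exists w, csums z w.
Proof.
have real_case (u : nat -> R) : (forall e : R, 0 < e -> exists m0, forall m m',
    (m0 <= m)%N -> (m <= m')%N -> `|\sum_(m <= i < m') u i| <= e) ->
    exists l, forall e : R, 0 < e -> exists m0, forall m, (m0 <= m)%N ->
      `|\sum_(i < m) u i - l| <= e.
  move=> uC.
  have cu : cvgn (series u).
    apply/cauchy_cvgP/cauchy_seriesP => e e0.
    have [m0 h] := uC (e / 2) ltac:(by rewrite divr_gt0).
    exists ([set m | (m0 <= m)%N], [set m | (m0 <= m)%N]) => /=.
      by split; exists m0.
    move=> [m m'] /= [mm0 mm0'].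
    have [mm'|m'm] := leqP m m'; last by rewrite big_geq ?normr0// ltnW.
    by apply: le_lt_trans (h _ _ mm0 mm') _; lra.
  exists (limn (series u)) => e e0.
  have /cvgrPdist_le/(_ _ e0)[m0 _ h] := cu.
  exists m0 => m /h; rewrite /series /= distrC big_mkord; exact.
move=> zC.
have [|a ha] := real_case (fun i => complex.Re (z i)).
  move=> e /zC[m0 h]; exists m0 => m m' m0m mm'; apply: le_trans (h m m' m0m mm').
  apply: le_trans (normc_ge_Re _); apply: le_of_eq; congr `| _ |.
  by apply/esym; apply: (big_morph (@complex.Re R)) => [x y|//]; exact: ReD.
have [|b hb] := real_case (fun i => complex.Im (z i)).
  move=> e /zC[m0 h]; exists m0 => m m' m0m mm'; apply: le_trans (h m m' m0m mm').
  apply: le_trans (normc_ge_Im _); apply: le_of_eq; congr `| _ |.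
  by apply/esym; apply: (big_morph (@complex.Im R)) => [x y|//]; exact: ImD.
exists (a +i* b) => e e0; have e20 : 0 < e / 2 by rewrite divr_gt0.
have [m1 h1] := ha _ e20; have [m2 h2] := hb _ e20.
exists (maxn m1 m2) => m; rewrite geq_max => /andP[/h1{}h1 /h2{}h2].
apply: le_trans (normc_le_ReIm _) _; rewrite [leRHS]splitr lerD//.
  apply: le_trans h1; apply: le_of_eq; congr `| _ |; rewrite ReD ReN /=.
  by congr (_ - _); apply: (big_morph (@complex.Re R)) => [x y|//]; exact: ReD.
apply: le_trans h2; apply: le_of_eq; congr `| _ |; rewrite ImD ImN /=.
by congr (_ - _); apply: (big_morph (@complex.Im R)) => [x y|//]; exact: ImD.
Qed.

Lemma summable_csums b z : summable b -> (forall i, normc (z i) <= b i) -> exists w, csums z w.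
Proof.
move=> sb zb; apply: cauchy_csums => e /(summable_tail sb)[m0 h].
exists m0 => m m' m0m mm'; apply: le_trans (h m m' m0m mm').
by apply: le_trans (normc_sum _ _ _) _; apply: ler_sum.
Qed.

Lemma summableZ (K : R) b : 0 <= K -> summable b -> summable (fun i => K * b i).
Proof.
move=> K0 [b0 [S bS]]; split=> [i|]; first exact: mulr_ge0.
by exists (K * S) => m; rewrite -mulr_sumr ler_wpM2l.
Qed.

(** The rank m0 depends only on the majorant, which gives uniform convergence of
    families of series. *)
Lemma csums_uniform_tail b : summable b -> forall e : R, 0 < e -> exists m0, forall z w,
  (forall i, normc (z i) <= b i) -> csums z w ->
  forall m, (m0 <= m)%N -> normc (\sum_(i < m) z i - w) <= e.
Proof.
move=> sb e /(summable_tail sb)[m0 h]; exists m0 => z w zb zw m m0m.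
apply/ler_addgt0Pr => d /zw[m1 hw].
pose m' := maxn m m1; have mm' : (m <= m')%N by exact: leq_maxl.
have := hw m' (leq_maxr _ _); rewrite -(big_mkord xpredT z) (big_cat_nat (leq0n _) mm')//= => hw'.
rewrite -(big_mkord xpredT z).
have -> : \sum_(0 <= i < m) z i - w =
  - (\sum_(m <= i < m') z i) + (\sum_(0 <= i < m) z i + \sum_(m <= i < m') z i - w) by ring.
apply: le_trans (le_normcD _ _) _; rewrite normcN lerD//.
by apply: le_trans (h m m' m0m mm'); apply: le_trans (normc_sum _ _ _) _; apply: ler_sum.
Qed.

End ComplexSeries.

Section TrigSeries.
Context {R : realType} {N : nat}.
Variables (M : weight_seq R) (xi : nat -> 'rV[int]_N) (c : nat -> R[i]).
Variables (b : nat -> R) (A B : R).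

(** A majorant of the form weight times summable sequence; b carries the
    convergence, so that the same statement serves sparse sequences of frequencies
    and the enumeration of the whole lattice. *)
Definition rapidly_decreasing := forall i n,
  normc (c i) * (1 + abs1 (xi i)) ^+ n <= A * (B ^+ n * M n * n`!%:R) * b i.

Hypotheses (A_ge0 : 0 <= A) (B_gt0 : 0 < B) (b_summable : summable b).
Hypothesis c_rapid : rapidly_decreasing.

Let wd (xi : 'rV[int]_N) (s : seq 'I_N) : R[i] := \prod_(j <- s) ('i * (xi 0 j)%:~R).

Let normc_wd (k : 'rV[int]_N) s : normc (wd k s) <= (abs1 k : R) ^+ size s.
Proof.
rewrite /wd; elim: s => [|j s IH]; first by rewrite big_nil normc1.
rewrite big_cons normcM exprS; apply: ler_pM => //; rewrite ?normc_nneg//.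
rewrite normcM -(rmorph_int (real_complex R)) /=.
rewrite expr0n expr1n add0r sqrtr1 mul1r addr0 sqrtr_sqr.
exact: abs1_ge.
Qed.

Let term s x i : R[i] := c i * (wd (xi i) s * torus_exp (xi i) x).

Let W n : R := A * (B ^+ n * M n * n`!%:R).

Let W_ge0 n : 0 <= W n.
Proof. by rewrite mulr_ge0// ultra_weight_ge0// ltW. Qed.

Let coef_bound i s m : normc (c i) * (normc (wd (xi i) s) * abs1 (xi i) ^+ m) <=
  W (size s + m) * b i.
Proof.
apply: le_trans (c_rapid i (size s + m)); rewrite ler_wpM2l ?normc_nneg// exprD.
have a0 := @abs1_ge0 R N (xi i).
have a1 : abs1 (xi i) <= 1 + abs1 (xi i) :> R by rewrite lerDr.
apply: ler_pM; rewrite ?normc_nneg ?exprn_ge0//.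
  apply: le_trans (normc_wd _ _) _; apply: lerXn2r; rewrite ?nnegrE ?addr_ge0//.
by apply: lerXn2r; rewrite ?nnegrE ?addr_ge0.
Qed.

Let term_bound s x i : normc (term s x i) <= W (size s) * b i.
Proof.
have := coef_bound i s 0; rewrite expr0 mulr1 addn0; apply: le_trans.
by rewrite /term !normcM normc_torus_exp mulr1.
Qed.

Let term_csums s x : exists w, csums (term s x) w.
Proof. exact: summable_csums (summableZ (W_ge0 (size s)) b_summable) (term_bound s x). Qed.

(** Termwise differentiation.  The candidate for the derivative along a word s is
    the series of derivatives of the exponentials; its Lipschitz constant and
    quadratic remainder are sums of those of the terms, which cost one and two more
    powers of the frequency.  The derivative bound is proportional to the sum S of
    the majorant, so applied to a tail it yields convergence in the norm. *)
Lemma trig_series_exists : exists f : 'rV[R]_N -> R[i],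
  [/\ smooth f, torus_periodic f,
      (forall S, (forall m, \sum_(i < m) b i <= S) -> ultra_bound M (A * S) B f) &
      forall x, csums (fun i => c i * torus_exp (xi i) x) (f x)].
Proof.
have /choice[G' hG] := fun p : seq 'I_N * 'rV[R]_N => term_csums p.1 p.2.
pose G s x := G' (s, x); have {}hG s x : csums (term s x) (G s x) := hG (s, x).
have [b0 [S bS]] := b_summable.
have sumW n (u : nat -> R[i]) K : 0 <= K -> (forall i, normc (u i) <= W n * b i * K) ->
    forall m, normc (\sum_(i < m) u i) <= W n * S * K.
  move=> K0 uW m; apply: le_trans (normc_sum _ _ _) _.
  apply: le_trans (_ : \sum_(i < m) W n * b i * K <= _); first by apply: ler_sum.
  by rewrite -mulr_suml -mulr_sumr ler_wpM2r// ler_wpM2l.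
have lipG s x y : normc (G s x - G s y) <= W (size s + 1) * S * 2 * dist1 x y.
  have -> : G s x - G s y = (-1) * G s y + G s x by ring.
  rewrite -[leRHS]mulrA; apply: csums_le (csums_lin (-1) (hG s y) (hG s x)) _.
  apply: (sumW _ (fun i => -1 * term s y i + term s x i) (2 * dist1 x y)) => [|i].
    by rewrite mulr_ge0// dist1_ge0.
  have -> : -1 * term s y i + term s x i =
    c i * (wd (xi i) s * (torus_exp (xi i) x - torus_exp (xi i) y)) by rewrite /term; ring.
  rewrite !normcM.
  apply: le_trans (_ : normc (c i) * (normc (wd (xi i) s) * abs1 (xi i) ^+ 1) *
      (2 * dist1 x y) <= _); last first.
        by rewrite ler_wpM2r ?mulr_ge0 ?dist1_ge0.
  rewrite -[leRHS]mulrA ler_wpM2l ?normc_nneg// -[leRHS]mulrA ler_wpM2l ?normc_nneg//.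
  by apply: le_trans (torus_exp_lipschitz _ _ _) _; rewrite expr1 mulrCA.
have quadG s j x (t : R) : normc (G s (x + t *: delta_mx 0 j) - G s x -
     t%:C * G (j :: s) x) <= W (size s + 2) * S * 2 * t ^+ 2.
  have -> : G s (x + t *: delta_mx 0 j) - G s x - t%:C * G (j :: s) x =
    (- t%:C) * G (j :: s) x + ((-1) * G s x + G s (x + t *: delta_mx 0 j)) by ring.
  rewrite -[leRHS]mulrA.
  apply: csums_le (csums_lin (- t%:C) (hG (j :: s) x)
    (csums_lin (-1) (hG s x) (hG s (x + t *: delta_mx 0 j)))) _.
  apply: (sumW _ (fun i => - t%:C * term (j :: s) x i +
    (-1 * term s x i + term s (x + t *: delta_mx 0 j) i)) (2 * t ^+ 2)) => [|i].
    by rewrite mulr_ge0// sqr_ge0.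
  rewrite /term [wd (xi i) (j :: s)]/wd big_cons -/(wd (xi i) s).
  set y := x + _; set e := torus_exp (xi i).
  have -> : - t%:C * (c i * ('i * (xi i 0 j)%:~R * wd (xi i) s * e x)) +
      (-1 * (c i * (wd (xi i) s * e x)) + c i * (wd (xi i) s * e y)) =
      c i * (wd (xi i) s * (e y - e x - t%:C * ('i * (xi i 0 j)%:~R * e x))) by ring.
  rewrite !normcM.
  apply: le_trans (_ : normc (c i) * (normc (wd (xi i) s) * abs1 (xi i) ^+ 2) *
      (2 * t ^+ 2) <= _); last first.
    by apply: ler_wpM2r => //; apply: mulr_ge0 => //; exact: sqr_ge0.
  rewrite -[leRHS]mulrA ler_wpM2l ?normc_nneg// -[leRHS]mulrA ler_wpM2l ?normc_nneg//.
  by apply: le_trans (torus_exp_quadratic _ _ _ _) _; rewrite mulrCA.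
have [sr Er] : rsmooth (fun x => complex.Re (G [::] x)) /\
    forall s, foldr rpart (fun x => complex.Re (G [::] x)) s = fun x => complex.Re (G s x).
  apply: (@rsmooth_family R N (fun s x => complex.Re (G s x))) => [s|s j].
    exists (W (size s + 1) * S * 2) => x y; rewrite -ReN -ReD.
    exact: le_trans (normc_ge_Re _) (lipG s x y).
  exists (W (size s + 2) * S * 2) => x t; apply: le_trans (quadG s j x t).
  apply: le_trans (normc_ge_Re _); apply: le_of_eq; congr `| _ |.
  by rewrite !ReD !ReN ReM /= mul0r subr0.
have [si Ei] : rsmooth (fun x => complex.Im (G [::] x)) /\
    forall s, foldr rpart (fun x => complex.Im (G [::] x)) s = fun x => complex.Im (G s x).
  apply: (@rsmooth_family R N (fun s x => complex.Im (G s x))) => [s|s j].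
    exists (W (size s + 1) * S * 2) => x y; rewrite -ImN -ImD.
    exact: le_trans (normc_ge_Im _) (lipG s x y).
  exists (W (size s + 2) * S * 2) => x t; apply: le_trans (quadG s j x t).
  apply: le_trans (normc_ge_Im _); apply: le_of_eq; congr `| _ |.
  by rewrite !ImD !ImN ImM /= mul0r addr0.
have E s x : foldr cpart (G [::]) s x = G s x.
  rewrite foldr_cpartE -[_ \o G [::]]/(fun x => complex.Re (G [::] x)).
  rewrite -[@complex.Im R \o G [::]]/(fun x => complex.Im (G [::] x)) Er Ei.
  by apply: complex_eq.
exists (G [::]); split=> //.
- move=> j x; apply: csums_uniq (hG _ _) _.
  have := hG [::] x; congr csums; apply/funext => i.
  by rewrite /term torus_exp_periodic.
- move=> S' bS' x a; rewrite normc_Dmulti E -size_mindex_seq.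
  apply: csums_le (hG _ _) _ => m; apply: le_trans (normc_sum _ _ _) _.
  apply: le_trans (_ : \sum_(i < m) W (size (mindex_seq a)) * b i <= _).
    by apply: ler_sum => i _; exact: term_bound.
  by rewrite -mulr_sumr [leRHS]mulrAC; apply: ler_wpM2l (bS' m); exact: W_ge0.
- move=> x; have := hG [::] x; congr csums; apply/funext => i.
  by rewrite /term /wd big_nil mul1r.
Qed.

End TrigSeries.

(** Integration against a bounded function commutes with the uniformly
    convergent sum. *)
Lemma csums_cintegral (R : realType) N (xi : nat -> 'rV[int]_N) (c : nat -> R[i])
    (b : nat -> R) (f g : 'rV[R]_N -> R[i]) :
  summable b -> (forall i, normc (c i) <= b i) ->
  (forall x, csums (fun i => c i * torus_exp (xi i) x) (f x)) -> cblip f -> cblip g ->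
  csums (fun i => c i * cintegral (fun x => torus_exp (xi i) x * g x))
    (cintegral (fun x => f x * g x)).
Proof.
move=> sb cb cf bf bg e e0.
have [K gK] : exists K, forall x, normc (g x) <= K.
  have [[[K1 h1] _] [[K2 h2] _]] := bg; exists (K1 + K2) => x.
  by apply: le_trans (normc_le_ReIm _) _; exact: lerD.
have K0 : 0 <= K := le_trans (normc_nneg _) (gK 0).
have p0 := @pi2_gt0 R; pose L := 2 * (2 * pi) ^+ N * (K + 1) : R.
have L0 : 0 < L by rewrite !mulr_gt0 ?exprn_gt0// ltr_wpDl.
have [m0 h] := csums_uniform_tail sb (divr_gt0 e0 L0).
exists m0 => m m0m.
have be i : cblip (torus_exp (xi i) : 'rV[R]_N -> R[i]) by exact: cblip_torus_exp.
have beg i : cblip (fun x => torus_exp (xi i) x * g x) by exact: cblipM.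
pose Sm x := \sum_(i < m) c i * torus_exp (xi i) x.
have bS : cblip Sm by apply: cblip_sum => i; exact: cblipZ.
have -> : \sum_(i < m) c i * cintegral (fun x => torus_exp (xi i) x * g x) -
    cintegral (fun x => f x * g x) = cintegral (fun x => (Sm x - f x) * g x).
  have -> : (fun x => (Sm x - f x) * g x) = (fun x => -1 * (f x * g x) + Sm x * g x).
    by apply/funext => x; ring.
  rewrite cintegral_lin; [|exact: cblipM|exact: cblipM].
  rewrite mulN1r [RHS]addrC; congr (_ - _).
  transitivity (\sum_(i < m) cintegral (fun x => c i * (torus_exp (xi i) x * g x))).
    by apply: eq_bigr => i _; rewrite cintegralZ.
  rewrite -cintegral_sum; last by move=> i; exact: cblipZ.
  congr cintegral; apply/funext => x; rewrite mulr_suml.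
  by apply: eq_bigr => i _; rewrite mulrA.
have -> : e = 2 * (2 * pi) ^+ N * (e / L * (K + 1)).
  by rewrite mulrCA -/L divfK// gt_eqF.
apply: cintegral_bound => [|x].
  apply: cblipM => //; apply: cblipD => //.
  have := cblipZ (-1) bf; rewrite (_ : (fun x => -1 * f x) = fun x => - f x)//.
  by apply/funext => x; rewrite mulN1r.
rewrite normcM; apply: ler_pM; rewrite ?normc_nneg//.
  apply: h (cf x) _ m0m => i.
  by rewrite normcM normc_torus_exp mulr1.
by apply: le_trans (gK x) _; rewrite lerDl.
Qed.

(** * Weight sequences and lattice sums *)

Section Weights.
Context {R : realType} (M : weight_seq R).

Lemma weight_ge1 n : 1 <= M n.
Proof.
suff H m : 1 <= M m /\ M m <= M m.+1 by have [] := H n.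
elim: m => [|m [M1 Mm]]; first by rewrite weight0 weight1.
split; first exact: le_trans Mm.
have M0 := weight_gt0 M m; have M0' := weight_gt0 M m.+1.
rewrite -(ler_pM2l M0'); apply: le_trans (_ : M m * M m.+2 <= _).
  by rewrite -expr2; exact: weight_logconvex.
by rewrite ler_pM2r// weight_gt0.
Qed.

Lemma weight_fact_ge1 n : 1 <= M n * n`!%:R.
Proof. by rewrite -[leLHS]mulr1 ler_pM// ?weight_ge1// ler1n fact_gt0. Qed.

Lemma weight_fact_submult : exists2 L : R, 1 < L & forall n k,
  M (n + k)%N * (n + k)`!%:R <= L ^+ (n + k) * ((M n * n`!%:R) * (M k * k`!%:R)).
Proof.
have [H H1 MH] := weight_submult M; exists (2 * H) => [|n k]; first lra.
have F : ((n + k)`!%:R : R) <= 2 ^+ (n + k) * (n`!%:R * k`!%:R).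
  by rewrite -!natrM -natrX -natrM ler_nat fact_add_le.
apply: le_trans (ler_pM _ _ (MH n k) F) _; rewrite ?ler0n ?(ltW (weight_gt0 _ _))//.
by rewrite exprMn; apply: le_of_eq; ring.
Qed.

Lemma exp_fact_bounded (t : R) : exists2 K, 0 < K & forall n, `|t| ^+ n <= K * n`!%:R.
Proof.
pose u := exp_coeff (`|t| + 1).
have t0 : 0 < `|t| + 1 by rewrite ltr_wpDl.
have u0 n : 0 <= u n by rewrite exp_coeff_ge0// ltW.
have cu : cvgn (series u) by exact: is_cvg_series_exp_coeff.
have nd : nondecreasing_seq (series u).
  by apply/nondecreasing_seqP => n; rewrite /series /= big_nat_recr//= lerDl.
exists (limn (series u) + 1) => [|n].
  apply: ltr_wpDl => //; apply: le_trans (nondecreasing_cvgn_le nd cu 0).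
  by rewrite /series /= big_geq.
have n0 : 0 < n`!%:R :> R by rewrite ltr0n fact_gt0.
rewrite -ler_pdivrMr//; apply: le_trans (_ : u n <= _).
  rewrite /u /exp_coeff /= ler_pM2r ?invr_gt0//.
  by apply: lerXn2r; rewrite ?nnegrE ?(ltW t0)// lerDl.
apply: le_trans (_ : series u n.+1 <= _).
  by rewrite /series /= big_nat_recr//= lerDr sumr_ge0.
by apply: le_trans (nondecreasing_cvgn_le nd cu _) _; rewrite lerDl.
Qed.

End Weights.

Section Norms.
Context {R : realType} {N : nat}.
Implicit Types xi : 'rV[int]_N.

Lemma euclid_norm_ge0 xi : 0 <= euclid_norm R xi.
Proof. exact: sqrtr_ge0. Qed.

Lemma euclid_norm_le_abs1 xi : euclid_norm R xi <= abs1 xi.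
Proof.
have -> : abs1 xi = Num.sqrt (abs1 xi ^+ 2) :> R by rewrite sqrtr_sqr ger0_norm// abs1_ge0.
apply: ler_wsqrtr; rewrite expr2 [X in X * _]/abs1 mulr_suml; apply: ler_sum => j _.
by rewrite -real_normK ?num_real// expr2 ler_wpM2l// abs1_ge.
Qed.

Lemma coordinate_le_euclid_norm xi j : `|(xi 0 j)%:~R| <= euclid_norm R xi.
Proof.
rewrite -sqrtr_sqr; apply: ler_wsqrtr.
by rewrite (bigD1 j)//= lerDl sumr_ge0// => i _; rewrite sqr_ge0.
Qed.

Lemma abs1_le_euclid_norm xi : abs1 xi <= N%:R * euclid_norm R xi.
Proof.
have -> : N%:R * euclid_norm R xi = \sum_(j < N) euclid_norm R xi.
  by rewrite sumr_const card_ord mulr_natl.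
by apply: ler_sum => j _; exact: coordinate_le_euclid_norm.
Qed.

Lemma abs1N xi : abs1 (- xi) = abs1 xi :> R.
Proof. by apply: eq_bigr => j _; rewrite mxE mulrNz normrN. Qed.

Lemma euclid_normN xi : euclid_norm R (- xi) = euclid_norm R xi.
Proof. by congr Num.sqrt; apply: eq_bigr => j _; rewrite mxE mulrNz sqrrN. Qed.

Lemma coordinate_dominates xi : (0 < N)%N -> exists j,
  1 + abs1 xi <= (1 + N%:R) * Num.max 1 `|(xi 0 j)%:~R| :> R.
Proof.
move=> N0; pose j0 := Ordinal N0.
have [j jP] : exists j, forall i, `|xi 0 i| <= `|xi 0 j|.
  case: (@Order.TotalTheory.arg_maxP _ int 'I_N j0 xpredT (fun i => `|xi 0 i|)) => // j _ jP.
  by exists j => i; exact: jP.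
exists j; rewrite mulrDl mul1r; apply: lerD; first by rewrite le_max lexx.
have -> : N%:R * Num.max 1 `|(xi 0 j)%:~R| = \sum_(i < N) Num.max 1 `|(xi 0 j)%:~R| :> R.
  by rewrite sumr_const card_ord mulr_natl.
apply: ler_sum => i _; rewrite le_max; apply/orP; right.
by rewrite -!intr_norm ler_int.
Qed.

Lemma summable_half : summable (fun i => (2 ^- i : R)).
Proof.
split=> [i|]; first by rewrite invr_ge0 exprn_ge0.
exists 2 => m; have E : \sum_(i < m) 2 ^- i = 2 - 2 * 2 ^- m :> R.
  elim: m => [|m IH]; first by rewrite big_ord0 expr0 invr1 mulr1 subrr.
  rewrite big_ord_recr /= IH exprS invfM; have : (2 : R) != 0 by [].
  by move=> ?; field; rewrite expf_neq0.
by rewrite E gerBl mulr_ge0// invr_ge0 exprn_ge0.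
Qed.

(** A summable function on the lattice that is a product over the coordinates, so
    that its sums over boxes factor. *)
Definition lattice_weight xi : R := \prod_j (1 + `|(xi 0 j)%:~R|) ^- 2.

(** The vectors with coordinates of modulus less than m, encoded by absolute
    values and signs.  Vectors with a zero coordinate are listed several times, which
    is harmless for covering and for upper bounds. *)
Definition box m : seq 'rV[int]_N :=
  [seq \row_j (if (f j).2 then ((f j).1 : nat)%:Z else - ((f j).1 : nat)%:Z)
    | f : {ffun 'I_N -> 'I_m * bool}].

Lemma mem_box m xi : (forall j, (`|xi 0%R j| < m)%N) -> xi \in box m.
Proof.
move=> xim; apply/mapP.
exists [ffun j => (Ordinal (xim j), 0 <= xi 0 j)]; first by rewrite mem_enum.
apply/rowP => j; rewrite mxE ffunE /=; case: (leP 0 (xi 0 j)) => h; first by rewrite gez0_abs.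
by rewrite ltz0_abs// opprK.
Qed.

Lemma lattice_weight_ge0 xi : 0 <= lattice_weight xi.
Proof. by apply: prodr_ge0 => j _; rewrite invr_ge0 exprn_ge0// addr_ge0. Qed.

Lemma sum_lattice_weight_box m : \sum_(xi <- box m) lattice_weight xi <= 4 ^+ N.
Proof.
pose p (x : 'I_m * bool) : R := (1 + (x.1 : nat)%:R) ^- 2.
have -> : \sum_(xi <- box m) lattice_weight xi =
    \sum_(f : {ffun 'I_N -> 'I_m * bool}) \prod_j p (f j).
  rewrite big_map big_enum /=; apply: eq_bigr => f _; apply: eq_bigr => j _.
  by rewrite mxE /p; case: ifP => _; rewrite ?mulrNz ?normrN -?pmulrn normr_nat.
rewrite -(bigA_distr_bigA (fun _ x => p x)) prodr_const card_ord.
have p0 x : 0 <= p x by rewrite invr_ge0 exprn_ge0// addr_ge0.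
apply: lerXn2r; rewrite ?nnegrE ?sumr_ge0//.
have -> : \sum_x p x = \sum_(i < m) \sum_(b : bool) p (i, b).
  by rewrite pair_bigA /=; apply: eq_bigr => -[].
have -> : \sum_(i < m) \sum_(b : bool) p (i, b) = 2 * \sum_(i < m) (1 + (i : nat)%:R) ^- 2.
  by rewrite mulr_sumr; apply: eq_bigr => i _; rewrite big_bool /p /=; ring.
suff : \sum_(i < m) (1 + (i : nat)%:R) ^- 2 <= 2 - 1 / m.+1%:R :> R.
  have : 0 < 1 / m.+1%:R :> R by rewrite divr_gt0.
  by move: (\sum_(i < m) _) (1 / _) => a b; lra.
(* telescoping: 1 / (1 + i)^2 is at most 2 / (1 + i) - 2 / (2 + i), hence 2 - 2 / (m + 1) *)
apply: le_trans (_ : 2 - 2 / m.+1%:R <= _); last first.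
  have : 0 < 1 / m.+1%:R :> R by rewrite divr_gt0.
  have -> : 2 / m.+1%:R = 2 * (1 / m.+1%:R) :> R by rewrite mulrA mulr1.
  by move: (1 / m.+1%:R) => a a0; lra.
elim: m {p p0} => [|m IH]; first by rewrite big_ord0 divr1 subrr.
rewrite big_ord_recr /=; move: IH; move: (\sum_(i < m) _) => a IH.
have h : (1 + m%:R) ^- 2 <= 2 / m.+1%:R - 2 / m.+2%:R :> R.
  have x0 : 0 < 1 + m%:R :> R by rewrite ltr_wpDr.
  have -> : m.+1%:R = 1 + m%:R :> R by rewrite -natr1 addrC.
  have -> : m.+2%:R = 2 + m%:R :> R by rewrite -!natr1; ring.
  have x1 : 0 < 2 + m%:R :> R by rewrite ltr_wpDr.
  have m0 : 0 <= m%:R :> R by [].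
  move: m0 x0 x1; move: (m%:R) => x m0 x0 x1.
  have -> : 2 / (1 + x) - 2 / (2 + x) = (1 + x) ^- 2 * (2 * (1 + x) / (2 + x)) :> R.
    by field; rewrite !gt_eqF.
  rewrite -[leLHS]mulr1; apply: ler_wpM2l; first by rewrite invr_ge0 exprn_ge0// ltW.
  by rewrite ler_pdivlMr// mul1r; lra.
by move: IH h; move: (_ ^- 2) (2 / m.+1%:R) (2 / m.+2%:R) => p q r; lra.
Qed.

Lemma ler_sum_sub_seq (I : eqType) (s t : seq I) (F : I -> R) : (forall i, 0 <= F i) ->
  uniq s -> {subset s <= t} -> \sum_(i <- s) F i <= \sum_(i <- t) F i.
Proof.
move=> F0; elim: s t => [|i s IH] t; first by rewrite big_nil sumr_ge0.
move=> /= /andP[i_s us] st; have it : i \in t by apply: st; rewrite mem_head.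
rewrite big_cons (big_rem i it)/= lerD2l; apply: IH => // j js.
have : j \in i :: rem i t by rewrite -(perm_mem (perm_to_rem it)) st// inE js orbT.
by rewrite inE => /predU1P[ji|//]; rewrite -ji js in i_s.
Qed.

(** [pickle_inv] enumerates the lattice without repetition by part of the natural
    numbers; the other indices get weight 0. *)
Definition enum_weight (i : nat) : R :=
  if (pickle_inv i : option 'rV[int]_N) is Some xi then lattice_weight xi else 0.

Lemma summable_enum_weight : summable enum_weight.
Proof.
split=> [i|]; first by rewrite /enum_weight; case: pickle_inv => // xi; exact: lattice_weight_ge0.
exists (4 ^+ N) => m; pose s := pmap (@pickle_inv 'rV[int]_N) (iota 0 m).
have -> : \sum_(i < m) enum_weight i = \sum_(xi <- s) lattice_weight xi.
  rewrite -(big_mkord xpredT enum_weight) /s /index_iota subn0; elim: (iota 0 m) => [|i t IH].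
    by rewrite !big_nil.
  rewrite big_cons IH /= /enum_weight; case: pickle_inv => /= [xi|]; first by rewrite big_cons.
  by rewrite add0r.
have us : uniq s by apply: (pmap_uniq (@pickle_invK _)); exact: iota_uniq.
pose K := (\sum_(xi <- s) \sum_j `|xi 0%R j|)%N.
apply: le_trans (sum_lattice_weight_box K.+1); apply: ler_sum_sub_seq => //.
  exact: lattice_weight_ge0.
move=> xi xis; apply: mem_box => j; rewrite ltnS /K (big_rem xi xis) /= (bigD1 j)//=.
by rewrite -addnA leq_addr.
Qed.

Lemma lattice_weight_bound xi : 1 <= lattice_weight xi * (1 + abs1 xi) ^+ (2 * N).
Proof.
have p0 j : 0 < (1 + `|(xi 0 j)%:~R|) ^+ 2 :> R by rewrite exprn_gt0// ltr_wpDr.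
have -> : (1 + abs1 xi) ^+ (2 * N) = \prod_(j < N) (1 + abs1 xi) ^+ 2 :> R.
  by rewrite prodr_const card_ord exprM.
rewrite /lattice_weight -big_split /=.
rewrite -[leLHS](_ : \prod_(j < N) 1 = 1 :> R); last by rewrite big1.
apply: ler_prod => j _; rewrite ler01 /= mulrC ler_pdivlMr// mul1r.
apply: lerXn2r; rewrite ?nnegrE ?addr_ge0 ?abs1_ge0//.
by rewrite lerD2l abs1_ge.
Qed.

End Norms.

(** * Fourier series of ultradifferentiable functions *)

Section FourierCoefficients.
Context {R : realType} (M : weight_seq R) (N : nat).
Implicit Types (xi eta : 'rV[int]_N) (v : 'rV[int]_N -> R[i]) (f g : ultradiff M N).

(** An exponential is the trigonometric series with a single term; its derivatives
    grow like powers of the frequency, and m_n n! >= 1. *)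
Lemma ultra_torus_exp xi : (torus_exp xi : 'rV[R]_N -> R[i]) \in @ultra_pred R M N.
Proof.
pose d (i : nat) : R := (i == 0)%:R.
have sd : summable d.
  split=> [i|]; first exact: ler0n.
  exists 1 => -[|m]; first by rewrite big_ord0.
  by rewrite big_ord_recl big1 ?addr0.
have B0 : 0 < 1 + abs1 xi :> R by rewrite ltr_wpDr// abs1_ge0.
have rd : @rapidly_decreasing R N M (fun=> xi) (fun i => (i == 0)%:R) d 1 (1 + abs1 xi).
  move=> i n; rewrite /d mul1r; case: (i == 0); last by rewrite mulr0n normc0 mul0r mulr0.
  rewrite mulr1n normc1 mul1r mulr1 -mulrA ler_peMr ?weight_fact_ge1//.
  by rewrite exprn_ge0// ltW.
have [f [fs fp fb fx]] := trig_series_exists ler01 B0 sd rd.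
have Ef : f = torus_exp xi.
  apply/funext => x; apply: csums_uniq (fx x) _.
  have := @csums_single R (fun i => (i == 0)%:R * torus_exp xi x) 0%N.
  by rewrite mul1r; apply=> -[//|i] _; rewrite mul0r.
rewrite -Ef; have [d0 [S dS]] := sd.
apply/ultra_predP; split=> //; exists (1 + `|S|), (1 + abs1 xi); split=> //.
rewrite -[1 + `|S|]mul1r; apply: fb => m; apply: le_trans (dS m) _.
by apply: le_trans (ler_norm _) _; rewrite lerDr.
Qed.

Definition ultra_exp xi : ultradiff M N := Ultradiff (ultra_torus_exp xi).

Lemma Dmulti_torus_exp (a : multinom N) xi (x : 'rV[R]_N) :
  Dmulti a (torus_exp xi) x = (\prod_j (xi 0 j)%:~R ^+ a j) * torus_exp xi x.
Proof.
have := congr1 (fun F => F x) (diffop_torus_exp (mpolyX R[i] a) xi).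
by rewrite /diffop /symbol mevalX msuppX big_seq1 mcoeffX eqxx mul1r.
Qed.

Lemma diffop_tr_ultra_exp P xi :
  ultra_diffop_tr P (ultra_exp xi) = symbol P (- xi) *: ultra_exp xi.
Proof.
apply/val_inj/funext => x; rewrite /= /diffop_tr.
rewrite -[RHS]/(symbol P (- xi) * torus_exp xi x) /symbol mevalE mulr_suml.
apply: eq_bigr => a _; rewrite Dmulti_torus_exp mulrA; congr (_ * _).
under [in RHS]eq_bigr do rewrite mxE mulrNz exprNn.
by rewrite big_split /= prodrXr -mdegE -mulrA mulrCA.
Qed.

Lemma fourier_ultra_exp xi eta :
  fourier (ultra_exp xi) eta = if xi + eta == 0 then ((2 * pi) ^+ N)%:C else 0.
Proof.
rewrite -cintegral_torus_exp /fourier; congr cintegral; apply/funext => x.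
by rewrite torus_expD.
Qed.

Lemma fourier_lin c f g xi : fourier (c *: f + g) xi = c * fourier f xi + fourier g xi.
Proof.
have be := @cblip_torus_exp R N xi.
have bf := cblipM (cblip_ultradiff f) be; have bg := cblipM (cblip_ultradiff g) be.
rewrite /fourier -cintegral_lin//; congr cintegral; apply/funext => x.
by rewrite mulrA -mulrDl.
Qed.

Definition rapid v A B := forall xi n,
  normc (v xi) * (1 + abs1 xi) ^+ n <= A * (B ^+ n * M n * n`!%:R).

(** Differentiate n times along the coordinate j with the largest |xi_j|, which
    controls 1 + |xi| up to the factor 1 + N when |xi_j| >= 1; otherwise the sup bound
    suffices.  The constants depend on the step h only, as needed for the continuity
    of functionals. *)
Lemma fourier_bound (h : R) : (0 < N)%N -> 0 < h -> exists A B, [/\ 0 < A, 0 < B &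
  forall C f, 0 <= C -> ultra_bound M C h f -> rapid (fourier f) (C * A) B].
Proof.
move=> N0 h0; pose m := Num.max 1 h.
have p0 := @pi2_gt0 R; have m1 : 1 <= m by rewrite le_max lexx.
have m0 : 0 < m by exact: lt_le_trans m1.
have N1 : 0 < 1 + N%:R :> R by rewrite ltr_wpDr.
exists (2 * (2 * pi) ^+ N), ((1 + N%:R) * m); split.
- by rewrite mulr_gt0// exprn_gt0.
- by rewrite mulr_gt0.
move=> C f C0 bf xi n; have [fs _ _] := ultradiffP f.
set K := 2 * (2 * pi) ^+ N; have K0 : 0 <= K by rewrite mulr_ge0// exprn_ge0// ltW.
have w0 l : 0 <= M l * l`!%:R by rewrite mulr_ge0// ltW// weight_gt0.
have pow j l : normc (fourier f xi) * `|(xi 0 j)%:~R| ^+ l <= C * K * (h ^+ l * (M l * l`!%:R)).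
  have := fourier_foldr_cpart f (nseq l j) xi.
  rewrite big_nseq iter_mulr mulr1 => /(congr1 (@normc R)).
  rewrite normcM mulrC; have -> : normc ((- ('i * (xi 0 j)%:~R)) ^+ l) = `|(xi 0 j)%:~R| ^+ l :> R.
    elim: l => [|l IH]; first by rewrite !expr0 normc1.
    rewrite !exprS normcM IH normcN normcM -(rmorph_int (real_complex R)) /=.
    by rewrite expr0n expr1n add0r sqrtr1 mul1r addr0 sqrtr_sqr.
  move=> <-; apply: le_trans (cintegral_bound _ (K := C * (h ^+ l * (M l * l`!%:R))) _) _.
  - by apply: cblipM; [exact: cblip_foldr_cpart|exact: cblip_torus_exp].
  - move=> x; rewrite normcM normc_torus_exp mulr1.
    by have := ultra_bound_word (nseq l j) x fs bf; rewrite size_nseq -!mulrA.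
  - by apply: le_of_eq; rewrite -/K; ring.
have [j jP] := coordinate_dominates xi N0 (R := R).
have hm l : h ^+ l <= m ^+ l.
  by apply: lerXn2r; rewrite ?nnegrE ?(ltW h0) ?(ltW m0)// /m le_max lexx orbT.
set F := normc (fourier f xi) in pow *; set mx := Num.max 1 _ in jP.
have CK : 0 <= C * K by exact: mulr_ge0.
have F0 : 0 <= F by exact: normc_nneg.
have key : F * mx ^+ n <= C * K * (m ^+ n * (M n * n`!%:R)).
  rewrite /mx maxEle; case: ifP => x1.
    apply: le_trans (pow j n) _; apply: ler_wpM2l => //; exact: ler_wpM2r.
  rewrite expr1n mulr1; have := pow j 0; rewrite !expr0 weight0 !mulr1 => Fle.
  apply: le_trans Fle _; rewrite ler_peMr// -[leLHS]mulr1.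
  by apply: ler_pM; rewrite ?weight_fact_ge1// exprn_ege1.
apply: le_trans (_ : F * ((1 + N%:R) * mx) ^+ n <= _).
  apply: ler_wpM2l => //; apply: lerXn2r => //.
    by rewrite nnegrE addr_ge0 ?abs1_ge0.
  by rewrite nnegrE mulr_ge0 ?(ltW N1)// le_max ler01.
rewrite exprMn mulrCA; apply: le_trans (ler_wpM2l _ key) _.
  by rewrite exprn_ge0// ltW.
by rewrite exprMn; apply: le_of_eq; ring.
Qed.

Lemma ultra_bound_normc (C h : R) (g : 'rV[R]_N -> R[i]) x : smooth g ->
  ultra_bound M C h g -> normc (g x) <= C.
Proof.
by move=> gs /(ultra_bound_word [::] x gs); rewrite /= expr0 weight0 fact0 !mulr1.
Qed.

(** d times a shifted cosine is a combination of d times e^{i x xi} and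
    d times e^{- i x xi}; with real test functions the real and imaginary parts of d
    separate, and the real completeness result applies to each. *)
Lemma fourier_inj f g : fourier f =1 fourier g -> f = g.
Proof.
move=> fg; pose d : ultradiff M N := (-1) *: f + g.
have d0 xi : fourier d xi = 0 by rewrite fourier_lin fg mulN1r addNr.
have [bRe bIm] := cblip_ultradiff d; have pd := ultradiff_periodic d.
have bc xi b : blip (fun x : 'rV[R]_N => cos (phase xi x + b)).
  by apply: blip_phase; [exact: cos_max|exact: cos_lipschitz].
have key xi b : cintegral (fun x => d x * (cos (phase xi x + b))%:C) = 0.
  have E : (fun x => d x * (cos (phase xi x + b))%:C) = fun x =>
      ((cos b / 2) +i* (sin b / 2)) * (d x * torus_exp xi x) +
      ((cos b / 2) +i* (- sin b / 2)) * (d x * torus_exp (- xi) x).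
    apply/funext => x; rewrite !torus_expE phaseN cosN sinN cosD.
    by apply: complex_eq; rewrite ?ReD ?ImD !(ReM, ImM) /=; field.
  have b1 := cblipM (cblip_ultradiff d) (cblip_torus_exp xi).
  have b2 := cblipM (cblip_ultradiff d) (cblip_torus_exp (- xi)).
  rewrite E cintegral_lin//; last exact: cblipZ.
  by rewrite cintegralZ// -/(fourier d xi) -/(fourier d (- xi)) !d0 !mulr0 addr0.
have Re0 x : complex.Re (d x) = 0.
  apply: (torus_complete bRe) => [j {}x|xi b]; first by rewrite pd.
  have := congr1 (@complex.Re R) (key xi b) => /=.
  by under [X in torus_integral X]eq_fun do rewrite ReM /= mulr0 subr0.
have Im0 x : complex.Im (d x) = 0.
  apply: (torus_complete bIm) => [j {}x|xi b]; first by rewrite pd.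
  have := congr1 (@complex.Im R) (key xi b) => /=.
  by under [X in torus_integral X]eq_fun do rewrite ImM /= mulr0 add0r.
have -> : g = f + d by rewrite /d scaleN1r addrA subrr add0r.
have dx x : d x = 0 by apply: complex_eq; [exact: Re0|exact: Im0].
have -> : d = 0 by apply/val_inj/funext => x; exact: dx.
by rewrite addr0.
Qed.

End FourierCoefficients.

Section FourierSeries.
Context {R : realType} (M : weight_seq R) (N : nat).
Implicit Types (f g phi : ultradiff M N).

(** Trading powers of the frequency for summability: k of the n + k available
    powers are absorbed by b, and the submultiplicativity of m_n n! pays for them
    with a larger B. *)
Lemma rapid_summable (xi : nat -> 'rV[int]_N) (c : nat -> R[i]) (b : nat -> R) (A B : R) k :
  0 <= A -> 0 < B -> (forall i, 0 <= b i) ->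
  (forall i n, normc (c i) * (1 + abs1 (xi i)) ^+ n <= A * (B ^+ n * M n * n`!%:R)) ->
  (forall i, c i != 0 -> 1 <= b i * (1 + abs1 (xi i)) ^+ k) ->
  exists A' B', [/\ 0 <= A', 0 < B' & rapidly_decreasing M xi c b A' B'].
Proof.
move=> A0 B0 b0 cAB cb; have [L L1 wL] := weight_fact_submult M.
have L0 : 0 < L by lra.
exists (A * ((B * L) ^+ k * (M k * k`!%:R))), (B * L); split.
- by rewrite !mulr_ge0// ?exprn_ge0 ?mulr_ge0// ltW// weight_gt0.
- exact: mulr_gt0.
move=> i n; have w0 : 0 <= (B * L) ^+ n * M n * n`!%:R.
  by rewrite ultra_weight_ge0// ltW// mulr_gt0.
have [->|c0] := eqVneq (c i) 0.
  rewrite normc0 mul0r mulr_ge0// mulr_ge0// !mulr_ge0// ?exprn_ge0 ?mulr_ge0//;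
  by rewrite ltW// weight_gt0.
set t := 1 + abs1 (xi i); have t0 : 0 <= t by rewrite addr_ge0 ?abs1_ge0.
apply: le_trans (_ : normc (c i) * t ^+ n * (b i * t ^+ k) <= _).
  rewrite -[leLHS]mulr1; apply: ler_wpM2l; last exact: cb.
  by rewrite mulr_ge0 ?normc_nneg ?exprn_ge0.
have -> : normc (c i) * t ^+ n * (b i * t ^+ k) = normc (c i) * t ^+ (n + k) * b i.
  by rewrite exprD; ring.
apply: ler_wpM2r => //; apply: le_trans (cAB i (n + k)%N) _.
rewrite -[leRHS]mulrA; apply: ler_wpM2l => //; rewrite -mulrA.
apply: le_trans (ler_wpM2l _ (wL n k)) _; first by rewrite exprn_ge0// ltW.
by rewrite !exprMn !exprD; apply: le_of_eq; ring.
Qed.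

Lemma trig_series_ultradiff (xi : nat -> 'rV[int]_N) (c : nat -> R[i]) (b : nat -> R) (A B : R) :
  0 <= A -> 0 < B -> summable b -> rapidly_decreasing M xi c b A B ->
  exists f, (forall x, csums (fun i => c i * torus_exp (xi i) x) (f x)) /\
    forall e : R, 0 < e -> exists m,
      ultra_bound M e B (f - \sum_(i < m) c i *: ultra_exp M (xi i)).
Proof.
move=> A0 B0 sb rc; have [f [fs fp fb fx]] := trig_series_exists A0 B0 sb rc.
have [b0 [S bS]] := sb.
have fU : f \in @ultra_pred R M N.
  apply/ultra_predP; split=> //; exists (A * `|S| + 1), B; split=> //.
    by rewrite ltr_wpDl// mulr_ge0.
  move=> x a; apply: le_trans (fb _ (fun m => le_trans (bS m) (ler_norm S)) x a) _.
  by rewrite ler_wpM2r ?ultra_weight_ge0 ?(ltW B0)// lerDl.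
exists (Ultradiff fU); split=> // e e0.
have A1 : 0 < A + 1 by rewrite ltr_wpDl.
have [m0 tail] := summable_tail sb (divr_gt0 e0 A1).
exists m0.
(* the remainder is itself a trigonometric series, with a majorant of small sum *)
pose c' i := if (i < m0)%N then 0 else c i.
pose b' i := if (i < m0)%N then 0 else b i.
have b'S m : \sum_(i < m) b' i <= e / (A + 1).
  rewrite -(big_mkord xpredT b'); have [mm0|m0m] := leqP m m0.
    rewrite big_nat_cond big1; first by rewrite divr_ge0// ltW.
    by move=> i /andP[/andP[_ im] _]; rewrite /b' (leq_trans im mm0).
  rewrite (big_cat_nat (leq0n _) (ltnW m0m))//= big_nat_cond big1 ?add0r; last first.
    by move=> i /andP[/andP[_ im] _]; rewrite /b' im.
  apply: le_trans (tail m0 m (leqnn _) (ltnW m0m)); apply: le_of_eq.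
  by apply: eq_big_nat => i /andP[im _]; rewrite /b' ltnNge im.
have sb' : summable b'.
  by split; [move=> i; rewrite /b'; case: ifP|exists (e / (A + 1))].
have rc' : rapidly_decreasing M xi c' b' A B.
  move=> i n; rewrite /c' /b'; case: ifP => _; last exact: rc.
  by rewrite normc0 mul0r mulr0.
have [f' [fs' fp' fb' fx']] := trig_series_exists A0 B0 sb' rc'.
suff -> : \val (Ultradiff fU - \sum_(i < m0) c i *: ultra_exp M (xi i)) = f'.
  move=> x a; apply: le_trans (fb' _ b'S x a) _.
  apply: ler_wpM2r; first by rewrite ultra_weight_ge0// ltW.
  by rewrite mulrCA ler_piMr ?(ltW e0)// ler_pdivrMr// mul1r lerDl.
apply/funext => x; apply: csums_uniq (fx' x).
pose z i := if (i < m0)%N then c i * torus_exp (xi i) x else 0.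
have := csums_lin (-1) (csums_finite (n := m0) (z := z) _) (fx x).
have -> : \val (Ultradiff fU - \sum_(i < m0) c i *: ultra_exp M (xi i)) x =
    -1 * (\sum_(i < m0) z i) + f x.
  have E m : \val (\sum_(i < m) c i *: ultra_exp M (xi i)) x =
      \sum_(i < m) c i * torus_exp (xi i) x.
    elim: m => [|m IH]; first by rewrite !big_ord0.
    by rewrite !big_ord_recr /= -IH.
  rewrite mulN1r [RHS]addrC -[LHS]/(f x - \val (\sum_(i < m0) c i *: ultra_exp M (xi i)) x) E.
  by congr (_ - _); apply: eq_bigr => i _; rewrite /z ltn_ord.
rewrite (_ : (fun i => _) = fun i => c' i * torus_exp (xi i) x).
  by apply=> i; rewrite /z ltnNge => ->.
by apply/funext => i; rewrite /z /c'; case: ifP => _; ring.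
Qed.

Definition trig_approximable phi := exists2 h : R, 0 < h & forall e : R, 0 < e ->
  exists m (xi : nat -> 'rV[int]_N) (c : nat -> R[i]),
    ultra_bound M e h (phi - \sum_(i < m) c i *: ultra_exp M (xi i)).

(** The coefficient of e^{i x xi} is v(-xi) / (2 pi)^N: by orthogonality, pairing with
    e^{i x eta} selects the frequency -eta. *)
Lemma fourier_series (v : 'rV[int]_N -> R[i]) (A B : R) : 0 <= A -> 0 < B ->
  rapid M v A B -> exists2 f, fourier f =1 v & trig_approximable f.
Proof.
move=> A0 B0 vAB; have p0 := @pi2_gt0 R.
have T0 : 0 < (2 * pi) ^+ N :> R by rewrite exprn_gt0.
pose xi i : 'rV[int]_N := odflt 0 (pickle_inv i).
pose c i : R[i] := if (pickle_inv i : option 'rV[int]_N) is Some k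
  then (((2 * pi) ^+ N)^-1)%:C * v (- k) else 0.
have cAB i n : normc (c i) * (1 + abs1 (xi i)) ^+ n <=
    ((2 * pi) ^+ N)^-1 * A * (B ^+ n * M n * n`!%:R).
  rewrite /c /xi; case: (pickle_inv i) => [k|]; last first.
    rewrite (@normc0 R) mul0r mulr_ge0 ?ultra_weight_ge0 ?(ltW B0)//.
    by rewrite mulr_ge0// invr_ge0 ltW.
  rewrite normcM /= expr0n addr0 sqrtr_sqr ger0_norm ?invr_ge0 ?(ltW T0)// -!mulrA.
  by rewrite ler_wpM2l ?invr_ge0 ?(ltW T0)// -(abs1N k) mulrA vAB.
have cb i : c i != 0 -> 1 <= @enum_weight R N i * (1 + abs1 (xi i)) ^+ (2 * N).
  rewrite /c /enum_weight /xi; case: pickle_inv => [k|] /=; last by rewrite eqxx.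
  by move=> _; exact: lattice_weight_bound.
have sb := @summable_enum_weight R N; have [b0 _] := sb.
have TA0 : 0 <= ((2 * pi) ^+ N)^-1 * A by rewrite mulr_ge0// invr_ge0 ltW.
have [A' [B' [A'0 B'0 rc]]] := rapid_summable TA0 B0 b0 cAB cb.
have [f [fx ftail]] := trig_series_ultradiff A'0 B'0 sb rc.
exists f; last first.
  by exists B' => // e /ftail[m fm]; exists m, xi, c.
move=> eta; have cb' i : normc (c i) <= A' * (B' ^+ 0 * M 0 * (0`!)%:R) * @enum_weight R N i.
  by have := rc i 0%N; rewrite [(1 + _) ^+ 0]expr0 [_ * 1]mulr1.
have sb' : summable (fun i => A' * (B' ^+ 0 * M 0 * (0`!)%:R) * @enum_weight R N i).
  by apply: summableZ => //; rewrite mulr_ge0// ultra_weight_ge0// ltW.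
have := csums_cintegral sb' cb' fx (cblip_ultradiff f) (cblip_torus_exp eta).
move=> /csums_uniq; apply.
pose z i := c i * cintegral (fun x => torus_exp (xi i) x * torus_exp eta x).
have zE i : z i = c i * (if xi i + eta == 0 then ((2 * pi) ^+ N)%:C else 0).
  rewrite -cintegral_torus_exp /z; congr (_ * cintegral _).
  by apply/funext => x; rewrite torus_expD.
have -> : v eta = z (pickle (- eta)).
  rewrite zE /xi /c pickleK_inv /= addNr eqxx opprK mulrAC -rmorphM/= mulVf ?mul1r//.
  by rewrite gt_eqF.
apply: (@csums_single R z) => i inp; rewrite zE.
case: eqP => [/eqP|_]; last by rewrite mulr0.
rewrite addr_eq0 /xi /c; have := @pickle_invK 'rV[int]_N i.
case: (pickle_inv i) => [k|] /=; last by rewrite mul0r.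
by move=> ki /eqP kE; move: inp; rewrite -ki kE eqxx.
Qed.

(** The Fourier series of phi converges in some step to a function
    with the coefficients of phi, which is phi. *)
Lemma trig_density phi : (0 < N)%N -> trig_approximable phi.
Proof.
move=> N0; have [_ _ [C [h [C0 h0 bphi]]]] := ultradiffP phi.
have [A [B [A0 B0 FAB]]] := fourier_bound M N0 h0.
have CA : 0 <= C * A by rewrite mulr_ge0// ltW.
have [f fE fa] := fourier_series CA B0 (FAB C phi (ltW C0) bphi).
by rewrite -(fourier_inj fE).
Qed.

End FourierSeries.

(** * Ultradistributions *)

Section Distributions.
Context {R : realType} (M : weight_seq R) (N : nat).
Implicit Types (f g phi : ultradiff M N) (u : ultradist M N).

Lemma nbhs_complexP (z : R[i]) (O : set R[i]) :
  nbhs (z : (R[i])^o) O <-> exists2 e : R, 0 < e & forall w, normc (z - w) < e -> O w.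
Proof.
have nE (w : R[i]) : `|w| = (normc w)%:C by case: w.
rewrite -nbhs_ballE; split.
  move=> [[a b] /=]; rewrite ltcE /= => /andP[/eqP -> a0] zO; exists a => // w zw.
  by apply: zO; rewrite /ball /= /ball_ /= nE ltcR.
move=> [e e0 zO]; exists (e%:C); first by rewrite /= ltcR.
by move=> w; rewrite /ball /= nE ltcR => /zO.
Qed.

(** Continuity for the inductive limit topology restricts to continuity on each
    step. *)
Lemma ultradist_small u (h e : R) : 0 < h -> 0 < e -> exists2 d : R, 0 < d &
  forall g, ultra_bound M d h g -> normc (u g) <= e.
Proof.
move=> h0 e0; have uc := @ultradist_continuous R M N u 0.
have : nbhs (0 : ultradiff M N) [set g | normc (u g) < e].
  apply: (uc [set z | normc z < e]); apply/nbhs_complexP.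
  exists e => // w; rewrite linear0 sub0r normcN; exact.
rewrite nbhsE => -[U [oU U0] Ue].
have {}oU : ultra_open U by [].
have [V [_ nV VU]] := oU _ U0.
have [n hn] : exists n, h <= n.+1%:R.
  by exists (Num.truncn h); exact/ltW/truncnS_gt.
have [d d0 dV] := nV n; exists (d / 2); first by rewrite divr_gt0.
move=> g bg; apply/ltW/Ue; rewrite -[g]add0r; apply/VU/dV.
apply: (@le_lt_trans _ _ (d / 2)%:E); last by rewrite lte_fin; lra.
apply/ultranorm_le; first by rewrite ltr0n.
by apply: ultra_bound_le hn bg; rewrite ?divr_ge0 ?ltW.
Qed.

Lemma ultradist_fourierE u f : (0 < N)%N ->
  (forall xi, u (ultra_exp M xi) = fourier f xi) -> forall phi, u phi = torus_pairing f phi.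
Proof.
move=> N0 uf phi; rewrite torus_pairingE; have bf := cblip_ultradiff f.
have [h h0 approx] := trig_density phi N0.
apply/eqP; rewrite -subr_eq0; apply/eqP/eq0_normc/eqP; rewrite eq_le normc_nneg andbT.
apply/ler_addgt0Pr => e e0; rewrite add0r.
have [K [K0 fK]] : exists K, 0 < K /\ forall x, normc (f x) <= K.
  have [fs _ [C [h' [C0 _ fb]]]] := ultradiffP f; exists C; split=> // x.
  exact: ultra_bound_normc fs fb.
have T0 : 0 < 2 * (2 * pi) ^+ N :> R by rewrite mulr_gt0// exprn_gt0// pi2_gt0.
have e20 : 0 < e / 2 by rewrite divr_gt0.
have [d d0 ud] := ultradist_small u h0 e20.
pose d' := Num.min d (e / 2 / (2 * (2 * pi) ^+ N * K)).
have TK : 0 < 2 * (2 * pi) ^+ N * K by exact: mulr_gt0.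
have d'0 : 0 < d' by rewrite lt_min d0 divr_gt0.
have [m [xi [c bS]]] := approx d' d'0.
set S := \sum_(i < m) _ in bS; pose r := phi - S.
have bcS : cblip S by exact: cblip_ultradiff.
have bcr : cblip r by exact: cblip_ultradiff.
have uS : u S = cintegral (fun x => f x * S x).
  have SE x : S x = \sum_(i < m) c i * torus_exp (xi i) x.
    rewrite /S; elim: (m) => [|l IH]; first by rewrite !big_ord0.
    by rewrite !big_ord_recr /= -IH.
  rewrite linear_sum /=.
  transitivity (\sum_(i < m) cintegral (fun x => c i * (f x * torus_exp (xi i) x))).
    apply: eq_bigr => i _; rewrite linearZ /= uf cintegralZ//.
    by apply: cblipM => //; exact: cblip_torus_exp.
  rewrite -cintegral_sum; last first.
    by move=> i; apply/cblipZ/cblipM => //; exact: cblip_torus_exp.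
  congr cintegral; apply/funext => x; rewrite SE mulr_sumr.
  by apply: eq_bigr => i _; ring.
have phiE : phi = 1 *: r + S by rewrite scale1r /r subrK.
have -> : u phi - cintegral (fun x => f x * phi x) = u r - cintegral (fun x => f x * r x).
  rewrite {1}phiE linearP -[1 *: u r]/(1 * u r) mul1r uS.
  have -> : (fun x => f x * phi x) = (fun x => 1 * (f x * r x) + f x * S x).
    apply/funext => x; rewrite phiE -[(1 *: r + S) x]/(1 * r x + S x); ring.
  rewrite cintegral_lin; [ring|exact: cblipM|exact: cblipM].
have [rs _ _] := ultradiffP r.
have d'le : d' <= d by rewrite ge_min lexx.
have br : ultra_bound M d h r.
  move=> x a; apply: le_trans (bS x a) _.
  by apply: ler_wpM2r => //; rewrite ultra_weight_ge0// ltW.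
apply: le_trans (le_normcD _ _) _; rewrite normcN [leRHS]splitr; apply: lerD; first exact: ud.
apply: le_trans (cintegral_bound (K := K * d') (cblipM bf bcr) _) _.
  move=> x; rewrite normcM; apply: ler_pM; rewrite ?normc_nneg//.
  exact: ultra_bound_normc rs bS.
rewrite mulrA -ler_pdivlMl// mulrC ge_min lexx orbT//.
Qed.

(** Conversely a linear functional bounded on every step is continuous: the sets
    |U| < e are absolutely convex and meet each step in a neighbourhood of 0. *)
Lemma ultradist_exists (U : ultradiff M N -> R[i]) :
  (forall c f g, U (c *: f + g) = c * U f + U g) ->
  (forall h : R, 0 < h -> exists2 K : R, 0 <= K & forall C f, 0 <= C -> ultra_bound M C h f ->
    normc (U f) <= K * C) ->
  exists u : ultradist M N, forall phi, u phi = U phi.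
Proof.
move=> Ulin Ub.
pose UL : {linear ultradiff M N -> (R[i])^o} :=
  HB.pack (U : ultradiff M N -> (R[i])^o) (GRing.isLinear.Build R[i] _ _ _ U Ulin).
suff cU : continuous UL by exists (Ultradist cU).
apply/continuousP => O oO; suff : ultra_open (UL @^-1` O) by [].
move=> f Of; have /nbhs_complexP[e e0 eO] : nbhs (UL f) O by exact: open_nbhs_nbhs.
exists [set g | normc (U g) < e]; split.
- move=> g g' a b /= ge g'e ab; rewrite Ulin -[b *: g']addr0 Ulin.
  have -> : U 0 = 0 by rewrite -[U]/(UL : _ -> _) linear0.
  rewrite addr0; apply: le_lt_trans (le_normcD _ _) _; rewrite !normcM.
  have a0 := normc_nneg a; have b0 := normc_nneg b.
  pose mx := Num.max (normc (U g)) (normc (U g')).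
  have mxe : mx < e by rewrite gt_max ge.
  have mx0 : 0 <= mx by rewrite le_max normc_nneg.
  apply: le_lt_trans mxe; apply: le_trans (_ : (normc a + normc b) * mx <= _).
    by rewrite mulrDl lerD// ler_wpM2l// le_max lexx ?orbT.
  by rewrite -[leRHS]mul1r ler_wpM2r.
- move=> n; have [|K K0 UK] := Ub n.+1%:R; first by rewrite ltr0n.
  have K1 : 0 < K + 1 by rewrite ltr_wpDl.
  exists (e / (K + 1)); first by rewrite divr_gt0.
  move=> g /ltW/ultranorm_le => /(_ (ltr0Sn _ _)) bg /=.
  apply: le_lt_trans (UK _ _ _ bg) _; first by rewrite divr_ge0 ?(ltW e0) ?(ltW K1).
  by rewrite mulrA ltr_pdivrMr// mulrC ltr_pM2l// ltrDl.
- move=> g /= ge; apply: eO.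
  rewrite -[X in normc X]/(U f - U (f + g)) -[f in f + g]scale1r Ulin mul1r opprD addrA.
  by rewrite subrr sub0r normcN.
Qed.

End Distributions.

(** * Symbols and hypoellipticity *)

Section WeightInfimum.
Context {R : realType} (M : weight_seq R) (N : nat).
Implicit Types (xi : 'rV[int]_N) (eps : R).

Definition weight_ratio eps xi n : R :=
  M n * n`!%:R / (eps ^+ n * (1 + euclid_norm R xi) ^+ n).

Definition weight_inf eps xi : R := inf [set weight_ratio eps xi n | n in [set: nat]].

Lemma weight_ratio_gt0 eps xi n : 0 < eps -> 0 < weight_ratio eps xi n.
Proof.
move=> e0; have t0 : 0 < 1 + euclid_norm R xi by rewrite ltr_wpDr ?euclid_norm_ge0.
by rewrite divr_gt0 ?mulr_gt0 ?exprn_gt0 ?weight_gt0// ltr0n fact_gt0.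
Qed.

Lemma weight_inf_le eps xi n : 0 < eps -> weight_inf eps xi <= weight_ratio eps xi n.
Proof.
move=> e0; apply: ge_inf; last by exists n.
by exists 0 => _ [m _ <-]; exact/ltW/weight_ratio_gt0.
Qed.

Lemma le_weight_inf eps xi (y : R) : (forall n, y <= weight_ratio eps xi n) ->
  y <= weight_inf eps xi.
Proof.
by move=> yle; apply: lb_le_inf; [exists (weight_ratio eps xi 0), 0%N|move=> _ [n _ <-]].
Qed.

(** t^n / n! is bounded in n and m_n >= 1. *)
Lemma weight_inf_gt0 eps xi : 0 < eps -> 0 < weight_inf eps xi.
Proof.
move=> e0; have t0 : 0 < 1 + euclid_norm R xi by rewrite ltr_wpDr ?euclid_norm_ge0.
have [K K0 Kn] := exp_fact_bounded (eps * (1 + euclid_norm R xi)).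
apply: (@lt_le_trans _ _ K^-1); first by rewrite invr_gt0.
apply: le_weight_inf => n; rewrite /weight_ratio -exprMn.
have et0 : 0 < (eps * (1 + euclid_norm R xi)) ^+ n by rewrite exprn_gt0// mulr_gt0.
rewrite ler_pdivlMr// ler_pdivrMl//; have := Kn n.
rewrite ger0_norm; last by rewrite mulr_ge0// ltW.
move/le_trans; apply; apply: ler_wpM2l; first exact: ltW.
by rewrite ler_peMl ?weight_ge1.
Qed.

Lemma weight_ratioN eps xi n : weight_ratio eps (- xi) n = weight_ratio eps xi n.
Proof. by rewrite /weight_ratio euclid_normN. Qed.

Lemma weight_infN eps xi : weight_inf eps (- xi) = weight_inf eps xi.
Proof.
by congr inf; apply: eq_imagel => n _; exact: weight_ratioN.
Qed.

End WeightInfimum.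

Section SymbolNorm.
Context {R : realType} {N k : nat} (P : 'I_k -> mpoly N R[i]).

Lemma symbol_norm_ge xi j : normc (symbol (P j) xi) <= symbol_norm P xi.
Proof. exact: (le_bigmax _ (fun j => normc (symbol (P j) xi)) j). Qed.

Lemma symbol_norm_mul_le xi (y X : R) : 0 <= y -> 0 <= X ->
  (forall j, normc (symbol (P j) xi) * y <= X) -> symbol_norm P xi * y <= X.
Proof.
rewrite le_eqVlt => /predU1P[<-|y0] X0 PX; first by rewrite mulr0.
rewrite -ler_pdivlMr//; apply: bigmax_le; first by rewrite divr_ge0// ltW.
by move=> j _; rewrite ler_pdivlMr.
Qed.

End SymbolNorm.

Section Hypoelliptic.
Context {R : realType} (M : weight_seq R) (N k : nat) (P : 'I_k -> mpoly N R[i]).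
Hypothesis N_gt0 : (0 < N)%N.

Lemma abs1_le_scaled_euclid (xi : 'rV[int]_N) :
  1 + abs1 xi <= (1 + N%:R) * (1 + euclid_norm R xi).
Proof.
have := abs1_le_euclid_norm xi (R := R); have := euclid_norm_ge0 xi (R := R).
have : 0 <= N%:R :> R by [].
by rewrite mulrDl mul1r mulrDr mulr1; lra.
Qed.

Definition symbol_bound := forall eps : R, 0 < eps -> exists2 r : R, 0 < r &
  forall xi : 'rV[int]_N, r <= euclid_norm R xi -> weight_inf M eps xi <= symbol_norm P xi.

Lemma rapid_le (v : 'rV[int]_N -> R[i]) (A B A' B' : R) : 0 <= A <= A' -> 0 <= B <= B' ->
  rapid M v A B -> rapid M v A' B'.
Proof.
move=> /andP[A0 AA'] /andP[B0 BB'] vAB xi n; apply: le_trans (vAB xi n) _.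
apply: ler_pM => //; first exact: ultra_weight_ge0.
exact: ultra_weight_le.
Qed.

(** Division by the symbol does not spoil rapid decrease.  Splitting n + k powers
    between a factor indexed by n and one indexed by k makes the infimum over k
    cancel the lower bound for |P|. *)
Lemma rapid_of_symbol_bound (v : 'rV[int]_N -> R[i]) (A B : R) :
  symbol_bound -> 0 < A -> 0 < B ->
  (forall j, rapid M (fun xi => symbol (P j) (- xi) * v xi) A B) ->
  exists A' B', [/\ 0 <= A', 0 < B' & rapid M v A' B'].
Proof.
move=> Pb A0 B0 PvAB; have [L L1 wL] := weight_fact_submult M.
have L0 : 0 < L by lra.
have LB0 : 0 < L * B by exact: mulr_gt0.
have eps0 : 0 < (L * B)^-1 by rewrite invr_gt0.
have [r r0 rP] := Pb _ eps0.
have w0 n : 0 <= M n * n`!%:R by apply: le_trans (weight_fact_ge1 M n).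
have N1 : 0 < 1 + N%:R :> R by rewrite ltr_wpDr.
pose B' := (1 + N%:R) * (L * B).
have B'0 : 0 < B' by exact: mulr_gt0.
have far xi : r <= euclid_norm R xi -> forall n,
    normc (v xi) * (1 + abs1 xi) ^+ n <= A * (B' ^+ n * M n * n`!%:R).
  move=> rxi n; set t := 1 + euclid_norm R xi.
  have t1 : 0 < t by rewrite ltr_wpDr ?euclid_norm_ge0.
  set T := weight_inf M (L * B)^-1 xi.
  have T0 : 0 < T by exact: weight_inf_gt0.
  have TP : T <= symbol_norm P (- xi) by rewrite /T -weight_infN; apply: rP; rewrite euclid_normN.
  have ratioE m : weight_ratio M (L * B)^-1 xi m = (L * B) ^+ m * (M m * m`!%:R) / t ^+ m.
    by rewrite /weight_ratio invfM exprVn invrK -/t; ring.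
  have step m : T * normc (v xi) * t ^+ m <= A * (B ^+ m * M m * m`!%:R).
    apply: le_trans (_ : symbol_norm P (- xi) * (normc (v xi) * t ^+ m) <= _).
      rewrite -mulrA; apply: ler_wpM2r => //.
      by rewrite mulr_ge0 ?normc_nneg// exprn_ge0// ltW.
    apply: symbol_norm_mul_le.
    - by rewrite mulr_ge0 ?normc_nneg// exprn_ge0// ltW.
    - by rewrite mulr_ge0 ?(ltW A0)// ultra_weight_ge0// ltW.
    - move=> j; rewrite mulrA -normcM; apply: le_trans (PvAB j xi m).
      apply: ler_wpM2l; first exact: normc_nneg.
      apply: lerXn2r; rewrite ?nnegrE ?addr_ge0 ?abs1_ge0 ?euclid_norm_ge0//.
      by rewrite /t lerD2l euclid_norm_le_abs1.
  have prod m : T * normc (v xi) / (A * weight_ratio M (L * B)^-1 xi n) <=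
      weight_ratio M (L * B)^-1 xi m.
    rewrite ler_pdivrMr; last by rewrite mulr_gt0// weight_ratio_gt0.
    have -> : weight_ratio M (L * B)^-1 xi m * (A * weight_ratio M (L * B)^-1 xi n) =
        A * (B ^+ (n + m) * (L ^+ (n + m) * ((M n * n`!%:R) * (M m * m`!%:R)))) / t ^+ (n + m).
      by rewrite !ratioE !exprMn !exprD invfM; ring.
    rewrite ler_pdivlMr ?exprn_gt0//; apply: le_trans (step (n + m)%N) _.
    apply: ler_wpM2l; first exact: ltW.
    by rewrite -mulrA; apply: ler_wpM2l; rewrite ?exprn_ge0 ?(ltW B0).
  have := le_weight_inf prod; rewrite -/T ler_pdivrMr; last first.
    by rewrite mulr_gt0// weight_ratio_gt0.
  rewrite ler_pM2l// ratioE mulrA ler_pdivlMr ?exprn_gt0// => vle.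
  apply: le_trans (_ : normc (v xi) * ((1 + N%:R) * t) ^+ n <= _).
    apply: ler_wpM2l; first exact: normc_nneg.
    apply: lerXn2r; rewrite ?nnegrE ?addr_ge0 ?abs1_ge0 ?mulr_ge0 ?(ltW N1) ?(ltW t1)//.
    exact: abs1_le_scaled_euclid.
  have -> : A * (B' ^+ n * M n * n`!%:R) =
      (1 + N%:R) ^+ n * (A * ((L * B) ^+ n * (M n * n`!%:R))) by rewrite exprMn; ring.
  rewrite exprMn mulrCA. apply: ler_wpM2l => //; rewrite exprn_ge0// ltW.
have near xi : exists K, 0 <= K /\ forall n,
    normc (v xi) * (1 + abs1 xi) ^+ n <= K * (B' ^+ n * M n * n`!%:R).
  have [K K0 Kn] := exp_fact_bounded ((1 + abs1 xi) / B').
  exists (normc (v xi) * K); split; first by rewrite mulr_ge0 ?normc_nneg ?ltW.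
  move=> n; rewrite -[leRHS]mulrA; apply: ler_wpM2l; first exact: normc_nneg.
  have := Kn n; rewrite ger0_norm; last by rewrite divr_ge0 ?addr_ge0 ?abs1_ge0// ltW.
  rewrite expr_div_n ler_pdivrMr ?exprn_gt0// => h; apply: le_trans h _.
  rewrite -[leLHS]mulrA; apply: ler_wpM2l; first exact: ltW.
  rewrite [leLHS]mulrC -[leRHS]mulrA; apply: ler_wpM2l; first by rewrite exprn_ge0// ltW.
  by rewrite ler_peMl ?weight_ge1.
have /choice[K KP] := near.
have [m rm] : exists m : nat, r <= m%:R.
  by exists (Num.truncn r).+1; exact/ltW/truncnS_gt.
exists (A + \sum_(xi <- @box N m) K xi), B'; split=> //.
  by rewrite addr_ge0 ?(ltW A0)// sumr_ge0// => xi _; have [] := KP xi.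
move=> xi n; have [rxi|xir] := leP r (euclid_norm R xi).
  apply: le_trans (far xi rxi n) _; apply: ler_wpM2r.
    by rewrite ultra_weight_ge0// ltW.
  by rewrite lerDl sumr_ge0// => eta _; have [] := KP eta.
have xibox : xi \in @box N m.
  apply: mem_box => j; rewrite -(ltr_nat R); apply: lt_le_trans rm.
  apply: le_lt_trans xir; rewrite natr_absz intr_norm.
  exact: coordinate_le_euclid_norm.
have [_ /(_ n) h] := KP xi; apply: le_trans h _; apply: ler_wpM2r.
  by rewrite ultra_weight_ge0// ltW.
rewrite (big_rem xi xibox) /= addrCA lerDl addr_ge0 ?(ltW A0)// sumr_ge0//.
by move=> eta _; have [] := KP eta.
Qed.

Lemma symbol_bound_hypoelliptic : symbol_bound -> globally_hypoelliptic M P.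
Proof.
move=> Pb u /choice[f fP]; pose v xi := u (ultra_exp M xi).
have fv j xi : fourier (f j) xi = symbol (P j) (- xi) * v xi.
  have := fP j (ultra_exp M xi).
  rewrite -[ultradist_diffop _ _ _]/(u (ultra_diffop_tr (P j) (ultra_exp M xi))).
  by rewrite diffop_tr_ultra_exp linearZ => /esym.
have fAB j : exists AB : R * R, [/\ 0 <= AB.1, 0 <= AB.2 & rapid M (fourier (f j)) AB.1 AB.2].
  have [_ _ [C [h [C0 h0 bf]]]] := ultradiffP (f j).
  have [A [B [A0 B0 AB]]] := fourier_bound M N_gt0 h0.
  exists (C * A, B); split; [by rewrite mulr_ge0 ?ltW|exact: ltW|exact: AB (ltW C0) bf].
have /choice[AB ABP] := fAB.
pose A := 1 + \sum_j (AB j).1; pose B := 1 + \sum_j (AB j).2.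
have [sA sB] : 0 <= \sum_j (AB j).1 /\ 0 <= \sum_j (AB j).2.
  by split; apply: sumr_ge0 => j _; have [] := ABP j.
have A0 : 0 < A by rewrite ltr_wpDr.
have B0 : 0 < B by rewrite ltr_wpDr.
have [|A' [B' [A'0 B'0 vAB]]] := @rapid_of_symbol_bound v A B Pb A0 B0.
  move=> j; have [a0 b0 ab] := ABP j.
  have : rapid M (fourier (f j)) A B.
    apply: rapid_le ab.
      rewrite a0 /A (bigD1 j)//= addrCA lerDl addr_ge0// sumr_ge0// => i _.
      by have [] := ABP i.
    rewrite b0 /B (bigD1 j)//= addrCA lerDl addr_ge0// sumr_ge0// => i _.
    by have [] := ABP i.
  by congr (rapid M _ A B); apply/funext => xi; exact: fv.
have [g gv _] := fourier_series A'0 B'0 vAB.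
by exists g; apply: ultradist_fourierE => // xi; rewrite gv.
Qed.

(** Doubling the norm at each step makes the frequencies distinct and the series
    of their inverse norms convergent. *)
Lemma sparse_sequence (Q : 'rV[int]_N -> Prop) :
  (forall r : R, exists xi, r <= euclid_norm R xi /\ Q xi) ->
  exists xi : nat -> 'rV[int]_N,
    [/\ forall i, Q (xi i), forall i, 2 ^+ i <= euclid_norm R (xi i) & injective xi].
Proof.
move=> /choice[F FP].
pose xi i := iter i (fun eta => F (2 * euclid_norm R eta)) (F 1).
have grow i : 2 * euclid_norm R (xi i) <= euclid_norm R (xi i.+1).
  by have [] := FP (2 * euclid_norm R (xi i)).
have big i : 2 ^+ i <= euclid_norm R (xi i).
  elim: i => [|i IH]; first by have [] := FP 1; rewrite expr0.
  by apply: le_trans (grow i); rewrite exprS ler_pM2l.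
exists xi; split=> //; first by case=> [|i]; [have [] := FP 1|have [] := FP (2 * euclid_norm R (xi i))].
have inc : {homo (fun i => euclid_norm R (xi i)) : i j / (i < j)%N >-> i < j}.
  apply: homo_ltn => [y x z|i]; first exact: lt_trans.
  apply: lt_le_trans (grow i); have : 0 < euclid_norm R (xi i).
    by apply: lt_le_trans (big i); rewrite exprn_gt0.
  lra.
move=> i j xij; have [ij|ji|//] := ltngtP i j.
  by have := inc _ _ ij; rewrite xij ltxx.
by have := inc _ _ ji; rewrite xij ltxx.
Qed.

(** The counterexample u = \sum_i e^{i x xi_i} along a sparse sequence violating the
    symbol condition. *)
Lemma hypoelliptic_symbol_bound : globally_hypoelliptic M P -> symbol_bound.
Proof.
move=> hyp eps eps0; apply: contrapT => nex.
have [|xi [small big inj]] := @sparse_sequence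
  (fun xi => symbol_norm P xi < weight_inf M eps xi).
  move=> r; apply: contrapT => h; apply: nex; exists (Num.max 1 r).
    by rewrite lt_max ltr01.
  move=> eta; rewrite ge_max => /andP[_ reta]; rewrite leNgt; apply/negP => lt_eta.
  by apply: h; exists eta.
have T0 : 0 < (2 * pi) ^+ N :> R by rewrite exprn_gt0// pi2_gt0.
pose b i : R := 2 ^- i.
have sb : summable b by exact: summable_half.
have [b0 [S bS]] := sb.
have ba i : 1 <= b i * (1 + abs1 (xi i)) ^+ 1.
  rewrite expr1 /b ler_pdivlMl ?exprn_gt0// mulr1.
  apply: le_trans (big i) _; apply: le_trans (euclid_norm_le_abs1 _) _.
  by rewrite lerDr.
have N1 : 0 < 1 + N%:R :> R by rewrite ltr_wpDr.
have fj j : exists f : ultradiff M N, forall phi : ultradiff M N,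
    csums (fun i => symbol (P j) (xi i) * fourier phi (xi i)) (torus_pairing f phi).
  have cB i n : normc (symbol (P j) (xi i)) * (1 + abs1 (xi i)) ^+ n <=
      1 * (((1 + N%:R) / eps) ^+ n * M n * n`!%:R).
    set t := 1 + euclid_norm R (xi i).
    have t0 : 0 < t by rewrite ltr_wpDr ?euclid_norm_ge0.
    apply: le_trans (_ : weight_ratio M eps (xi i) n * ((1 + N%:R) * t) ^+ n <= _).
      apply: ler_pM; rewrite ?normc_nneg ?exprn_ge0 ?addr_ge0 ?abs1_ge0//.
        apply: le_trans (symbol_norm_ge P (xi i) j) _; apply: le_trans (ltW (small i)) _.
        exact: weight_inf_le.
      apply: lerXn2r; rewrite ?nnegrE ?addr_ge0 ?abs1_ge0 ?mulr_ge0 ?(ltW N1) ?(ltW t0)//.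
      exact: abs1_le_scaled_euclid.
    apply: le_of_eq; rewrite /weight_ratio -/t !exprMn exprVn.
    by field; rewrite !expf_neq0// gt_eqF.
  have Be : 0 < (1 + N%:R) / eps by rewrite divr_gt0.
  have [A' [B' [A'0 B'0 rc]]] := rapid_summable ler01 Be b0 cB (fun i _ => ba i).
  have [f [fx _]] := trig_series_ultradiff A'0 B'0 sb rc.
  exists f => phi.
  have cb i : normc (symbol (P j) (xi i)) <= A' * (B' ^+ 0 * M 0 * (0`!)%:R) * b i.
    by have := rc i 0%N; rewrite [(1 + _) ^+ 0]expr0 [_ * 1]mulr1.
  have sb' : summable (fun i => A' * (B' ^+ 0 * M 0 * (0`!)%:R) * b i).
    by apply: summableZ => //; rewrite mulr_ge0// ultra_weight_ge0// ltW.
  have := csums_cintegral sb' cb fx (cblip_ultradiff f) (cblip_ultradiff phi).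
  congr csums; apply/funext => i; congr (_ * cintegral _).
  by apply/funext => x; rewrite mulrC.
have fb (h : R) : 0 < h -> exists2 K : R, 0 <= K & forall C (phi : ultradiff M N), 0 <= C ->
    ultra_bound M C h phi -> forall i, normc (fourier phi (xi i)) <= K * C * b i.
  move=> h0; have [A [B [A0 B0 AB]]] := fourier_bound M N_gt0 h0.
  exists (A * (B ^+ 1 * M 1 * (1`!)%:R)).
    by rewrite mulr_ge0 ?(ltW A0)// ultra_weight_ge0// ltW.
  move=> C phi C0 bphi i; apply: le_trans (_ : normc (fourier phi (xi i)) *
      (b i * (1 + abs1 (xi i)) ^+ 1) <= _).
    by rewrite ler_peMr ?normc_nneg.
  rewrite mulrCA mulrC; apply: ler_wpM2r => //.
  by apply: le_trans (AB C phi C0 bphi (xi i) 1%N) _; apply: le_of_eq; ring.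
have ex (phi : ultradiff M N) : exists w, csums (fun i => fourier phi (xi i)) w.
  have [_ _ [C [h [C0 h0 bphi]]]] := ultradiffP phi.
  have [K K0 Kb] := fb h h0.
  apply: (summable_csums (summableZ _ sb) (Kb C phi (ltW C0) bphi)).
  by rewrite mulr_ge0// ltW.
have /choice[U UP] := ex.
have [c f g|h h0|u uU] := @ultradist_exists R M N U.
- apply: csums_uniq (UP _) _.
  have := csums_lin c (UP f) (UP g); congr csums; apply/funext => i.
  by rewrite fourier_lin.
- have [K K0 Kb] := fb h h0; exists (K * S).
    by rewrite mulr_ge0//; apply: le_trans (bS 0%N); rewrite big_ord0.
  move=> C phi C0 bphi; apply: csums_le (UP phi) _ => m.
  apply: le_trans (normc_sum _ _ _) _.
  apply: le_trans (_ : \sum_(i < m) K * C * b i <= _).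
    by apply: ler_sum => i _; exact: Kb bphi i.
  by rewrite -mulr_sumr [leRHS]mulrAC; apply: ler_wpM2l (bS m); rewrite mulr_ge0.
have [j|g gP] := hyp u.
  have [f fP] := fj j; exists f => phi.
  rewrite -[LHS]/(u (ultra_diffop_tr (P j) phi)) uU.
  apply: csums_uniq (UP _) _; have := fP phi; congr csums; apply/funext => i.
  by rewrite -(fourier_diffop_tr (P j) phi).
(* were u a function g of E_M, its coefficients at -xi_i would be constant instead of
   decreasing *)
have gxi i : fourier g (- xi i) = ((2 * pi) ^+ N)%:C.
  have := gP (ultra_exp M (- xi i)); rewrite uU => UE.
  rewrite -[LHS]/(torus_pairing g (ultra_exp M (- xi i))) -UE.
  apply: csums_uniq (UP _) _.
  pose z l : R[i] := fourier (ultra_exp M (- xi i)) (xi l).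
  have -> : ((2 * pi) ^+ N)%:C = z i by rewrite /z fourier_ultra_exp addNr eqxx.
  apply: (@csums_single R z) => l li; rewrite /z fourier_ultra_exp.
  by rewrite addrC subr_eq0 (inj_eq inj) (negbTE li).
have [_ _ [C [h [C0 h0 bg]]]] := ultradiffP g.
have [A [B [A0 B0 AB]]] := fourier_bound M N_gt0 h0.
pose X := C * A * (B ^+ 1 * M 1 * (1`!)%:R).
have le_X i : (2 * pi) ^+ N * 2 ^+ i <= X.
  apply: le_trans (AB C g (ltW C0) bg (- xi i) 1%N); rewrite gxi abs1N expr1.
  rewrite /= expr0n addr0 sqrtr_sqr ger0_norm ?(ltW T0)//; apply: ler_wpM2l; first exact: ltW.
  apply: le_trans (big i) _; apply: le_trans (euclid_norm_le_abs1 _) _.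
  by rewrite lerDr.
pose n := (Num.truncn (X / (2 * pi) ^+ N)).+1.
have : X / (2 * pi) ^+ N < 2 ^+ n.
  apply: lt_le_trans (truncnS_gt _) _; rewrite -natrX ler_nat; exact/ltnW/ltn_expl.
by rewrite ltr_pdivrMr// mulrC ltNge le_X.
Qed.

End Hypoelliptic.

Theorem theorem6p2 (R : realType) (M : weight_seq R) (N k : nat)
    (hN : (0 < N)%N) (hk : (0 < k)%N) (P : 'I_k -> mpoly N R[i]) :
  globally_hypoelliptic M P <->
  forall eps : R, 0 < eps -> exists2 Reps : R, 0 < Reps &
    forall xi : 'rV[int]_N, Reps <= euclid_norm R xi ->
      inf [set M n * n`!%:R / (eps ^+ n * (1 + euclid_norm R xi) ^+ n) | n in [set: nat]]
      <= symbol_norm P xi.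
Proof.
split; first exact: hypoelliptic_symbol_bound.
exact: symbol_bound_hypoelliptic.
Qed.
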